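(* Let $k\ge1$, $\sigma>0$ and $\beta\ge1$, and let the standing assumptions stated in the context hold. Then the solution $\mathbf q_h'$ of the linearized semidiscrete DG-NIPG scheme described in the context satisfies $$\|\mathbf q_h'(T)\|_{L^2(\Omega)}^2+\nu_T\int_0^T\|\mathbf q_h'\|_{\mathrm{DG}}^2\,\mathrm dt\le c_1\left(\|\mathbf q_h'(0)\|_{L^2(\Omega)}^2+\int_0^T\|\mathbf r_{\mathrm{eq}}\|_{L^2(\Omega)}^2\,\mathrm dt\right),$$ where the constant $c_1$ is independent of the mesh size $h$ but may depend on $T$, the coefficient bounds, the bounds of a symmetrizer of the linearized flux Jacobians, $f_c$, $\nu_T^{-1}$, and $\sigma$.
   Context: **Nonlinear model.** $\Omega\subset\mathbb R^2$ is a bounded polygonal domain, $T>0$, $g>0$, $f_c$ the Coriolis parameter, $\nu_T>0$ the viscosity, $b\in W^{1,\infty}(\Omega)$ the bottom field, $\phi_b=gb$. For $\mathbf q=(\phi_\eta,U,V)^\top$ and $\phi=\phi_\eta+\phi_b>0$ the model is $\partial_t\mathbf q+\nabla\cdot\mathcal F(\mathbf q)-\Delta S(\mathbf q)=R(\mathbf q)$ with $$\mathcal F(\mathbf q)=\begin{pmatrix}U&V\\ U^2/\phi+\tfrac12(\phi^2-\phi_b^2)&UV/\phi\\ UV/\phi&V^2/\phi+\tfrac12(\phi^2-\phi_b^2)\end{pmatrix},\quad S(\mathbf q)=\mathbf B\mathbf q,\ \mathbf B=\operatorname{diag}(0,\nu_T,\nu_T),$$ $$R(\mathbf q)=(0,\;f_cV+\phi_\eta\partial_x\phi_b,\;-f_cU+\phi_\eta\partial_y\phi_b)^\top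 .$$ **Linearization.** $\mathbf q_{\mathrm{eq}}=(\phi_{\eta,\mathrm{eq}},U_{\mathrm{eq}},V_{\mathrm{eq}})^\top$ is a steady smooth reference state, $\phi_{\mathrm{eq}}=\phi_{\eta,\mathrm{eq}}+\phi_b$, $\mathbf u_{\mathrm{eq}}=(U_{\mathrm{eq}},V_{\mathrm{eq}})^\top/\phi_{\mathrm{eq}}$. The perturbation $\mathbf q'=\mathbf q-\mathbf q_{\mathrm{eq}}$ is governed by $$\partial_t\mathbf q'+\partial_x(\mathbf A_1\mathbf q')+\partial_y(\mathbf A_2\mathbf q')-\Delta(\mathbf B\mathbf q')=\mathbf C\mathbf q'+\mathbf r_{\mathrm{eq}},$$ with $$\mathbf A_1=\begin{pmatrix}0&1&0\\ \phi_{\mathrm{eq}}-U_{\mathrm{eq}}^2/\phi_{\mathrm{eq}}^2&2U_{\mathrm{eq}}/\phi_{\mathrm{eq}}&0\\ -U_{\mathrm{eq}}V_{\mathrm{eq}}/\phi_{\mathrm{eq}}^2&V_{\mathrm{eq}}/\phi_{\mathrm{eq}}&U_{\mathrm{eq}}/\phi_{\mathrm{eq}}\end{pmatrix},\quad \mathbf A_2=\begin{pmatrix}0&0&1\\ -U_{\mathrm{eq}}V_{\mathrm{eq}}/\phi_{\mathrm{eq}}^2&V_{\mathrm{eq}}/\phi_{\mathrm{eq}}&U_{\mathrm{eq}}/\phi_{\mathrm{eq}}\\ \phi_{\mathrm{eq}}-V_{\mathrm{eq}}^2/\phi_{\mathrm{eq}}^2&0&2V_{\mathrm{eq}}/\phi_{\mathrm{eq}}\end{pmatrix},$$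 $$\mathbf C=\begin{pmatrix}0&0&0\\ \partial_x\phi_b&0&f_c\\ \partial_y\phi_b&-f_c&0\end{pmatrix},\qquad \mathbf r_{\mathrm{eq}}=R(\mathbf q_{\mathrm{eq}})-\nabla\cdot\mathcal F(\mathbf q_{\mathrm{eq}})+\Delta S(\mathbf q_{\mathrm{eq}}).$$ $\mathbf q$ and $\mathbf q_{\mathrm{eq}}$ satisfy the same boundary conditions on $\Gamma_{\mathrm D}$, so $\mathbf q'$ satisfies homogeneous ones. **Mesh, spaces, traces.** $Q_h$ is a triangulation of $\Omega$ with mesh size $h$ and facets $\mathcal E_h=\Gamma_h\cup\Gamma_{\mathrm D}$ (interior and Dirichlet; periodic pairs are treated as interior). $V_k=\{v\in L^2(\Omega):v|_K\in\mathbb P_k(K)\ \forall K\}$, $\mathbf V_h=V_k^3$. On an interior facet $e=\partial K^+\cap\partial K^-$ the unit normal $\mathbf n=(n_x,n_y)^\top$ points from $K^+$ to $K^-$; $\{\!\{z\}\!\}=\frac12(z^++z^-)$, $[[z]]=z^+-z^-$ componentwise. **Linearized semidiscrete scheme.** $\mathbf q_h'(t)\in\mathbf V_h$ satisfies, for all $\mathbf w_h\in\mathbf V_h$ and $t\in(0,T]$, $$(\partial_t\mathbf q_h',\mathbf w_h)_\Omega+b_h(\mathbf q_h',\mathbf w_h)+a_h(\mathbf q_h',\mathbf w_h)=(\mathbf C\mathbf q_h'+\mathbf r_{\mathrm{eq}},\mathbf w_h)_\Omega ,$$ where $(\cdot,\cdot)_\Omega$ is the $L^2(\Omega)$ inner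 product. The hyperbolic form with (linearized) local Lax–Friedrichs flux is $$b_h(\mathbf z,\mathbf w)=-\sum_K\int_K\bigl(\mathbf A_1\mathbf z\cdot\partial_x\mathbf w+\mathbf A_2\mathbf z\cdot\partial_y\mathbf w\bigr)\mathrm d\mathbf x+\sum_{e\in\mathcal E_h}\int_e\Bigl((n_x\mathbf A_1+n_y\mathbf A_2)\{\!\{\mathbf z\}\!\}+\frac{\tau^*}{2}[[\mathbf z]]\Bigr)\cdot[[\mathbf w]]\,\mathrm ds,$$ with $\tau^*=|\mathbf u_{\mathrm{eq}}\cdot\mathbf n|+\sqrt{\phi_{\mathrm{eq}}}$; on $\Gamma_{\mathrm D}$ the exterior state in this form is zero ($\{\!\{\mathbf z\}\!\}=\frac12\mathbf z^+$, $[[\mathbf z]]=\mathbf z^+$, $[[\mathbf w]]=\mathbf w^+$). The NIPG form, with $\mu_e=\sigma h_e^{-\beta}$, $h_e=\operatorname{diam}e$, is $$a_h(\mathbf z,\mathbf w)=\sum_K\int_K\nabla S(\mathbf z):\nabla\mathbf w\,\mathrm d\mathbf x-\sum_{e\in\mathcal E_h}\int_e\{\!\{\nabla S(\mathbf z)\}\!\}\mathbf n\cdot[[\mathbf w]]\,\mathrm ds+\sum_{e\in\mathcal E_h}\int_e\{\!\{\nabla\mathbf w\}\!\}\mathbf n\cdot[[S(\mathbf z)]]\,\mathrm ds+\sum_{e\in\mathcal E_h}\int_e\mu_e[[S(\mathbf z)]]\cdot[[\mathbf w]]\,\mathrm ds ,$$ where on $\Gamma_{\mathrm D}$ jumps and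 averages are interior traces. **DG seminorm.** For $\mathbf q_h=(\phi_{\eta,h},U_h,V_h)^\top$ and $\mathbf U_h=(U_h,V_h)^\top$, $$\|\mathbf q_h\|_{\mathrm{DG}}^2=\sum_{K}\|\nabla\mathbf U_h\|_{L^2(K)}^2+\sum_{e\in\mathcal E_h}\frac{\sigma}{h_e^\beta}\|[[\mathbf U_h]]\|_{L^2(e)}^2 .$$ **Standing assumptions.** (i) The exact solution satisfies $\mathbf q\in(H^{k+1}(\Omega))^3$ for some $k\ge1$; the mesh family $Q_h$ is shape-regular and quasi-uniform; the reference depth is strictly positive, $\inf_\Omega(\eta_0+b)>0$ with $\eta_0$ the reference free surface; $\sigma>0$. (ii) The linearization is around a smooth reference state $\mathbf q_{\mathrm{eq}}$ with strictly positive depth and coefficients bounded in $W^{1,\infty}(\Omega)$. *)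

(* Defs.v *)
From HB Require Import structures.
From mathcomp Require Import all_boot all_order all_algebra.
From mathcomp Require Import all_classical all_reals all_analysis.
Set Implicit Arguments.
Unset Strict Implicit.
Unset Printing Implicit Defensive.
Import Order.TTheory GRing.Theory Num.Theory numFieldNormedType.Exports.
Local Open Scope classical_set_scope.
Local Open Scope ring_scope.

Section PlaneCalculus.
Context {R : realType}.
Implicit Types (f h : R * R -> R) (D : set (R * R)) (i : 'I_2).

Definition leb1 := @lebesgue_measure R.
Definition leb2 := (leb1 \x leb1)%E.

(* The norm that the library puts on [R * R] is the sup norm. *)
Definition enorm (v : R * R) : R := Num.sqrt (v.1 ^+ 2 + v.2 ^+ 2).
Definition edot (v w : R * R) : R := v.1 * w.1 + v.2 * w.2.
Definition coord (v : R * R) i : R := if i == 0 then v.1 else v.2.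

Definition basis i : R * R := if i == 0 then (1, 0) else (0, 1).
Definition partial i f : R * R -> R := fun x => 'D_(basis i) f x.

(* For open [D] this is C^oo: every iterated partial derivative exists on [D]
   and is continuous there. *)
Definition smooth_on D f : Prop :=
  forall (s : seq 'I_2) x, D x ->
    {for x, continuous (foldr partial f s)} /\
    forall i, derivable (foldr partial f s) x (basis i).

Definition smooth_up_to_boundary D f : Prop :=
  exists D', [/\ open D', closure D `<=` D' & smooth_on D' f].

Definition test_function D f : Prop :=
  smooth_on setT f /\
  exists S, [/\ compact S, S `<=` D & forall x, ~ S x -> f x = 0].

Definition loc_integrable D f : Prop :=
  measurable_fun D f /\
  forall S, compact S -> S `<=` D -> leb2.-integrable S (EFin \o f).

Definition is_weak_partial D i f h : Prop :=
  [/\ loc_integrable D f, loc_integrable D h &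
      forall psi, test_function D psi ->
        \int[leb2]_(x in D) (f x * partial i psi x)
        = - \int[leb2]_(x in D) (h x * psi x)].

Definition weakly_differentiable D f : Prop :=
  forall i, exists h, is_weak_partial D i f h.

(* A representative of the weak derivative, which is unique up to a null set
   (and agrees a.e. with [partial i f] when [f] is smooth on [D]). *)
Definition wpartial D i f : R * R -> R :=
  xget (fun=> 0) [set h | is_weak_partial D i f h].

Definition W1infty_bound D (M : R) f : Prop :=
  [/\ weakly_differentiable D f,
      {ae leb2, forall x, D x -> `|f x| <= M} &
      forall i, {ae leb2, forall x, D x -> `|wpartial D i f x| <= M}].

Definition W1infty D f : Prop := exists M, W1infty_bound D M f.

Definition L2 D f : Prop :=
  measurable_fun D f /\ (\int[leb2]_(x in D) ((f x) ^+ 2)%:E < +oo)%E.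

Fixpoint Hs (s : nat) D f : Prop :=
  L2 D f /\
  if s is s'.+1 then
    weakly_differentiable D f /\ forall i, Hs s' D (wpartial D i f)
  else True.

Definition segment (a b : R * R) : set (R * R) :=
  [set a + s *: (b - a) | s in [set s : R | 0 <= s <= 1]].

(* Regularity as an open set, [(closure D)° = D], rules out slits: the domain
   lies on one side only of each of its boundary segments. *)
Definition polygonal_domain D : Prop :=
  [/\ open D, D !=set0, connected D, bounded_set D & interior (closure D) = D]
  /\ exists ss : seq ((R * R) * (R * R)),
       closure D `\` D = \bigcup_(p in [set` ss]) segment p.1 p.2.

(* For a function of time on [0, T]: one-sided derivative at the end points. *)
Definition time_derivative (T : R) (f : R -> R) (t l : R) : Prop :=
  (s - t)^-1 * (f s - f t) @[s --> within `[0, T] t^'] --> l.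

End PlaneCalculus.

Section ShallowWater.
Context {R : realType}.
Implicit Types (q : 'cV[R]_3) (Q : R * R -> 'cV[R]_3) (D : set (R * R)).
Implicit Types (b : R * R -> R) (x : R * R).

Definition cv3 (a0 a1 a2 : R) : 'cV[R]_3 := \col_i [:: a0; a1; a2]`_i.
Definition mx3 (rows : seq (seq R)) : 'M[R]_3 :=
  \matrix_(i, j) (nth [::] rows i)`_j.
Definition dot (u v : 'cV[R]_3) : R := \sum_i u i 0 * v i 0.

(* A state is (phi_eta, U, V). *)
Definition phieta q : R := q 0 0.
Definition U_ q : R := q 1 0.
Definition V_ q : R := q 2%:R 0.

Definition phib (g : R) b : R * R -> R := fun x => g * b x.

(* In the pointwise definitions below [pb] is the value of phi_b. *)
Definition phi (pb : R) q : R := phieta q + pb.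

Definition flux (j : 'I_2) (pb : R) q : 'cV[R]_3 :=
  let p := phi pb q in
  let U := U_ q in
  let V := V_ q in
  let press := 2^-1 * (p ^+ 2 - pb ^+ 2) in
  if j == 0 then cv3 U (U ^+ 2 / p + press) (U * V / p)
  else cv3 V (U * V / p) (V ^+ 2 / p + press).

Definition Bmx (nu : R) : 'M[R]_3 :=
  mx3 [:: [:: 0; 0; 0]; [:: 0; nu; 0]; [:: 0; 0; nu]].

Definition source D g fc b Q x : 'cV[R]_3 :=
  cv3 0
    (fc * V_ (Q x) + phieta (Q x) * wpartial D 0 (phib g b) x)
    (- fc * U_ (Q x) + phieta (Q x) * wpartial D 1 (phib g b) x).

Definition div_flux D g b Q x : 'cV[R]_3 :=
  \col_i \sum_(j < 2) wpartial D j (fun y => flux j (phib g b y) (Q y) i 0) x.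

Definition lap_visc D nu Q x : 'cV[R]_3 :=
  \col_i \sum_(j < 2)
    wpartial D j (wpartial D j (fun y => (Bmx nu *m Q y) i 0)) x.

Definition exact_solution D T g fc nu b (q : R -> R * R -> 'cV[R]_3) : Prop :=
  (forall t x, 0 <= t <= T -> D x -> 0 < phi (phib g b x) (q t x)) /\
  (forall t, 0 < t <= T ->
     {ae leb2, forall x, D x -> forall i : 'I_3,
        time_derivative T (fun s => q s x i 0) t
          ((source D g fc b (q t) x - div_flux D g b (q t) x
            + lap_visc D nu (q t) x) i 0)}).

(* Flux Jacobians at the state [q]. *)
Definition Amx (j : 'I_2) (pb : R) q : 'M[R]_3 :=
  let p := phi pb q in
  let U := U_ q in
  let V := V_ q in
  if j == 0 then
    mx3 [:: [:: 0; 1; 0];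
            [:: p - U ^+ 2 / p ^+ 2; 2 * U / p; 0];
            [:: - (U * V / p ^+ 2); V / p; U / p]]
  else
    mx3 [:: [:: 0; 0; 1];
            [:: - (U * V / p ^+ 2); V / p; U / p];
            [:: p - V ^+ 2 / p ^+ 2; 0; 2 * V / p]].

Definition Cmx D g fc b x : 'M[R]_3 :=
  mx3 [:: [:: 0; 0; 0];
          [:: wpartial D 0 (phib g b) x; 0; fc];
          [:: wpartial D 1 (phib g b) x; - fc; 0]].

Definition residual D g fc nu b Q x : 'cV[R]_3 :=
  source D g fc b Q x - div_flux D g b Q x + lap_visc D nu Q x.

Definition lf_speed (pb : R) q (n : R * R) : R :=
  `|edot (U_ q / phi pb q, V_ q / phi pb q) n| + Num.sqrt (phi pb q).

(* The coefficients of the linearized problem: the entries of A_1 and A_2 in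
   W^{1,oo}, and those of C, which involve only the gradient of phi_b, in L^oo
   through the W^{1,oo} bound of phi_b. *)
Definition coefficient_bounds D (M delta : R) g b Q : Prop :=
  [/\ forall x, D x -> delta <= phi (phib g b x) (Q x),
      forall (j : 'I_2) (k l : 'I_3),
        W1infty_bound D M (fun x => Amx j (phib g b x) (Q x) k l)
    & W1infty_bound D M (phib g b)].

Definition sqnorm_L2 D Q : \bar R :=
  (\int[leb2]_(x in D) (dot (Q x) (Q x))%:E)%E.

End ShallowWater.

Section Mesh.
Context {R : realType}.

(* A side of a mesh with [n] triangles is a pair (K, i): the edge of K that is
   opposite to its vertex i. A facet has its K^+ side and, if it is interior,
   its K^- side together with the translation taking the former onto the
   latter; this translation is 0 unless the facet is a pair of periodic ones.
   A facet without K^- side is a Dirichlet facet. *)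
Record facet (n : nat) := Facet {
  plus : 'I_n * 'I_3;
  minus : option (('I_n * 'I_3) * (R * R)) }.

Record mesh := Mesh {
  nelt : nat;
  vtx : 'I_nelt -> 'I_3 -> R * R;
  nfacet : nat;
  facets : 'I_nfacet -> facet nelt }.

Section OneMesh.
Variable m : mesh.
Implicit Types (K : 'I_(nelt m)) (sd : 'I_(nelt m) * 'I_3).
Implicit Types (e : facet (nelt m)).

Definition hull K : set (R * R) :=
  [set x | exists l : 'I_3 -> R,
     [/\ forall i, 0 <= l i, \sum_i l i = 1 & x = \sum_i l i *: vtx K i]].

(* The interior of the triangle [hull K]. *)
Definition elt K : set (R * R) :=
  [set x | exists l : 'I_3 -> R,
     [/\ forall i, 0 < l i, \sum_i l i = 1 & x = \sum_i l i *: vtx K i]].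

(* The face of K spanned by the vertices it shares with K'. *)
Definition common_face K K' : set (R * R) :=
  [set x | exists l : 'I_3 -> R,
     [/\ forall i, 0 <= l i, \sum_i l i = 1, x = \sum_i l i *: vtx K i
       & forall i, l i != 0 -> exists i', vtx K i = vtx K' i']].

Definition side_a sd : R * R := vtx sd.1 (ordS sd.2).
Definition side_b sd : R * R := vtx sd.1 (ordS (ordS sd.2)).
Definition side_vec sd : R * R := side_b sd - side_a sd.
Definition side_len sd : R := enorm (side_vec sd).
Definition side_set sd : set (R * R) := segment (side_a sd) (side_b sd).

Definition area2 K : R :=
  let u := vtx K 1 - vtx K 0 in
  let v := vtx K 2%:R - vtx K 0 in
  u.1 * v.2 - u.2 * v.1.

Definition out_normal sd : R * R :=
  let t := side_vec sd in
  let nu := (side_len sd)^-1 *: ((t.2, - t.1) : R * R) in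
  if edot nu (vtx sd.1 sd.2 - side_a sd) < 0 then nu else - nu.

Definition facet_sides e : seq ('I_(nelt m) * 'I_3) :=
  plus e :: (if minus e is Some (sd, _) then [:: sd] else [::]).

Definition facet_conforming (D : set (R * R)) e : Prop :=
  let bdry sd := side_set sd `<=` closure D `\` D in
  match minus e with
  | None => bdry (plus e)
  | Some (sd, p) =>
      [/\ (side_a sd = side_a (plus e) + p /\ side_b sd = side_b (plus e) + p)
          \/ (side_a sd = side_b (plus e) + p /\
              side_b sd = side_a (plus e) + p),
          out_normal sd = - out_normal (plus e)
        & p != 0 -> bdry (plus e) /\ bdry sd]
  end.

(* A conforming triangulation of D, each side of each triangle occurring exactly
   once as the K^+ or K^- side of a facet. *)
Definition triangulation (D : set (R * R)) : Prop :=
  [/\ forall K, area2 K != 0,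
      \bigcup_K hull K = closure D,
      forall K K', K != K' ->
        hull K `&` hull K' = common_face K K' /\
        exists i, forall i', vtx K i <> vtx K' i',
      perm_eq (flatten [seq facet_sides (facets i) | i <- enum 'I_(nfacet m)])
              (enum {: 'I_(nelt m) * 'I_3})
    & forall i : 'I_(nfacet m), facet_conforming D (facets i)].

Definition diam K : R := \big[Num.max/0]_(i < 3) side_len (K, i).
Definition mesh_size : R := \big[Num.max/0]_K diam K.

End OneMesh.

(* h_K / rho_K <= gamma, where rho_K is the diameter of the largest disc
   contained in K. *)
Definition shape_regular (Q : set mesh) : Prop :=
  exists2 gamma : R, 0 < gamma & forall m, Q m -> forall K : 'I_(nelt m),
    exists x, forall y,
      enorm (y - x) <= diam K / (2 * gamma) -> hull K y.

Definition quasi_uniform (Q : set mesh) : Prop :=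
  exists2 theta : R, 0 < theta & forall m, Q m -> forall K : 'I_(nelt m),
    theta * mesh_size m <= diam K.

End Mesh.
Arguments mesh : clear implicits.
Arguments facets {R} m _.

Section DG.
Context {R : realType}.

Definition poly_le (k : nat) (f : R * R -> R) : Prop :=
  exists c : nat -> nat -> R, forall x,
    f x = \sum_(i < k.+1) \sum_(j < k.+1 | (i + j <= k)%N)
            c i j * x.1 ^+ i * x.2 ^+ j.

Variable m : mesh R.
Implicit Types (K : 'I_(nelt m)) (e : facet (R := R) (nelt m)).

(* A broken function is the family of its restrictions to the elements, each
   extended to the plane by its polynomial expression, so that traces on the
   facets are values. *)
Definition dgfun := 'I_(nelt m) -> R * R -> 'cV[R]_3.

Definition Vh (k : nat) (z : dgfun) : Prop :=
  forall K (i : 'I_3), poly_le k (fun x => z K x i 0).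

Definition dpart (j : 'I_2) (z : dgfun) : dgfun :=
  fun K x => \col_i partial j (fun y => z K y i 0) x.

Definition Sop (nu : R) (z : dgfun) : dgfun := fun K x => Bmx nu *m z K x.

(* The velocity part (U, V), padded with a zero first component. *)
Definition Upart (z : dgfun) : dgfun :=
  fun K x => cv3 0 (U_ (z K x)) (V_ (z K x)).

(* Facets are parametrized over [0, 1] by affine maps. *)
Definition facet_pt e (s : R) : R * R :=
  side_a (plus e) + s *: side_vec (plus e).
Definition normal e : R * R := out_normal (plus e).
Definition facet_len e : R := side_len (plus e).
Definition facet_int e (F : R -> R) : R :=
  facet_len e * \int[leb1]_(s in `[0, 1]) F s.

(* [trace_m] is the exterior state 0 on Dirichlet facets. *)
Definition trace_p (z : dgfun) e (s : R) : 'cV[R]_3 :=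
  z (plus e).1 (facet_pt e s).
Definition trace_m (z : dgfun) e (s : R) : 'cV[R]_3 :=
  if minus e is Some (sd, p) then z sd.1 (facet_pt e s + p) else 0.

Definition jump z e s : 'cV[R]_3 := trace_p z e s - trace_m z e s.
(* On Dirichlet facets: half of the interior trace in [avg_hyp], used in b_h,
   and the interior trace in [avg_visc], used in a_h. *)
Definition avg_hyp z e s : 'cV[R]_3 :=
  2^-1 *: (trace_p z e s + trace_m z e s).
Definition avg_visc z e s : 'cV[R]_3 :=
  if minus e is None then trace_p z e s
  else 2^-1 *: (trace_p z e s + trace_m z e s).
Definition avg_visc_dn z e s : 'cV[R]_3 :=
  \sum_(j < 2) coord (normal e) j *: avg_visc (dpart j z) e s.

Definition sum_facets (F : facet (R := R) (nelt m) -> R) : R :=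
  \sum_(i < nfacet m) F (facets m i).

(* [pb] is the field phi_b and [Q] the reference state; on a periodic pair the
   coefficients are evaluated on the K^+ side. *)
Definition b_h (pb : R * R -> R) (Q : R * R -> 'cV[R]_3) (z w : dgfun) : R :=
  - (\sum_K \int[leb2]_(x in elt K)
       (\sum_(j < 2) dot (Amx j (pb x) (Q x) *m z K x) (dpart j w K x)))
  + sum_facets (fun e => facet_int e (fun s =>
      let x := facet_pt e s in
      dot ((\sum_(j < 2) coord (normal e) j *: Amx j (pb x) (Q x))
             *m avg_hyp z e s
           + (lf_speed (pb x) (Q x) (normal e) / 2) *: jump z e s)
          (jump w e s))).

Definition a_h (nu sigma beta : R) (z w : dgfun) : R :=
  (\sum_K \int[leb2]_(x in elt K)
     (\sum_(j < 2) dot (dpart j (Sop nu z) K x) (dpart j w K x)))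
  - sum_facets (fun e => facet_int e (fun s =>
      dot (avg_visc_dn (Sop nu z) e s) (jump w e s)))
  + sum_facets (fun e => facet_int e (fun s =>
      dot (avg_visc_dn w e s) (jump (Sop nu z) e s)))
  + sum_facets (fun e => facet_int e (fun s =>
      sigma * facet_len e `^ (- beta)
      * dot (jump (Sop nu z) e s) (jump w e s))).

(* The L^2 inner product on the union of the elements, i.e. on the domain up to
   a null set. *)
Definition ip (z w : dgfun) : R :=
  \sum_K \int[leb2]_(x in elt K) (dot (z K x) (w K x)).

Definition dg_seminorm2 (sigma beta : R) (z : dgfun) : R :=
  (\sum_K \int[leb2]_(x in elt K)
     (\sum_(j < 2) dot (dpart j (Upart z) K x) (dpart j (Upart z) K x)))
  + sum_facets (fun e => sigma / (facet_len e `^ beta)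
      * facet_int e (fun s =>
          dot (jump (Upart z) e s) (jump (Upart z) e s))).

Definition semidiscrete_solution (k : nat) (D : set (R * R))
    (T g fc nu sigma beta : R) (b : R * R -> R) (Q : R * R -> 'cV[R]_3)
    (q : R -> dgfun) : Prop :=
  [/\ forall t, 0 <= t <= T -> Vh k (q t),
      forall K x (i : 'I_3),
        {within `[0, T], continuous (fun t => q t K x i 0)}
    & forall t, 0 < t <= T -> exists dq : dgfun,
        (forall K x (i : 'I_3),
           time_derivative T (fun s => q s K x i 0) t (dq K x i 0)) /\
        forall w, Vh k w ->
          ip dq w + b_h (phib g b) Q (q t) w + a_h nu sigma beta (q t) w
          = ip (fun K x => Cmx D g fc b x *m q t K x + residual D g fc nu b Q x)
               w].

End DG.

(* Main.v *)
Require Import Defs.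
From HB Require Import structures.
From mathcomp Require Import all_boot all_order all_algebra.
From mathcomp Require Import all_classical all_reals all_analysis.
From mathcomp Require Import unstable measurable_realfun ring lra zify.

(** The estimate is an energy estimate: the scheme is tested with its own solution
    q_h = (p, u), where p is the scalar component and u the momentum. Let E be the
    squared L^2 norm of q_h and N its squared DG seminorm, which only sees u.

    On the diagonal the consistency terms of the nonsymmetric viscous form cancel,
    so that a_h(q_h, q_h) = nu N ([a_h_diag]).

    The hyperbolic form satisfies b_h(q_h, q_h) >= - (nu/2) N - K E with K independent
    of the mesh ([b_h_lower_bound]). The danger is the term u . grad p, since N does
    not control derivatives of p. But the first rows of A_1 and A_2 are constant:
    u . grad p = div (p u) - p div u exactly, and the divergence theorem on each
    triangle ([divergence_elt]) trades it for p div u and the fluxes of p u through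
    the sides. In the volume all terms then contain a derivative of u
    ([transport_pointwise]). On a facet, the difference between the numerical flux
    and the fluxes of p u from both sides contains only terms with a factor [[u]] and
    the Lax-Friedrichs dissipation, which has the good sign ([facet_pointwise]).
    Young's inequality absorbs derivatives and jumps of u into (nu/2) N and leaves
    squares of q_h, in the volume and on the facets. The latter are bounded by E
    through the inverse inequality f(x)^2 <= C/|K| int_K f^2 ([elt_sup_bound]) and
    shape regularity, h_e^2 <= gamma |K| ([side_len_sqr_area]), where |K| is twice the
    area of K. As the penalty parameter is sigma h_e^(- beta), a factor
    h_e^(beta - 1) remains, which is bounded because beta >= 1 and Omega is bounded
    ([facet_len_area]).

    In the source term the Coriolis force does no work, the gradient of phi_b is
    bounded, and the residual r is handled by Young's inequality ([source_bound]).
    Altogether E' + nu N <= A E + |r|^2, and [gronwall] gives the result with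
    c_1 = exp(A T).

    The solution is differentiable in time only at each point x. On each triangle it
    is a polynomial of degree k, hence a combination of fixed Lagrange functions with
    its nodal values as coefficients; E and N are finite sums of products of nodal
    values with fixed integrals, so they are continuous, and E is differentiable with
    the expected derivative ([is_derive_energy]). *)

Set Implicit Arguments.
Unset Strict Implicit.
Unset Printing Implicit Defensive.
Import Order.TTheory GRing.Theory Num.Theory numFieldNormedType.Exports.
Local Open Scope classical_set_scope.
Local Open Scope ring_scope.

(** * Affine substitution on the line *)

Section affine_line.
Context {R : realType}.

(** The measure sending A to |a| times the measure of its preimage agrees with
    Lebesgue measure on half-open intervals, which determine a measure. *)
Lemma lebesgue_preimage_affine (a c : R) (A : set R) : a != 0 -> measurable A ->
  (leb1 ((fun x => a * x + c)%R @^-1` A) = (`|a|^-1)%R%:E * leb1 A)%E.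
Proof.
move=> a0 mA; pose phi : measurableTypeR R -> measurableTypeR R := fun x : R => a * x + c.
have mphi : measurable_fun setT phi.
  by apply: measurable_funD.
have ap : 0 <= `|a| by [].
pose m : {measure set (measurableTypeR R) -> \bar R} :=
   mscale (NngNum ap) (measure_function_pushforward__canonical__measure_function_Measure leb1 mphi).
have key : leb1 A = m A.
  apply: lebesgue_measure_unique => // _ [[p q] _ <-] /=.
  rewrite /m /mscale /= /pushforward /leb1.
  have [an|ap'|/eqP] := ltgtP a 0; last by rewrite (negbTE a0).
    have -> : phi @^-1` `]p, q] = `[(q-c)/a, (p-c)/a[%classic.
      apply/seteqP; split => x /=; rewrite !in_itv /= /phi => /andP[h1 h2]; apply/andP; split.
      - by rewrite ler_ndivrMr // mulrC lerBrDr.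
      - by rewrite ltr_ndivlMr // mulrC ltrBlDr.
      - by move: h2; rewrite ltr_ndivlMr // mulrC ltrBlDr.
      - by move: h1; rewrite ler_ndivrMr // mulrC lerBrDr.
    rewrite !lebesgue_measure_itv /= !lte_fin ltr_nM2r ?invr_lt0 // ltrD2r; case: ifP => pq; last by rewrite mule0.
    rewrite -!EFinD -EFinM; congr (_%:E); rewrite (ltr0_norm an); field. exact: a0.
  have -> : phi @^-1` `]p, q] = `](p-c)/a, (q-c)/a]%classic.
    apply/seteqP; split => x /=; rewrite !in_itv /= /phi => /andP[h1 h2]; apply/andP; split.
    - by rewrite ltr_pdivrMr // mulrC ltrBlDr.
    - by rewrite ler_pdivlMr // mulrC lerBrDr.
    - by move: h1; rewrite ltr_pdivrMr // mulrC ltrBlDr.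
    - by move: h2; rewrite ler_pdivlMr // mulrC lerBrDr.
  rewrite !lebesgue_measure_itv /= !lte_fin ltr_pM2r ?invr_gt0 // ltrD2r; case: ifP => pq; last by rewrite mule0.
  rewrite -!EFinD -EFinM; congr (_%:E); rewrite (gtr0_norm ap'); field. exact: a0.
rewrite key /m /mscale /= /pushforward muleA -EFinM mulVf ?mul1e //.
by rewrite normr_eq0.
Qed.

Lemma ge0_integral_affine (a c : R) (f : R -> \bar R) : a != 0 ->
  measurable_fun setT f -> (forall x, (0 <= f x)%E) ->
  (\int[leb1]_x f (a * x + c)%R = (`|a|^-1)%R%:E * \int[leb1]_x f x)%E.
Proof.
move=> a0 mf f0; pose phi : measurableTypeR R -> measurableTypeR R := fun x : R => a * x + c.
have mphi : measurable_fun setT phi.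
  by apply: measurable_funD.
have ap : 0 <= `|a|^-1 by rewrite invr_ge0.
rewrite -(@ge0_integral_mscale _ _ _ _ _ _ (NngNum ap)) //.
transitivity (\int[measure_function_pushforward__canonical__measure_function_Measure leb1 mphi]_y f y)%E.
  by rewrite ge0_integral_pushforward.
apply: eq_measure_integral => A mA _ /=.
rewrite /mscale /pushforward /=; exact: lebesgue_preimage_affine.
Qed.

End affine_line.

(** * Open sets of the plane and Lebesgue measure *)

Section open_plane.
Context {R : realType}.
Implicit Types (D U : set (R * R)).

Lemma ballE2 (x y : R * R) (e : R) : ball x e y <-> `|x.1 - y.1| < e /\ `|x.2 - y.2| < e.
Proof. by split => -[]. Qed.

Lemma open_ball2 U x : open U -> U x -> exists2 e : R, 0 < e & forall y, `|x.1 - y.1| < e -> `|x.2 - y.2| < e -> U y.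
Proof.
move=> oU Ux; have /nbhs_ballP[e e0 sub] : nbhs x U by exact: open_nbhs_nbhs.
by exists e => // y h1 h2; apply: sub; rewrite ballE2.
Qed.

Lemma open2P U : (forall x, U x -> exists2 e : R, 0 < e & forall y, `|x.1 - y.1| < e -> `|x.2 - y.2| < e -> U y) -> open U.
Proof.
move=> H; rewrite openE => x /H[e e0 sub]; apply/nbhs_ballP; exists e => // y /ballE2[h1 h2]. exact: sub.
Qed.

Definition open_rectangle (a b c d : R) : set (R * R) := `]a, b[ `*` `]c, d[.

Lemma measurable_open_rectangle a b c d : measurable (open_rectangle a b c d).
Proof. by apply: measurableX. Qed.

(** The plane carries the product sigma-algebra: an open set is the countable
    union of the rational rectangles that it contains. *)
Lemma open_measurable2 U : open U -> measurable U.
Proof.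
move=> oU.
pose G (p q r s : rat) := if `[< open_rectangle (ratr p) (ratr q) (ratr r) (ratr s) `<=` U >] then open_rectangle (ratr p) (ratr q) (ratr r) (ratr s) else set0.
suff -> : U = \bigcup_p \bigcup_q \bigcup_r \bigcup_s G p q r s.
  do 4 (apply: bigcupT_measurable_rat => ?); rewrite /G; case: ifP => // _; exact: measurable_open_rectangle.
apply/seteqP; split => [x Ux|x [p _ [q _ [r _ [s _]]]]]; last first.
  by rewrite /G; case: asboolP => // sub /sub.
have [e e0 sub] := open_ball2 oU Ux.
have lt1 (t : R) : t - e < t by rewrite gtrBl.
have lt2 (t : R) : t < t + e by rewrite ltrDl.
have [p] := rat_in_itvoo (lt1 x.1); have [q] := rat_in_itvoo (lt2 x.1).
have [r] := rat_in_itvoo (lt1 x.2); have [s] := rat_in_itvoo (lt2 x.2).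
rewrite !in_itv /= => /andP[s1 s2] /andP[r1 r2] /andP[q1 q2] /andP[p1 p2].
exists p => //; exists q => //; exists r => //; exists s => //; rewrite /G; case: asboolP.
  by move=> _; split; rewrite /= in_itv /= ?p2 ?q1 ?r2 ?s1.
case=> y [] /=; rewrite !in_itv /= => /andP[y1 y2] /andP[z1 z2].
by apply: sub; rewrite ltr_norml; apply/andP; split; lra.
Qed.

Lemma leb2_open_gt0 U : open U -> U !=set0 -> (0 < leb2 U)%E.
Proof.
move=> oU [x /(open_ball2 oU)[e e0 sub]].
have mb (y : R) : measurable (ball y e) by exact: measurable_ball.
have : (leb2 (ball x.1 e `*` ball x.2 e) <= leb2 U)%E.
  apply: le_measure; rewrite ?inE.
  - by apply: measurableX; exact: mb.
  - exact: open_measurable2.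
  by move=> y [h1 h2]; exact: sub.
have lb (y : R) : (0 < lebesgue_measure (ball y e))%E.
  by rewrite lebesgue_measure_ball ?ltW // lte_fin pmulrn_lgt0.
apply: lt_le_trans; rewrite /leb2 product_measure1E; [|exact: mb..].
by apply: mule_gt0; exact: lb.
Qed.

Lemma continuous_measurable_fun2 D (f : R * R -> R) : open D ->
  (forall x, D x -> {for x, continuous f}) -> measurable_fun D f.
Proof.
move=> oD cf; apply: (measurability _ (RGenOpens.measurableE R)).
move=> _ [_ [a [b ->]] <-]; apply: open_measurable2.
rewrite openE => x [Dx fx].
have n1 : nbhs x D by exact: open_nbhs_nbhs.
have n2 : nbhs x (f @^-1` `]a, b[).
  apply: cf => //; apply: open_nbhs_nbhs; split => //; exact: interval_open.
exact: filterI.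
Qed.

(** A non-empty open set has positive measure, so it is not contained in the
    exceptional null set. This is how almost-everywhere bounds on the coefficients
    become bounds at points. *)
Lemma ae_open_dense D (P : R * R -> Prop) U : open D ->
  {ae leb2, forall x, D x -> P x} -> open U -> U `&` D !=set0 -> exists2 x, (U `&` D) x & P x.
Proof.
move=> oD [N [mN N0 sub]] oU ne.
apply: contrapT => nex.
have sUN : U `&` D `<=` N.
  move=> x [Ux Dx]; apply: sub => /= Px; apply: nex; exists x => //; exact: Px.
have oUD : open (U `&` D) by exact: openI.
have : (leb2 (U `&` D) <= leb2 N)%E.
  by apply: le_measure; rewrite ?inE //; exact: open_measurable2.
by rewrite N0 leNgt leb2_open_gt0.
Qed.

End open_plane.

(** * Affine changes of variables in the plane *)

Section affine_plane.
Context {R : realType}.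
Local Notation leb2 := (@leb2 R).

(** The map x |-> v0 + x.1 *: e1 + x.2 *: e2, in coordinates, so that identities
    between such maps are polynomial identities. *)
Definition affine_map (v0 e1 e2 x : R * R) : R * R :=
  (v0.1 + x.1 * e1.1 + x.2 * e2.1, v0.2 + x.1 * e1.2 + x.2 * e2.2).

Definition cross (u v : R * R) : R := u.1 * v.2 - u.2 * v.1.

Lemma measurable_lin2 (a b c : R) : measurable_fun [set: R * R] (fun x => a + x.1 * b + x.2 * c).
Proof.
by apply: measurable_funD; [apply: measurable_funD => //; apply: measurable_funM|apply: measurable_funM].
Qed.

Lemma measurable_affine_map v0 e1 e2 : measurable_fun setT (affine_map v0 e1 e2).
Proof. by apply: measurable_fun_pair; exact: measurable_lin2. Qed.

Section ge0.
Variable f : R * R -> \bar R.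
Hypotheses (mf : measurable_fun setT f) (f0 : forall x, (0 <= f x)%E).

(** For fixed x.2 this is an affine substitution in x.1: Tonelli reduces it to
    the line. *)
Lemma ge0_integral_shear1 (a b c : R) : a != 0 ->
  (\int[leb2]_x f (a * x.1 + (b * x.2 + c), x.2)%R = (`|a|^-1)%R%:E * \int[leb2]_x f x)%E.
Proof.
move=> a0.
have mg : measurable_fun setT (fun x : R * R => f (a * x.1 + (b * x.2 + c), x.2)).
  apply: (measurableT_comp mf); apply: measurable_fun_pair => //.
  by apply: measurable_funD; [apply: measurable_funM|apply: measurable_funD => //; apply: measurable_funM].
have a0' : (0 <= (`|a|^-1)%:E)%E by rewrite lee_fin invr_ge0.
rewrite fubini_tonelli2 // [X in (_ * X)%E]fubini_tonelli2 //.
rewrite -ge0_integralZl //; last first.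
- by move=> y _; apply: integral_ge0.
- exact: measurable_fun_fubini_tonelli_G.
apply: eq_integral => y _; rewrite /fubini_G /=.
rewrite (@ge0_integral_affine _ a (b * y + c) (fun x => f (x, y))) //.
exact: measurableT_comp.
Qed.

Lemma ge0_integral_shear2 (a b c : R) : a != 0 ->
  (\int[leb2]_x f (x.1, a * x.2 + (b * x.1 + c))%R = (`|a|^-1)%R%:E * \int[leb2]_x f x)%E.
Proof.
move=> a0.
have mg : measurable_fun setT (fun x : R * R => f (x.1, a * x.2 + (b * x.1 + c))).
  apply: (measurableT_comp mf); apply: measurable_fun_pair => //.
  by apply: measurable_funD; [apply: measurable_funM|apply: measurable_funD => //; apply: measurable_funM].
have a0' : (0 <= (`|a|^-1)%:E)%E by rewrite lee_fin invr_ge0.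
rewrite fubini_tonelli1 // [X in (_ * X)%E]fubini_tonelli1 //.
rewrite -ge0_integralZl //; last first.
- by move=> y _; apply: integral_ge0.
- exact: measurable_fun_fubini_tonelli_F.
apply: eq_integral => x _; rewrite /fubini_F /=.
rewrite (@ge0_integral_affine _ a (b * x + c) (fun y => f (x, y))) //.
exact: measurableT_comp.
Qed.

Lemma ge0_integral_swap2 : (\int[leb2]_x f (x.2, x.1) = \int[leb2]_x f x)%E.
Proof.
rewrite fubini_tonelli1 //; last by apply: (measurableT_comp mf); apply: measurable_fun_pair.
by rewrite [RHS]fubini_tonelli2.
Qed.

End ge0.

(** If e1.1 is nonzero, the map is a shear in the first variable followed by a
    shear in the second one, and the two one-dimensional factors multiply to the
    determinant. *)
Lemma ge0_integral_affine_map_neq0 v0 e1 e2 (f : R * R -> \bar R) :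
  measurable_fun setT f -> (forall x, (0 <= f x)%E) -> e1.1 != 0 -> cross e1 e2 != 0 ->
  (\int[leb2]_x f (affine_map v0 e1 e2 x) = (`|cross e1 e2|^-1)%R%:E * \int[leb2]_x f x)%E.
Proof.
move=> mf f0 a0 d0.
(* The first shear computes the new first coordinate; the second coordinate is
   then an affine function of it and of x.2. *)
set g := fun x : R * R => f (x.1, (cross e1 e2 / e1.1) * x.2 + (e1.2 / e1.1 * x.1 + (v0.2 - e1.2 / e1.1 * v0.1))).
have mg : measurable_fun setT g.
  apply: (measurableT_comp mf); apply: measurable_fun_pair => //.
  apply: measurable_funD; first exact: measurable_funM.
  by apply: measurable_funD => //; apply: measurable_funM.
have -> : (fun x => f (affine_map v0 e1 e2 x)) = (fun x => g (e1.1 * x.1 + (e2.1 * x.2 + v0.1), x.2)).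
  apply/funext => x; rewrite /g /affine_map /cross /=; congr (f (_, _)); first ring.
  by field.
rewrite ge0_integral_shear1 //; last by move=> x; exact: f0.
have -> : (\int[leb2]_x g x = `|cross e1 e2 / e1.1|^-1%:E * \int[leb2]_x f x)%E.
  by apply: ge0_integral_shear2 => //; rewrite mulf_neq0 ?invr_neq0.
by rewrite muleA -EFinM -invfM normrM normfV mulrCA divff ?mulr1 // ?normr_eq0.
Qed.

(** If e1.1 = 0, exchanging the two variables replaces it by e2.1, which is nonzero. *)
Lemma ge0_integral_affine_map v0 e1 e2 (f : R * R -> \bar R) :
  measurable_fun setT f -> (forall x, (0 <= f x)%E) -> cross e1 e2 != 0 ->
  (\int[leb2]_x f (affine_map v0 e1 e2 x) = (`|cross e1 e2|^-1)%R%:E * \int[leb2]_x f x)%E.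
Proof.
move=> mf f0 d0; have [e10|] := eqVneq e1.1 0; last by move=> ?; exact: ge0_integral_affine_map_neq0.
have e20 : e2.1 != 0 by apply: contra_neq d0 => e20; rewrite /cross e10 e20 mul0r mulr0 subr0.
have crossC : cross e2 e1 = - cross e1 e2 by rewrite /cross; ring.
rewrite -(@ge0_integral_swap2 (fun x => f (affine_map v0 e1 e2 x))) //; last first.
  by apply: (measurableT_comp mf); exact: measurable_affine_map.
have -> : (fun x : R * R => f (affine_map v0 e1 e2 (x.2, x.1))) = (fun x => f (affine_map v0 e2 e1 x)).
  by apply/funext => x; rewrite /affine_map /=; congr (f (_, _)); ring.
by rewrite ge0_integral_affine_map_neq0 // crossC ?normrN ?oppr_eq0.
Qed.

Lemma Rintegral_affine_map v0 e1 e2 (D : set (R * R)) (f : R * R -> R) :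
  cross e1 e2 != 0 -> measurable D -> leb2.-integrable D (EFin \o f) ->
  \int[leb2]_(x in D) f x =
  `|cross e1 e2| * \int[leb2]_(x in affine_map v0 e1 e2 @^-1` D) f (affine_map v0 e1 e2 x).
Proof.
move=> d0 mD intf; set phi := affine_map v0 e1 e2; set d := `|_|.
have dn0 : d != 0 by rewrite normr_eq0.
rewrite Rintegral_mkcond [in RHS]Rintegral_mkcond.
have -> : (fun x => f (phi x)) \_ (phi @^-1` D) = (f \_ D) \o phi.
  apply/funext => x; rewrite /= !patchE; congr (if _ then _ else _); apply/idP/idP; rewrite !inE //.
set h := f \_ D.
have inth : leb2.-integrable setT (EFin \o h).
  by rewrite /h -restrict_EFin; apply/integrable_restrict => //; rewrite setTI.
have mh := measurable_int _ inth.
pose H : R * R -> \bar R := EFin \o h.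
have E1 : (\int[leb2]_x H x = \int[leb2]_x H^\+ x - \int[leb2]_x H^\- x)%E.
  exact: integralE.
have E2 : (\int[leb2]_x H (phi x) = \int[leb2]_x H^\+ (phi x) - \int[leb2]_x H^\- (phi x))%E.
  have -> : (fun x => H^\+ (phi x))%E = ((H \o phi)^\+)%E by apply/funext => x; rewrite !funeposE.
  have -> : (fun x => H^\- (phi x))%E = ((H \o phi)^\-)%E by apply/funext => x; rewrite !funenegE.
  by rewrite -integralE.
have E3 : (\int[leb2]_x H^\+ (phi x) = d^-1%:E * \int[leb2]_x H^\+ x)%E.
  by apply: ge0_integral_affine_map => //; exact: measurable_funepos.
have E4 : (\int[leb2]_x H^\- (phi x) = d^-1%:E * \int[leb2]_x H^\- x)%E.
  by apply: ge0_integral_affine_map => //; exact: measurable_funeneg.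
change (fine (\int[leb2]_x H x)%E = d * fine (\int[leb2]_x H (phi x))%E).
have fp : (\int[leb2]_x H^\+ x)%E \is a fin_num by exact: integrable_pos_fin_num.
have fn : (\int[leb2]_x H^\- x)%E \is a fin_num by exact: integrable_neg_fin_num.
rewrite E1 E2 E3 E4 -(fineK fp) -(fineK fn) -!EFinM -!EFinB /=.
by rewrite -mulrBr mulrA mulfV // mul1r.
Qed.

End affine_plane.

(** * Polynomial functions of two variables *)

Section polynomial_functions.
Context {R : realType}.

(** [polyfun n f] says that f is a polynomial function of total degree at most n.
    It is generated inductively rather than read off coefficients, so that
    continuity, boundedness, stability under affine substitution and
    differentiation are all direct inductions. *)
Inductive polyfun : nat -> (R * R -> R) -> Prop :=
| polyfun_cst c : polyfun 0 (fun=> c)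
| polyfun_fst : polyfun 1 (fun x => x.1)
| polyfun_snd : polyfun 1 (fun x => x.2)
| polyfunD n f h : polyfun n f -> polyfun n h -> polyfun n (fun x => f x + h x)
| polyfunM n m f h : polyfun n f -> polyfun m h -> polyfun (n + m) (fun x => f x * h x)
| polyfunW n m f : (n <= m)%N -> polyfun n f -> polyfun m f.

Lemma polyfun_const n c : polyfun n (fun=> c).
Proof. by apply: (@polyfunW 0); [|exact: polyfun_cst]. Qed.

Lemma polyfunZ n c f : polyfun n f -> polyfun n (fun x => c * f x).
Proof. by move=> pf; rewrite -[n]add0n; apply: polyfunM => //; exact: polyfun_cst. Qed.

Lemma polyfunN n f : polyfun n f -> polyfun n (fun x => - f x).
Proof.
move=> pf; have -> : (fun x => - f x) = (fun x => -1 * f x) by apply/funext => x; rewrite mulN1r.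
exact: polyfunZ.
Qed.

Lemma polyfun_sum n (I : Type) (s : seq I) (P : pred I) (F : I -> R * R -> R) :
  (forall i, P i -> polyfun n (F i)) -> polyfun n (fun x => \sum_(i <- s | P i) F i x).
Proof.
move=> pF; elim: s => [|i s IH].
  by have -> : (fun x => \sum_(i <- [::] | P i) F i x) = (fun=> 0); [apply/funext => x; rewrite big_nil|exact: polyfun_const].
have [Pi|nPi] := boolP (P i).
  have -> : (fun x => \sum_(i <- i :: s | P i) F i x) = (fun x => F i x + \sum_(i <- s | P i) F i x).
    by apply/funext => x; rewrite big_cons Pi.
  by apply: polyfunD => //; exact: pF.
have -> // : (fun x => \sum_(i <- i :: s | P i) F i x) = (fun x => \sum_(i <- s | P i) F i x).
by apply/funext => x; rewrite big_cons (negbTE nPi).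
Qed.

Lemma polyfunX n m f : polyfun n f -> polyfun (m * n) (fun x => f x ^+ m).
Proof.
move=> pf; elim: m => [|m IH]; first exact: polyfun_cst.
rewrite mulSn; have -> : (fun x => f x ^+ m.+1) = (fun x => f x * f x ^+ m) by apply/funext => x; rewrite exprS.
exact: polyfunM.
Qed.

Lemma poly_le_polyfun k f : poly_le k f -> polyfun k f.
Proof.
move=> [c cE]; have -> : f = fun x => \sum_(i < k.+1) \sum_(j < k.+1 | (i + j <= k)%N) c i j * x.1 ^+ i * x.2 ^+ j.
  exact/funext.
apply: polyfun_sum => i _; apply: polyfun_sum => j ij; apply: (polyfunW ij).
apply: polyfunM; first apply: polyfunZ.
- by rewrite -[X in polyfun X]muln1; apply: polyfunX; exact: polyfun_fst.
- by rewrite -[X in polyfun X]muln1; apply: polyfunX; exact: polyfun_snd.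
Qed.

Lemma polyfun_continuous n f : polyfun n f -> continuous f.
Proof.
elim=> [c x|x|x|{}n {}f h _ IHf _ IHh x|{}n m {}f h _ IHf _ IHh x|//].
- exact: cvg_cst.
- exact: cvg_fst.
- exact: cvg_snd.
- exact: cvgD (IHf x) (IHh x).
- exact: cvgM (IHf x) (IHh x).
Qed.

Lemma polyfun_bounded n f B : polyfun n f ->
  exists2 C, 0 <= C & forall x, `|x.1| <= B -> `|x.2| <= B -> `|f x| <= C.
Proof.
elim=> [c|||{}n {}f h _ [C1 C10 H1] _ [C2 C20 H2]|{}n m {}f h _ [C1 C10 H1] _ [C2 C20 H2]|//].
- by exists `|c|.
- exists (Num.max 0 B); rewrite ?le_max ?lexx // => x h1 _; rewrite le_max h1 orbT //.
- exists (Num.max 0 B); rewrite ?le_max ?lexx // => x _ h1; rewrite le_max h1 orbT //.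
- exists (C1 + C2); rewrite ?addr_ge0 // => x h1 h2; apply: (le_trans (ler_normD _ _)).
  by apply: lerD; [exact: H1|exact: H2].
- exists (C1 * C2); rewrite ?mulr_ge0 // => x h1 h2; rewrite normrM.
  by apply: ler_pM => //; [exact: H1|exact: H2].
Qed.

Lemma polyfun_affine n f v0 e1 e2 : polyfun n f -> polyfun n (f \o affine_map v0 e1 e2).
Proof.
elim=> [c|||{}n {}f h _ H1 _ H2|{}n m {}f h _ H1 _ H2|{}n m {}f nm _ H].
- exact: polyfun_cst.
- rewrite (_ : _ \o _ = (fun x => v0.1 + x.1 * e1.1 + x.2 * e2.1)) //.
  apply: polyfunD; first apply: polyfunD; first exact: polyfun_const.
  + by apply: (@polyfunM 1 0); [exact: polyfun_fst|exact: polyfun_cst].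
  + by apply: (@polyfunM 1 0); [exact: polyfun_snd|exact: polyfun_cst].
- rewrite (_ : _ \o _ = (fun x => v0.2 + x.1 * e1.2 + x.2 * e2.2)) //.
  apply: polyfunD; first apply: polyfunD; first exact: polyfun_const.
  + by apply: (@polyfunM 1 0); [exact: polyfun_fst|exact: polyfun_cst].
  + by apply: (@polyfunM 1 0); [exact: polyfun_snd|exact: polyfun_cst].
- exact: (polyfunD H1 H2).
- exact: (polyfunM H1 H2).
- exact: (polyfunW nm H).
Qed.

(** Along horizontal lines f is a univariate polynomial, to which Lagrange
    interpolation applies. *)
Lemma polyfun_slice1 n f y : polyfun n f -> exists2 p : {poly R}, (size p <= n.+1)%N & forall x, f (x, y) = p.[x].
Proof.
elim=> [c|||{}n {}f h _ [p sp H1] _ [q sq H2]|{}n m {}f h _ [p sp H1] _ [q sq H2]|{}n m {}f nm _ [p sp H]].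
- by exists c%:P; [rewrite size_polyC; case: eqP|move=> x; rewrite hornerC].
- by exists 'X; [rewrite size_polyX|move=> x; rewrite hornerX].
- by exists y%:P; [rewrite size_polyC; case: eqP|move=> x; rewrite hornerC].
- exists (p + q); last by move=> x; rewrite hornerD H1 H2.
  by apply: (leq_trans (size_polyD _ _)); rewrite geq_max sp.
- exists (p * q); last by move=> x; rewrite hornerM H1 H2.
  apply: (leq_trans (size_polyMleq _ _)); move: sp sq; move: (size p) (size q) => a b; lia.
- by exists p => //; exact: leq_trans sp _.
Qed.

Lemma polyfun_slice2 n f x : polyfun n f -> exists2 p : {poly R}, (size p <= n.+1)%N & forall y, f (x, y) = p.[y].
Proof.
move=> pf; have [p sp pE] := polyfun_slice1 x (polyfun_affine (0, 0) (0, 1) (1, 0) pf).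
by exists p => // y; rewrite -pE /affine_map /=; congr f; congr (_, _); ring.
Qed.

Lemma is_derive_fst (x v : R * R) : is_derive x v (fun y : R * R => y.1) v.1.
Proof.
have E : (fun h : R => h^-1 *: ((h *: v + x).1 - x.1)) @ 0^' --> v.1.
  apply: cvg_near_cst; near=> h; rewrite /= addrK scalerA mulVf ?scale1r //.
  near: h. exact: nbhs_dnbhs_neq.
by apply: DeriveDef; [apply/cvg_ex; exists v.1|exact/cvg_lim].
Unshelve. all: by end_near. Qed.

Lemma is_derive_snd (x v : R * R) : is_derive x v (fun y : R * R => y.2) v.2.
Proof.
have E : (fun h : R => h^-1 *: ((h *: v + x).2 - x.2)) @ 0^' --> v.2.
  apply: cvg_near_cst; near=> h; rewrite /= addrK scalerA mulVf ?scale1r //.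
  near: h. exact: nbhs_dnbhs_neq.
by apply: DeriveDef; [apply/cvg_ex; exists v.2|exact/cvg_lim].
Unshelve. all: by end_near. Qed.

(** All directional derivatives at once: the polynomial gradient (f0, f1) is part of
    the induction, and both [partial] and the chain rule for affine maps are
    instances. *)
Lemma polyfun_is_derive n f : polyfun n f -> exists f0 f1, [/\ polyfun n f0, polyfun n f1 &
  forall x v, is_derive x v f (v.1 * f0 x + v.2 * f1 x)].
Proof.
elim=> [c|||{}n {}f h _ [f0 [f1 [p0 p1 pd]]] _ [g0 [g1 [q0 q1 qd]]]|{}n m {}f h pf [f0 [f1 [p0 p1 pd]]] ph [g0 [g1 [q0 q1 qd]]]|{}n m {}f nm _ [f0 [f1 [p0 p1 pd]]]].
- exists (fun=> 0), (fun=> 0); split; try exact: polyfun_cst.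
  by move=> x v; rewrite !mulr0 addr0; exact: is_derive_cst.
- exists (fun=> 1), (fun=> 0); split; try exact: polyfun_const.
  by move=> x v; rewrite mulr0 addr0 mulr1; exact: is_derive_fst.
- exists (fun=> 0), (fun=> 1); split; try exact: polyfun_const.
  by move=> x v; rewrite mulr0 add0r mulr1; exact: is_derive_snd.
- exists (fun x => f0 x + g0 x), (fun x => f1 x + g1 x); split; try exact: polyfunD.
  move=> x v; rewrite !mulrDr addrACA; exact: (is_deriveD (pd x v) (qd x v)).
- exists (fun x => f x * g0 x + f0 x * h x), (fun x => f x * g1 x + f1 x * h x); split; try by apply: polyfunD; apply: polyfunM.
  move=> x v; rewrite [X in is_derive _ _ _ X](_ : _ = f x *: (v.1 * g0 x + v.2 * g1 x) + h x *: (v.1 * f0 x + v.2 * f1 x)).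
    exact: (is_deriveM (pd x v) (qd x v)).
  rewrite /GRing.scale /=; ring.
- exists f0, f1; split => //; exact: (polyfunW nm).
Qed.

Lemma polyfun_partial n f i : polyfun n f -> polyfun n (partial i f).
Proof.
move=> /polyfun_is_derive[f0 [f1 [p0 p1 pd]]].
have [->|->] : i = 0 \/ i = 1 by case: i => -[|[|//]] ?; [left|right]; exact/val_inj.
  suff -> : partial 0 f = f0 by []; apply/funext => x; rewrite /partial /basis /=.
  by rewrite (@derive_val _ _ _ _ _ _ _ (pd x (1, 0))) /= mul1r mul0r addr0.
suff -> : partial 1 f = f1 by []; apply/funext => x; rewrite /partial /basis /=.
by rewrite (@derive_val _ _ _ _ _ _ _ (pd x (0, 1))) /= mul1r mul0r add0r.
Qed.

Lemma polyfun_is_derive_partial n f x v : polyfun n f ->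
  is_derive x v f (v.1 * partial 0 f x + v.2 * partial 1 f x).
Proof.
move=> /polyfun_is_derive[f0 [f1 [p0 p1 pd]]]; rewrite [X in is_derive _ _ _ X](_ : _ = v.1 * f0 x + v.2 * f1 x) //.
rewrite /partial /basis /=.
rewrite (@derive_val _ _ _ _ _ _ _ (pd x (1, 0))) (@derive_val _ _ _ _ _ _ _ (pd x (0, 1))) /=.
by rewrite !mul1r !mul0r addr0 add0r.
Qed.

End polynomial_functions.

Section polynomial_integrals.
Context {R : realType}.
Local Notation leb2 := (@leb2 R).
Implicit Types (f g h : R * R -> R) (D : set (R * R)).

Definition within_box (B : R) D := forall x, D x -> `|x.1| <= B /\ `|x.2| <= B.

Lemma within_box_lt_pinfty B D : measurable D -> within_box B D -> (leb2 D < +oo)%E.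
Proof.
move=> mD bD; pose I : set R := `[- B, B]%classic.
have lI : (lebesgue_measure I < +oo)%E by rewrite /I lebesgue_measure_itv; case: ifP => _; rewrite ?ltry.
apply: (@le_lt_trans _ _ (leb2 (I `*` I))).
  apply: le_measure; rewrite ?inE //; first by apply: measurableX; exact: measurable_itv.
  by move=> x /bD[h1 h2]; split; rewrite /I /= in_itv /= -ler_norml.
rewrite /leb2 product_measure1E; [|exact: measurable_itv..].
apply: lte_mul_pinfty => //.
  by rewrite ge0_fin_numE.
Qed.

Lemma polyfun_integrable n f B D : polyfun n f -> measurable D -> within_box B D ->
  leb2.-integrable D (EFin \o f).
Proof.
move=> pf mD bD; apply: measurable_bounded_integrable => //.
- exact: within_box_lt_pinfty bD.
- apply: (measurable_funS measurableT) => //; apply: continuous_measurable_fun2; first exact: openT.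
  by move=> x _; exact: polyfun_continuous pf x.
- have [C C0 HC] := polyfun_bounded B pf.
  exists C; split; first exact: num_real.
  by move=> M CM x /bD[h1 h2] /=; apply: (le_trans _ (ltW CM)); exact: HC.
Qed.

Lemma polyfun_partial_affine n f i v0 e1 e2 x : polyfun n f ->
  partial i (f \o affine_map v0 e1 e2) x =
  let e := if i == 0 then e1 else e2 in
  e.1 * partial 0 f (affine_map v0 e1 e2 x) + e.2 * partial 1 f (affine_map v0 e1 e2 x).
Proof.
move=> pf /=; set e := if _ then _ else _; set p := affine_map _ _ _ x.
have -> : partial i (f \o affine_map v0 e1 e2) x = 'D_e f p.
  have E : (fun h : R => h^-1 *: (((f \o affine_map v0 e1 e2) \o shift x) (h *: Defs.basis i)
        - (f \o affine_map v0 e1 e2) x)) = (fun h : R => h^-1 *: ((f \o shift p) (h *: e) - f p)).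
    apply/funext => h /=; congr (_ *: (f _ - _)); rewrite /e /p /affine_map /Defs.basis.
    case: ifP => _ /=; congr (_, _); rewrite /GRing.scale /=;
      match goal with |- ?l = ?a *: ?b + ?r => change (l = a * b + r) end; ring.
  by rewrite /partial /derive E.
by rewrite (@derive_val _ _ _ _ _ _ _ (polyfun_is_derive_partial p e pf)).
Qed.

(** If the square integral vanishes, f vanishes almost everywhere on D, hence on a
    dense subset, hence on D by continuity. *)
Lemma polyfun_eq0 n f B D : open D -> within_box B D -> polyfun n f ->
  \int[leb2]_(x in D) (f x ^+ 2) = 0 -> forall x, D x -> f x = 0.
Proof.
move=> oD bD pf.
have pf2 : polyfun (2 * n) (fun x => f x ^+ 2) by exact: polyfunX.
have int2 := polyfun_integrable pf2 (open_measurable2 oD) bD.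
have cf := polyfun_continuous pf.
move=> int0.
have ae0 : {ae leb2, forall x, D x -> f x = 0}.
  have : (\int[leb2]_(x in D) `|(f x ^+ 2)%:E| = 0)%E.
    under eq_integral do rewrite gee0_abs ?lee_fin ?sqr_ge0 //.
    have fin : (\int[leb2]_(x in D) (f x ^+ 2)%:E)%E \is a fin_num by apply: integrable_fin_num => //; exact: open_measurable2.
    by rewrite -(fineK fin) -[fine _]/(\int[leb2]_(x in D) (f x ^+ 2)) int0.
  move/(ae_eq_integral_abs leb2 (open_measurable2 oD) (measurable_int _ int2)).
  apply: filterS => x /= H Dx; have /eqP := H Dx; rewrite eqe sqrf_eq0 => /eqP //.
move=> x Dx; apply: contrapT => /eqP fx0.
pose U := f @^-1` [set y | y != 0].
have oU : open U by apply: open_comp => //; exact: open_neq.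
have [|y [Uy _] fy0] := ae_open_dense oD ae0 oU; first by exists x.
by move: Uy; rewrite /U /= fy0 eqxx.
Qed.

End polynomial_integrals.

(** * Interpolation and the inverse inequality on the reference triangle *)

Section reference_triangle.
Context {R : realType}.
Local Notation leb2 := (@leb2 R).
Implicit Types (f g : R * R -> R).

Definition ref_triangle : set (R * R) := [set x | [/\ 0 < x.1, 0 < x.2 & x.1 + x.2 < 1]].

Lemma open_ref_triangle : open ref_triangle.
Proof.
apply: open2P => x [x1 x2 x3].
pose e := Num.min (Num.min x.1 x.2) ((1 - (x.1 + x.2)) / 2).
have e0 : 0 < e by rewrite !lt_min x1 x2 /= divr_gt0 // subr_gt0.
have [e1 e2 e3] : [/\ e <= x.1, e <= x.2 & e <= (1 - (x.1 + x.2)) / 2].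
  by rewrite /e !ge_min !lexx !orbT.
exists e => // y; rewrite !ltr_norml => /andP[h1 h2] /andP[k1 k2]; split; lra.
Qed.

Lemma ref_triangle_box : within_box 1 ref_triangle.
Proof. move=> x [x1 x2 x3]; split; rewrite ler_norml; apply/andP; split; lra. Qed.

Lemma measurable_ref_triangle : measurable ref_triangle.
Proof. exact: open_measurable2 open_ref_triangle. Qed.

Section interpolation.
Variable k : nat.

(** The nodes are a/(2k + 4) with 1 <= a <= k + 1: the coordinates of a grid point
    add up to at most (2k + 2)/(2k + 4), so the whole grid lies in the triangle. *)
Definition node1 (a : nat) : R := a.+1%:R / (2 * k.+2)%:R.
Definition node (a : 'I_k.+1 * 'I_k.+1) : R * R := (node1 a.1, node1 a.2).
Definition lagrange1 (a : 'I_k.+1) : {poly R} := tnth (k.+1.-lagrange node1) a.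
Definition lagrange2 (a : 'I_k.+1 * 'I_k.+1) : R * R -> R :=
  fun x => (lagrange1 a.1).[x.1] * (lagrange1 a.2).[x.2].

Lemma node1_inj : injective node1.
Proof.
move=> a b /(congr1 (fun x => x * (2 * k.+2)%:R)); rewrite !divfK ?pnatr_eq0 //.
by move/eqP; rewrite eqr_nat => /eqP [].
Qed.

Lemma node_ref_triangle a : ref_triangle (node a).
Proof.
case: a => a b; split; rewrite /node /node1 /=.
- by rewrite divr_gt0 ?ltr0n.
- by rewrite divr_gt0 ?ltr0n.
- rewrite -mulrDl ltr_pdivrMr ?ltr0n // mul1r -natrD ltr_nat.
  by have := ltn_ord a; have := ltn_ord b; lia.
Qed.

Lemma polyfun_lagrange2 a : exists n, polyfun n (lagrange2 a).
Proof.
have H1 (p : {poly R}) : polyfun (size p) (fun x => p.[x.1]).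
  rewrite (_ : (fun x => _) = (fun x : R * R => \sum_(i < size p) p`_i * x.1 ^+ i)); last first.
    by apply/funext => x; rewrite horner_coef.
  apply: polyfun_sum => i _; apply: (@polyfunW _ i); first exact/ltnW.
  apply: polyfunZ; rewrite -[X in polyfun X]muln1; apply: polyfunX; exact: polyfun_fst.
have H2 (p : {poly R}) : polyfun (size p) (fun x => p.[x.2]).
  rewrite (_ : (fun x => _) = (fun x : R * R => \sum_(i < size p) p`_i * x.2 ^+ i)); last first.
    by apply/funext => x; rewrite horner_coef.
  apply: polyfun_sum => i _; apply: (@polyfunW _ i); first exact/ltnW.
  apply: polyfunZ; rewrite -[X in polyfun X]muln1; apply: polyfunX; exact: polyfun_snd.
by eexists; apply: polyfunM; [exact: H1|exact: H2].
Qed.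

Lemma lagrange_interp (p : {poly R}) x : (size p <= k.+1)%N ->
  p.[x] = \sum_(a < k.+1) p.[node1 a] * (lagrange1 a).[x].
Proof.
move=> sp; rewrite {1}(lagrange_gen (ltn0Sn k) node1_inj sp) horner_sum.
by apply: eq_bigr => a _; rewrite hornerM hornerC.
Qed.

(** Interpolation in the first variable on the line through x, then in the second
    one on the vertical lines through the nodes. *)
Lemma polyfun_interp f x : polyfun k f -> f x = \sum_a f (node a) * lagrange2 a x.
Proof.
move=> pf; rewrite -(pair_bigA _ (fun a b => f (node (a, b)) * lagrange2 (a, b) x)) /=.
have [p sp pE] := polyfun_slice1 x.2 pf.
rewrite {1}(surjective_pairing x) pE (lagrange_interp _ sp).
apply: eq_bigr => a _; rewrite -pE.
have [q sq qE] := polyfun_slice2 (node1 a) pf.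
rewrite qE (lagrange_interp _ sq) mulr_suml; apply: eq_bigr => b _.
by rewrite -qE /lagrange2 /= -mulrA [X in _ * X]mulrC.
Qed.

Lemma lagrange2_node a b : lagrange2 a (node b) = (a == b)%:R.
Proof.
rewrite /lagrange2 /node /lagrange1 /= !lagrange_sample //; try exact: node1_inj.
by case: a b => [a1 a2] [b1 b2] /=; rewrite xpair_eqE; do 2 case: eqP => _; rewrite ?mulr1 ?mulr0.
Qed.

End interpolation.

(** The integral of (f - t g)^2 is nonnegative for t = b/(1 + B), where b is the
    integral of f g and B that of g^2. The factor 1 + B in place of B covers the
    degenerate case B = 0. *)
Lemma polyfun_cauchy_schwarz n m f g : polyfun n f -> polyfun m g ->
  `|\int[leb2]_(x in ref_triangle) (f x * g x)| <=
  Num.sqrt (1 + \int[leb2]_(x in ref_triangle) (g x ^+ 2)) * Num.sqrt (\int[leb2]_(x in ref_triangle) (f x ^+ 2)).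
Proof.
move=> pf pg.
have int n' h : polyfun n' h -> leb2.-integrable ref_triangle (EFin \o h).
  by move=> ph; apply: polyfun_integrable ph measurable_ref_triangle ref_triangle_box.
have mT := measurable_ref_triangle.
have If := int _ _ (polyfunX 2 pf).
have Ig := int _ _ (polyfunX 2 pg).
have Ifg := int _ _ (polyfunM pf pg).
set b := \int[leb2]_(x in _) (f x * g x); set B := \int[leb2]_(x in _) (g x ^+ 2).
set S := \int[leb2]_(x in _) (f x ^+ 2).
have B0 : 0 <= B by apply: Rintegral_ge0 => x _; exact: sqr_ge0.
have S0 : 0 <= S by apply: Rintegral_ge0 => x _; exact: sqr_ge0.
pose t := b / (1 + B).
have Q : S - 2 * t * b + t ^+ 2 * B = \int[leb2]_(x in ref_triangle) ((f x - t * g x) ^+ 2).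
  transitivity (\int[leb2]_(x in ref_triangle) (f x ^+ 2 + ((- (2 * t)) * (f x * g x) + t ^+ 2 * g x ^+ 2))).
    have I1 := int _ _ (polyfunZ (- (2 * t)) (polyfunM pf pg)).
    have I2 := int _ _ (polyfunZ (t ^+ 2) (polyfunX 2 pg)).
    have I3 : leb2.-integrable ref_triangle (EFin \o (fun x => - (2 * t) * (f x * g x) + t ^+ 2 * g x ^+ 2)).
      apply: (int (n + m + 2 * m)%N); apply: polyfunD; apply: polyfunZ;
        [apply: (polyfunW _ (polyfunM pf pg))|apply: (polyfunW _ (polyfunX 2 pg))]; lia.
    rewrite RintegralD // RintegralD //.
    by rewrite !RintegralZl // -/b -/B -/S mulNr addrA.
  by apply: eq_Rintegral => x _; ring.
have Q0 : 0 <= S - 2 * t * b + t ^+ 2 * B.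
  by rewrite Q; apply: Rintegral_ge0 => x _; exact: sqr_ge0.
have B1 : 0 < 1 + B by rewrite ltr_pwDl.
have le : b ^+ 2 <= (1 + B) * S.
  have tb : t * (1 + B) = b by rewrite /t divfK // gt_eqF.
  have h : t ^+ 2 * (2 + B) <= S.
    by rewrite -subr_ge0 (_ : S - _ = S - 2 * t * b + t ^+ 2 * B) // -tb; ring.
  apply: (@le_trans _ _ ((1 + B) * (t ^+ 2 * (2 + B)))); last by rewrite ler_wpM2l // ltW.
  rewrite -tb exprMn expr2 mulrC -mulrA ler_wpM2l ?(ltW B1) // mulrC ler_wpM2l ?sqr_ge0 //.
  by rewrite lerD2r ler1n.
rewrite -sqrtrM; last exact: ltW.
by rewrite -sqrtr_sqr; apply: ler_wsqrtr.
Qed.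

(** Inverse inequality, by finite dimension. The Gram matrix of the Lagrange
    functions is invertible because a combination orthogonal to all of them has zero
    square integral, hence vanishes at the nodes. So the nodal values of f are a fixed
    linear image of its moments against these functions, and the moments are bounded
    by Cauchy-Schwarz. *)
Lemma ref_sup_bound (k : nat) : exists2 C : R, 0 <= C & forall f x, polyfun k f ->
  `|x.1| <= 1 -> `|x.2| <= 1 ->
  f x ^+ 2 <= C * \int[leb2]_(y in ref_triangle) (f y ^+ 2).
Proof.
have int n' h : polyfun n' h -> leb2.-integrable ref_triangle (EFin \o h).
  by move=> ph; apply: polyfun_integrable ph measurable_ref_triangle ref_triangle_box.
have mT := measurable_ref_triangle.
pose I := ('I_k.+1 * 'I_k.+1)%type; pose N := #|{: I}|.
pose l (i : 'I_N) : R * R -> R := lagrange2 (enum_val i).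
have /boolp.choice[nl pl] : forall i, exists n, polyfun n (l i) by move=> i; exact: polyfun_lagrange2.
pose G : 'M[R]_N := \matrix_(i, j) \int[leb2]_(y in ref_triangle) (l i y * l j y).
have interp f : polyfun k f -> f = fun x => \sum_i f (node (enum_val i)) * l i x.
  move=> pf; apply/funext => x; rewrite (polyfun_interp x pf).
  rewrite (reindex (@enum_val I predT)) //; exact/onW_bij/enum_val_bij.
have intsum (F : 'I_N -> R * R -> R) (nF : 'I_N -> nat) : (forall i, polyfun (nF i) (F i)) ->
    \int[leb2]_(y in ref_triangle) (\sum_i F i y) = \sum_i \int[leb2]_(y in ref_triangle) F i y.
  move=> pF; pose M := \max_i nF i.
  have pM i : polyfun M (F i) by apply: polyfunW (pF i); exact: leq_bigmax.
  elim: (index_enum _) => [|i s IH].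
    rewrite big_nil; under eq_Rintegral do rewrite big_nil.
    by rewrite Rintegral_cst // mul0r.
  rewrite big_cons -IH; under eq_Rintegral do rewrite big_cons.
  rewrite RintegralD //; first exact: int (pM i).
  by apply: (int M); apply: polyfun_sum.
(* For v in the kernel of G, f is orthogonal to every l j, and f (node i) = v_i. *)
have Gfree : G \in unitmx.
  rewrite -row_free_unit; apply: inj_row_free => v vG.
  pose f x := \sum_i v 0 i * l i x.
  have pf : polyfun (\max_i nl i) f.
    by apply: polyfun_sum => i _; apply: polyfunZ; apply: polyfunW (pl i); exact: leq_bigmax.
  have f2 : \int[leb2]_(y in ref_triangle) (f y ^+ 2) = 0.
    transitivity (\int[leb2]_(y in ref_triangle) \sum_j (v 0 j * (f y * l j y))).
      apply: eq_Rintegral => y _; rewrite expr2 {2}/f mulr_sumr; apply: eq_bigr => j _; ring.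
    rewrite (intsum (fun j y => v 0 j * (f y * l j y)) (fun j => \max_i nl i + nl j)%N); last first.
      by move=> j; apply: polyfunZ; exact: polyfunM.
    apply: big1 => j _; rewrite RintegralZl //; last by apply: int; exact: polyfunM pf (pl j).
    suff -> : \int[leb2]_(y in ref_triangle) (f y * l j y) = (v *m G) 0 j by rewrite vG mxE mulr0.
    rewrite mxE; under [RHS]eq_bigr do rewrite mxE.
    transitivity (\int[leb2]_(y in ref_triangle) \sum_i (v 0 i * (l i y * l j y))).
      by apply: eq_Rintegral => y _; rewrite /f mulr_suml; apply: eq_bigr => i _; rewrite -mulrA.
    rewrite (intsum (fun i y => v 0 i * (l i y * l j y)) (fun i => nl i + nl j)%N); last by move=> i; apply: polyfunZ; exact: polyfunM.
    by apply: eq_bigr => i _; rewrite RintegralZl //; apply: int; exact: polyfunM.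
  have f0 := polyfun_eq0 open_ref_triangle ref_triangle_box pf f2.
  apply/rowP => i; rewrite mxE -(f0 _ (node_ref_triangle (enum_val i))) /f (bigD1 i) //= big1 ?addr0.
    by rewrite /l lagrange2_node eqxx mulr1.
  move=> j ji; rewrite /l lagrange2_node; case: eqP => [/enum_val_inj e|]; rewrite ?mulr0 //.
  by rewrite e eqxx in ji.
have [B B0 HB] : exists2 B : 'I_N -> R, (forall i, 0 <= B i) & forall i x, `|x.1| <= 1 -> `|x.2| <= 1 -> `|l i x| <= B i.
  have /boolp.choice[B HB] : forall i, exists B, 0 <= B /\ forall x, `|x.1| <= 1 -> `|x.2| <= 1 -> `|l i x| <= B.
    by move=> i; have [C C0 HC] := polyfun_bounded 1 (pl i); exists C; split.
  by exists B => i; case: (HB i).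
pose sq j := Num.sqrt (1 + \int[leb2]_(x in ref_triangle) (l j x ^+ 2)).
pose C := \sum_i (\sum_j sq j * `|invmx G j i|) * B i.
have C0 : 0 <= C.
  by apply: sumr_ge0 => i _; apply: mulr_ge0 => //; apply: sumr_ge0 => j _; rewrite mulr_ge0 ?sqrtr_ge0.
exists (C ^+ 2); first exact: sqr_ge0.
move=> f x pf x1 x2; set S := \int[leb2]_(y in _) _.
have S0 : 0 <= S by apply: Rintegral_ge0 => y _; exact: sqr_ge0.
pose c : 'rV[R]_N := \row_i f (node (enum_val i)).
pose b := \row_j \int[leb2]_(y in ref_triangle) (f y * l j y).
have cG : c *m G = b.
  apply/rowP => j; rewrite !mxE; under eq_bigr do rewrite !mxE.
  transitivity (\int[leb2]_(y in ref_triangle) \sum_i (f (node (enum_val i)) * (l i y * l j y))).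
    rewrite (intsum (fun i y => f (node (enum_val i)) * (l i y * l j y)) (fun i => nl i + nl j)%N); last by move=> i; apply: polyfunZ; exact: polyfunM.
    by apply: eq_bigr => i _; rewrite RintegralZl //; apply: int; exact: polyfunM.
  apply: eq_Rintegral => y _; rewrite [in RHS](interp _ pf) mulr_suml; apply: eq_bigr => i _; by rewrite -mulrA.
have ci i : `|f (node (enum_val i))| <= (\sum_j sq j * `|invmx G j i|) * Num.sqrt S.
  have -> : f (node (enum_val i)) = (b *m invmx G) 0 i by rewrite -cG mulmxK // mxE.
  rewrite mxE; apply: (le_trans (ler_norm_sum _ _ _)); rewrite mulr_suml; apply: ler_sum => j _.
  rewrite normrM mulrAC ler_wpM2r // mxE; exact: polyfun_cauchy_schwarz pf (pl j).
have fx : `|f x| <= C * Num.sqrt S.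
  rewrite (interp _ pf); apply: (le_trans (ler_norm_sum _ _ _)); rewrite mulr_suml; apply: ler_sum => i _.
  rewrite normrM mulrAC; apply: ler_pM => //; exact: HB.
rewrite -[S]sqr_sqrtr // -exprMn -real_normK ?num_real // lerXn2r ?nnegrE // mulr_ge0 ?sqrtr_ge0 //.
Qed.

End reference_triangle.

(** * The divergence theorem on the reference triangle *)

Section reference_divergence.
Context {R : realType}.
Local Notation leb2 := (@leb2 R).
Implicit Types (f g : R * R -> R).

Lemma continuous_within (f : R -> R) (A : set R) : continuous f -> {within A, continuous f}.
Proof. exact: continuous_subspaceT. Qed.

Lemma polyfun_slice_continuous n f y : polyfun n f -> continuous (fun x => f (x, y)).
Proof.
move=> pf; have [p _ pE] := polyfun_slice1 y pf.
rewrite (_ : (fun x => _) = fun x => p.[x]); last exact/funext.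
exact: continuous_horner.
Qed.

Lemma polyfun_is_derive_slice n f (x y : R) : polyfun n f ->
  is_derive x 1 (fun s => f (s, y)) (partial 0 f (x, y)).
Proof.
move=> pf; have [d1 d2] := polyfun_is_derive_partial (x, y) (1, 0) pf.
have E : (fun h : R => h^-1 *: (((fun s => f (s, y)) \o shift x) (h *: 1) - f (x, y)))
       = (fun h : R => h^-1 *: ((f \o shift (x, y)) (h *: (1, 0)) - f (x, y))).
  apply/funext => h /=; congr (_ *: (f _ - _)).
  by congr (_, _); rewrite /= scaler0 add0r.
apply: DeriveDef; first by rewrite /derivable E.
rewrite /derive E; exact: (etrans d2 _); rewrite /= mul1r mul0r addr0.
Qed.

Lemma FTC_slice n f (y b : R) : polyfun n f -> 0 < b ->
  \int[leb1]_(x in `[0, b]) (partial 0 f (x, y)) = f (b, y) - f (0, y).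
Proof.
move=> pf b0; have pd := polyfun_partial 0 pf.
have cf := @polyfun_slice_continuous _ _ y pf.
have H x := @polyfun_is_derive_slice _ _ x y pf.
rewrite /Rintegral (@continuous_FTC2 _ (fun x => partial 0 f (x, y)) (fun x => f (x, y))) //.
- apply: continuous_within; exact: polyfun_slice_continuous pd.
- split.
  + by move=> x _; case: (H x).
  + by apply: cvg_at_right_filter; exact: cf.
  + by apply: cvg_at_left_filter; exact: cf.
- by move=> x _; rewrite derive1E; case: (H x).
Qed.

(** Fubini: the slice of the triangle at height y is ]0, 1 - y[, where the
    fundamental theorem of calculus applies. *)
Lemma ref_divergence0 n f : polyfun n f ->
  \int[leb2]_(x in ref_triangle) partial 0 f x =
  \int[leb1]_(s in `[0, 1]) (f (1 - s, s) - f (0, s)).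
Proof.
move=> pf; have pd := polyfun_partial 0 pf; set g := partial 0 f in pd *.
have mT := @measurable_ref_triangle R.
have ig := polyfun_integrable pd mT (@ref_triangle_box R).
pose h := g \_ ref_triangle.
have ih : leb2.-integrable setT (EFin \o h).
  by rewrite /h -restrict_EFin; apply/integrable_restrict => //; rewrite setTI.
rewrite Rintegral_mkcond /Rintegral -[X in fine X = _]/(\int[leb2]_x (EFin \o h) x)%E.
rewrite /Defs.leb2 -(integral21_prod_meas1 ih).
have inner y : fubini_G leb1 (EFin \o h) y = ((fun s => (f (1 - s, s) - f (0, s))%:E) \_ `]0, 1[) y.
  rewrite /fubini_G patchE; case: ifPn => [|ny].
    rewrite inE /= in_itv /= => /andP[y0 y1].
    have b0 : 0 < 1 - y by rewrite subr_gt0.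
    have cg := @polyfun_slice_continuous _ _ y pd.
    have ic : leb1.-integrable `[0, 1 - y] (EFin \o (fun x => g (x, y))).
      apply: continuous_compact_integrable; first exact: segment_compact.
      exact: continuous_within.
    have -> : (fun x => (EFin \o h) (x, y)) = (EFin \o (fun x => g (x, y))) \_ `]0, 1 - y[.
      apply/funext => x; rewrite /= /h !patchE.
      have -> : ((x, y) \in ref_triangle) = (x \in `]0, 1 - y[%classic).
        apply/idP/idP; rewrite !inE /= in_itv /=.
          by move=> [/= h1 h2 h3]; rewrite h1 ltrBrDr h3.
        by move=> /andP[h1 h2]; split => //=; rewrite -ltrBrDr.
      by case: ifP.
    rewrite -integral_mkcond -(@FTC_slice _ _ y _ pf b0) /Rintegral fineK; last exact: integrable_fin_num.
    rewrite -(@integral_itv_bndoo _ _ _ _ true false) //.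
    apply: (@measurable_int _ _ _ leb1); apply: integrableS ic => //; exact: subset_itv_oo_cc.
  apply: integral0_eq => x _; rewrite /= /h patchE; case: ifPn => //; rewrite inE => -[/= h1 h2 h3].
  by move: ny; rewrite notin_setE /= in_itv /= h2 /=; case; lra.
pose I : set R := `]0, 1[%classic.
pose K : R -> \bar R := (fun s : R => (f (1 - s, s) - f (0, s))%:E) \_ I.
transitivity (fine (\int[leb1]_y K y)%E).
  by congr fine; apply: eq_integral => y _; exact: inner.
rewrite /K -integral_mkcond /I (@integral_itv_bndoo _ _ _ _ true false) //.
have ck : continuous (fun s : R => f (1 - s, s) - f (0, s)).
  have cp (u : R -> R * R) : continuous u -> continuous (fun s => f (u s)).
    by move=> cu x; apply: continuous_comp; [exact: cu|exact: polyfun_continuous pf _].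
  have c1 : continuous (fun s : R => 1 - s).
    by move=> z; apply: cvgB; [exact: cvg_cst|exact: cvg_id].
  move=> x; apply: cvgB; apply: cp => z.
  - exact: cvg_pair (c1 z) cvg_id.
  - exact: cvg_pair (cvg_cst _) cvg_id.
  apply: (@measurable_int _ _ _ leb1).
apply: (@integrableS _ _ _ leb1 `[0, 1]) => //; first exact: subset_itv_oo_cc.
apply: continuous_compact_integrable; first exact: segment_compact.
exact: continuous_within.
Qed.

(** The triangle is invariant under the exchange of the coordinates. *)
Lemma ref_divergence1 n f : polyfun n f ->
  \int[leb2]_(x in ref_triangle) partial 1 f x =
  \int[leb1]_(s in `[0, 1]) (f (s, 1 - s) - f (s, 0)).
Proof.
move=> pf; have pd := polyfun_partial 1 pf.
have mT := @measurable_ref_triangle R.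
have ig := polyfun_integrable pd mT (@ref_triangle_box R).
pose phi := affine_map (0, 0) (0, 1) ((1, 0) : R * R).
have phiE x : phi x = (x.2, x.1) by rewrite /phi /affine_map /=; congr (_, _); ring.
have cr : cross (0, 1) ((1, 0) : R * R) = -1 by rewrite /cross /=; ring.
rewrite (@Rintegral_affine_map _ (0, 0) (0, 1) (1, 0)) //; last by rewrite cr oppr_eq0 oner_neq0.
rewrite -/phi cr normrN1 mul1r.
have -> : phi @^-1` ref_triangle = ref_triangle.
  apply/seteqP; split => x; rewrite /= phiE => -[/= h1 h2 h3]; split => //=; lra.
have pfp := polyfun_affine (0, 0) (0, 1) (1, 0) pf.
transitivity (\int[leb2]_(x in ref_triangle) partial 0 (f \o phi) x).
  by apply: eq_Rintegral => x _; rewrite (polyfun_partial_affine 0 _ _ _ _ pf) /= -/phi; ring.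
rewrite (ref_divergence0 pfp); apply: eq_Rintegral => s _ /=.
by rewrite -/phi !phiE.
Qed.

End reference_divergence.

(** * Triangles as affine images of the reference triangle *)

Section triangles.
Context {R : realType}.
Local Notation leb2 := (@leb2 R).
Variable m : mesh R.
Implicit Types (K : 'I_(nelt m)) (f g : R * R -> R).

Definition tri_map K : R * R -> R * R :=
  affine_map (vtx K 0) (vtx K 1 - vtx K 0) (vtx K 2%:R - vtx K 0).

Lemma sum3 (V : nmodType) (F : 'I_3 -> V) : \sum_i F i = F 0 + F 1 + F 2%:R.
Proof.
rewrite !big_ord_recl big_ord0 addr0 addrA; congr (F _ + F _ + F _); exact/val_inj.
Qed.

Lemma forall3 (P : 'I_3 -> Prop) : P 0 -> P 1 -> P 2%:R -> forall i, P i.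
Proof.
by move=> p0 p1 p2 [[|[|[|//]]] h]; [move: p0|move: p1|move: p2]; congr P; exact/val_inj.
Qed.

Lemma ord3P (i : 'I_3) : [\/ i = 0, i = 1 | i = 2%:R].
Proof. by move: i; apply: forall3; [constructor 1|constructor 2|constructor 3]. Qed.

Lemma tri_mapE K x : tri_map K x = (1 - x.1 - x.2) *: vtx K 0 + x.1 *: vtx K 1 + x.2 *: vtx K 2%:R.
Proof.
rewrite /tri_map /affine_map; congr (_, _) => /=; rewrite /GRing.scale /=; ring.
Qed.

Definition bary (x : R * R) : 'I_3 -> R := fun i => [:: 1 - x.1 - x.2; x.1; x.2]`_i.

Lemma bary_sum x : \sum_i bary x i = 1.
Proof. by rewrite sum3 /bary /=; ring. Qed.

Lemma bary_comb K x : \sum_i bary x i *: vtx K i = tri_map K x.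
Proof. by rewrite sum3 tri_mapE. Qed.

Lemma comb_tri_map K (l : 'I_3 -> R) : \sum_i l i = 1 ->
  \sum_i l i *: vtx K i = tri_map K (l 1, l 2%:R).
Proof.
rewrite !sum3 tri_mapE /= => l1; congr (_ *: _ + _ + _); rewrite -l1; ring.
Qed.

Lemma hullP K x : hull K x <-> exists y, [/\ 0 <= y.1, 0 <= y.2, y.1 + y.2 <= 1 & x = tri_map K y].
Proof.
split=> [[l [l0 l1 ->]]|[y [y1 y2 y3 ->]]].
  exists (l 1, l 2%:R); split => //=; last exact: comb_tri_map.
  by rewrite -l1 sum3 -addrA lerDr.
exists (bary y); split; [|exact: bary_sum|by rewrite bary_comb].
by apply: forall3; rewrite /bary //=; lra.
Qed.

Lemma eltP K x : elt K x <-> exists2 y, ref_triangle y & x = tri_map K y.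
Proof.
split=> [[l [l0 l1 ->]]|[y [y1 y2 y3] ->]].
  exists (l 1, l 2%:R); last exact: comb_tri_map.
  by split => //=; rewrite -l1 sum3 -addrA ltrDr.
exists (bary y); split; [|exact: bary_sum|by rewrite bary_comb].
by apply: forall3; rewrite /bary //=; lra.
Qed.

Lemma elt_hull K : elt K `<=` hull K.
Proof. by move=> x [l [l0 l1 ->]]; exists l; split => // i; exact: ltW. Qed.

Lemma area2E K : area2 K = cross (vtx K 1 - vtx K 0) (vtx K 2%:R - vtx K 0).
Proof. by []. Qed.

Section nondegenerate.
Variable K : 'I_(nelt m).
Hypothesis a0 : area2 K != 0.

(** Cramer's rule for the affine map [tri_map K]. *)
Definition tri_inv : R * R -> R * R :=
  let e1 := vtx K 1 - vtx K 0 in let e2 := vtx K 2%:R - vtx K 0 in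
  affine_map (- cross (vtx K 0) e2 / area2 K, cross (vtx K 0) e1 / area2 K)
    (e2.2 / area2 K, - e1.2 / area2 K) (- e2.1 / area2 K, e1.1 / area2 K).

Lemma tri_mapK : cancel (tri_map K) tri_inv.
Proof.
move: a0; rewrite /area2 /= => n0 x.
rewrite /tri_inv /tri_map /affine_map /cross /area2 /= [RHS]surjective_pairing.
by congr (_, _); field.
Qed.

Lemma tri_invK : cancel tri_inv (tri_map K).
Proof.
move: a0; rewrite /area2 /= => n0 x.
rewrite /tri_inv /tri_map /affine_map /cross /area2 /= [RHS]surjective_pairing.
by congr (_, _); field.
Qed.

Lemma eltE : elt K = tri_inv @^-1` ref_triangle.
Proof.
apply/seteqP; split => x /=; rewrite eltP; first by move=> [y Ty ->]; rewrite tri_mapK.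
by move=> Tx; exists (tri_inv x) => //; rewrite tri_invK.
Qed.

Lemma tri_map_preimage : tri_map K @^-1` elt K = ref_triangle.
Proof. by rewrite eltE; apply/seteqP; split => x /=; rewrite tri_mapK. Qed.

Lemma continuous_affine_map (v e1 e2 : R * R) : continuous (affine_map v e1 e2).
Proof.
move=> x.
have h1 := polyfun_continuous (polyfun_affine v e1 e2 polyfun_fst) (x := x).
have h2 := polyfun_continuous (polyfun_affine v e1 e2 polyfun_snd) (x := x).
exact: cvg_pair h1 h2.
Qed.

Lemma open_elt : open (elt K).
Proof.
rewrite eltE; apply: open_comp; last exact: open_ref_triangle.
by move=> x _; exact: continuous_affine_map.
Qed.

Lemma measurable_elt : measurable (elt K).
Proof. exact: open_measurable2 open_elt. Qed.

Lemma elt_within_box : exists B, within_box B (elt K).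
Proof.
have [B1 _ H1] := polyfun_bounded 1 (polyfun_affine (vtx K 0) (vtx K 1 - vtx K 0) (vtx K 2%:R - vtx K 0) polyfun_fst).
have [B2 _ H2] := polyfun_bounded 1 (polyfun_affine (vtx K 0) (vtx K 1 - vtx K 0) (vtx K 2%:R - vtx K 0) polyfun_snd).
exists (Num.max B1 B2) => x /eltP[y /ref_triangle_box[y1 y2] ->]; split; rewrite le_max.
  by apply/orP; left; exact: H1.
by apply/orP; right; exact: H2.
Qed.

Lemma polyfun_integrable_elt n f : polyfun n f -> leb2.-integrable (elt K) (EFin \o f).
Proof. have [B bB] := elt_within_box => pf; exact: polyfun_integrable pf measurable_elt bB. Qed.

Lemma Rintegral_elt n f : polyfun n f ->
  \int[leb2]_(x in elt K) f x = `|area2 K| * \int[leb2]_(x in ref_triangle) f (tri_map K x).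
Proof.
move=> pf; rewrite (Rintegral_affine_map (vtx K 0) (e1 := vtx K 1 - vtx K 0) (e2 := vtx K 2%:R - vtx K 0)) //.
- by rewrite -area2E -/(tri_map K) tri_map_preimage.
- exact: measurable_elt.
- exact: polyfun_integrable_elt pf.
Qed.

End nondegenerate.

Lemma hull_box (K : 'I_(nelt m)) x : hull K x -> exists y, [/\ `|y.1| <= 1, `|y.2| <= 1 & x = tri_map K y].
Proof.
move=> /hullP[y [y1 y2 y3 ->]]; exists y; split=> //; rewrite ger0_norm //; lra.
Qed.

End triangles.

(** The constant is that of the reference triangle: the affine map onto K preserves
    values and multiplies integrals by |area2 K|. *)
Lemma elt_sup_bound (R : realType) (k : nat) : exists2 C : R, 0 <= C &
  forall (m : mesh R) (K : 'I_(nelt m)) f x, area2 K != 0 -> polyfun k f -> hull K x ->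
    f x ^+ 2 <= C / `|area2 K| * \int[leb2]_(y in elt K) (f y ^+ 2).
Proof.
have [C C0 HC] := @ref_sup_bound R k; exists C => // m K f x a0 pf /hull_box[y [y1 y2 ->]].
rewrite (Rintegral_elt a0 (polyfunX 2 pf)) mulrA divfK ?normr_eq0 //.
exact: (HC _ _ (polyfun_affine _ _ _ pf) y1 y2).
Qed.

(** * The divergence theorem on triangles *)

Section partial_linear.
Context {R : realType}.
Implicit Types (f g : R * R -> R).

Lemma partialD n f g i x : polyfun n f -> polyfun n g ->
  partial i (fun y => f y + g y) x = partial i f x + partial i g x.
Proof.
move=> pf pg; apply: deriveD; first by case: (polyfun_is_derive_partial x (Defs.basis i) pf).
by case: (polyfun_is_derive_partial x (Defs.basis i) pg).
Qed.

Lemma partialZ n f (c : R) i x : polyfun n f -> partial i (fun y => c * f y) x = c * partial i f x.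
Proof.
by move=> pf; apply: deriveZ; case: (polyfun_is_derive_partial x (Defs.basis i) pf).
Qed.

Lemma partial_cst (c : R) i x : partial i (fun=> c) x = 0.
Proof. exact: derive_cst. Qed.

Lemma partialM n k f g i x : polyfun n f -> polyfun k g ->
  partial i (fun y => f y * g y) x = f x * partial i g x + g x * partial i f x.
Proof.
move=> pf pg; apply: deriveM; first by case: (polyfun_is_derive_partial x (Defs.basis i) pf).
by case: (polyfun_is_derive_partial x (Defs.basis i) pg).
Qed.

Lemma partial_sum n (I : Type) (s : seq I) (c : I -> R) (F : I -> R * R -> R) i x :
  (forall j, polyfun n (F j)) ->
  partial i (fun y => \sum_(j <- s) c j * F j y) x = \sum_(j <- s) c j * partial i (F j) x.
Proof.
move=> pF; elim: s => [|j s IH].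
  rewrite big_nil (_ : (fun y => _) = fun=> 0); first exact: partial_cst.
  by apply/funext => y; rewrite big_nil.
rewrite big_cons -IH -(partialZ _ _ _ (pF j)).
rewrite (_ : (fun y => \sum_(j0 <- j :: s) _) = fun y => c j * F j y + \sum_(j <- s) c j * F j y); last first.
  by apply/funext => y; rewrite big_cons.
by apply: (@partialD n); [exact: polyfunZ|apply: polyfun_sum => j' _; exact: polyfunZ].
Qed.

End partial_linear.

Section unit_interval.
Context {R : realType}.
Implicit Types (h : R -> R).

Lemma continuous_integrable01 h : continuous h -> leb1.-integrable `[0, 1] (EFin \o h).
Proof.
move=> ch; apply: continuous_compact_integrable; first exact: segment_compact.
exact: continuous_within.
Qed.

Lemma Rintegral_onem h : continuous h -> \int[leb1]_(s in `[0, 1]) h (1 - s) = \int[leb1]_(s in `[0, 1]) h s.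
Proof.
move=> ch; rewrite [RHS](@Rintegration_by_substitution_onem _ h 1) ?ler01 ?lexx //.
  by rewrite unstable.onem1.
exact: continuous_within.
Qed.

Lemma continuous_path n (f : R * R -> R) (u v : R * R) : polyfun n f ->
  continuous (fun s : R => f (u + s *: v)).
Proof.
move=> pf; have := polyfun_slice_continuous (y := 0) (polyfun_affine u v 0 pf).
rewrite (_ : (fun x => _) = (fun s : R => f (u + s *: v))) //; apply/funext => s.
rewrite /= /affine_map /=; congr f; rewrite [RHS]surjective_pairing /=; congr (_, _); rewrite /GRing.scale /=; ring.
Qed.

End unit_interval.

Section sides.
Context {R : realType}.
Variable m : mesh R.
Variable K : 'I_(nelt m).
Hypothesis a0 : area2 K != 0.
Implicit Types (f g : R * R -> R).

Lemma ordS0 : ordS (0 : 'I_3) = 1. Proof. exact/val_inj. Qed.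
Lemma ordS1 : ordS (1 : 'I_3) = 2%:R. Proof. exact/val_inj. Qed.
Lemma ordS2 : ordS (2%:R : 'I_3) = 0. Proof. exact/val_inj. Qed.

Definition rot90 (t : R * R) : R * R := (t.2, - t.1).

Lemma side_cross i : cross (side_vec (K, i)) (vtx K i - side_a (K, i)) = area2 K.
Proof.
move: i; apply: forall3; rewrite /side_vec /side_a /side_b /= ?ordS0 ?ordS1 ?ordS2 ?ordS0 ?ordS1 /area2 /cross /=; ring.
Qed.

Lemma enorm_gt0 (v : R * R) : v != 0 -> 0 < enorm v.
Proof.
move=> v0; rewrite /enorm sqrtr_gt0 lt_neqAle addr_ge0 ?sqr_ge0 // andbT eq_sym paddr_eq0 ?sqr_ge0 // !sqrf_eq0.
by apply: contra v0 => /andP[/eqP h1 /eqP h2]; rewrite [v]surjective_pairing h1 h2.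
Qed.

Lemma side_len_gt0 i : 0 < side_len (K, i).
Proof.
apply: enorm_gt0; apply: contra_neq a0 => h; rewrite -(side_cross i) h /cross /=; ring.
Qed.

(** Multiplied by the length of the side, the outward normal becomes linear in the
    vertices, with the same sign, the orientation of K, for the three sides. *)
Lemma out_normalE i : side_len (K, i) *: out_normal (K, i) = Num.sg (area2 K) *: rot90 (side_vec (K, i)).
Proof.
have l0 := side_len_gt0 i; set l := side_len _ in l0 *.
rewrite /out_normal -/l -/(rot90 (side_vec (K, i))); set t := side_vec _.
have -> : edot (l^-1 *: rot90 t) (vtx K i - side_a (K, i)) = - (area2 K / l).
  rewrite -(side_cross i) -/t /cross /edot /rot90 /=; rewrite /GRing.scale /=; ring.
rewrite oppr_lt0 pmulr_lgt0 ?invr_gt0 //.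
have [an|ap|/eqP] := ltgtP (area2 K) 0; last by rewrite (negbTE a0).
  by rewrite (ltr0_sg an) scaleN1r scalerN scalerA divff ?gt_eqF // scale1r.
by rewrite (gtr0_sg ap) scalerA divff ?gt_eqF.
Qed.

Lemma side_pt0 s : side_a (K, 0) + s *: side_vec (K, 0) = tri_map K (1 - s, s).
Proof.
rewrite tri_mapE /side_vec /side_a /side_b /= ordS0 ordS1.
rewrite [LHS]surjective_pairing [RHS]surjective_pairing; congr (_, _); rewrite /= /GRing.scale /=; ring.
Qed.

Lemma side_pt1 s : side_a (K, 1) + s *: side_vec (K, 1) = tri_map K (0, 1 - s).
Proof.
rewrite tri_mapE /side_vec /side_a /side_b /= ordS1 ordS2.
rewrite [LHS]surjective_pairing [RHS]surjective_pairing; congr (_, _); rewrite /= /GRing.scale /=; ring.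
Qed.

Lemma side_pt2 s : side_a (K, 2%:R) + s *: side_vec (K, 2%:R) = tri_map K (s, 0).
Proof.
rewrite tri_mapE /side_vec /side_a /side_b /= ordS2 ordS0.
rewrite [LHS]surjective_pairing [RHS]surjective_pairing; congr (_, _); rewrite /= /GRing.scale /=; ring.
Qed.

Definition side_pt (i : 'I_3) (s : R) := side_a (K, i) + s *: side_vec (K, i).

Lemma side_pt_hull i s : 0 <= s <= 1 -> hull K (side_pt i s).
Proof.
move=> /andP[s0 s1]; move: i; apply: forall3; rewrite /side_pt ?side_pt0 ?side_pt1 ?side_pt2; apply/hullP;
  [exists (1 - s, s)|exists (0, 1 - s)|exists (s, 0)]; split => //=; lra.
Qed.

(** By the Piola transform: the cofactor matrix of [tri_map K] turns (f, g) into a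
    field (F, G) on the reference triangle whose divergence is area2 K times the
    divergence of (f, g), and whose fluxes through the reference sides are those of
    (f, g) up to the orientation of K. *)
Lemma divergence_elt n f g : polyfun n f -> polyfun n g ->
  \int[leb2]_(x in elt K) (partial 0 f x + partial 1 g x) =
  \sum_i side_len (K, i) * \int[leb1]_(s in `[0, 1])
    edot (f (side_pt i s), g (side_pt i s)) (out_normal (K, i)).
Proof.
move=> pf pg; set e1 := vtx K 1 - vtx K 0; set e2 := vtx K 2%:R - vtx K 0.
have mT := @measurable_ref_triangle R.
have intT (n' : nat) (h : R * R -> R) : polyfun n' h -> leb2.-integrable ref_triangle (EFin \o h).
  by move=> ph; apply: polyfun_integrable ph mT (@ref_triangle_box R).
have pfm := polyfun_affine (vtx K 0) e1 e2 pf; have pgm := polyfun_affine (vtx K 0) e1 e2 pg.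
pose F x := e2.2 * f (tri_map K x) + (- e2.1) * g (tri_map K x).
pose G x := (- e1.2) * f (tri_map K x) + e1.1 * g (tri_map K x).
have pF : polyfun n F by apply: polyfunD; apply: polyfunZ.
have pG : polyfun n G by apply: polyfunD; apply: polyfunZ.
have LHSE : \int[leb2]_(x in elt K) (partial 0 f x + partial 1 g x) =
    Num.sg (area2 K) * (\int[leb1]_(s in `[0, 1]) (F (1 - s, s) - F (0, s))
     + \int[leb1]_(s in `[0, 1]) (G (s, 1 - s) - G (s, 0))).
  have pd0 := polyfun_partial 0 pf; have pd1 := polyfun_partial 1 pg.
  rewrite (Rintegral_elt a0 (polyfunD pd0 pd1)) normrEsg -mulrA; congr (_ * _).
  rewrite -(ref_divergence0 pF) -(ref_divergence1 pG) -RintegralD //; last 2 first.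
  - exact: intT (polyfun_partial 0 pF).
  - exact: intT (polyfun_partial 1 pG).
  rewrite -RintegralZl //; last first.
    exact: intT (polyfun_affine (vtx K 0) e1 e2 (polyfunD pd0 pd1)).
  apply: eq_Rintegral => x _.
  rewrite /F /G !(partialD _ _ (polyfunZ _ pfm) (polyfunZ _ pgm)).
  rewrite !(partialZ _ _ _ pfm) !(partialZ _ _ _ pgm) !(polyfun_partial_affine _ _ _ _ _ pf) !(polyfun_partial_affine _ _ _ _ _ pg) /=.
  rewrite area2E -/e1 -/e2 /cross -/(tri_map K x) /e1 /e2 /=; ring.
rewrite LHSE.
have c0 i (h : R * R -> R) k : polyfun k h -> continuous (fun s => h (side_pt i s)) by move=> ph; exact: continuous_path ph.
have RHSE i : side_len (K, i) * \int[leb1]_(s in `[0, 1]) edot (f (side_pt i s), g (side_pt i s)) (out_normal (K, i))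
   = Num.sg (area2 K) * \int[leb1]_(s in `[0, 1]) ((rot90 (side_vec (K, i))).1 * f (side_pt i s) + (rot90 (side_vec (K, i))).2 * g (side_pt i s)).
  have c1 (a b : R) : leb1.-integrable `[0, 1] (EFin \o (fun s => a * f (side_pt i s) + b * g (side_pt i s))).
    by apply: continuous_integrable01; apply: (c0 i (fun x => a * f x + b * g x) n); apply: polyfunD; apply: polyfunZ.
  rewrite /edot /=.
  under [in LHS]eq_Rintegral => s _ do rewrite (mulrC (f _)) (mulrC (g _)).
  rewrite -!RintegralZl //; apply: eq_Rintegral => s _.
  have h1 : side_len (K, i) * (out_normal (K, i)).1 = Num.sg (area2 K) * (rot90 (side_vec (K, i))).1.
    exact: (congr1 fst (out_normalE i)).
  have h2 : side_len (K, i) * (out_normal (K, i)).2 = Num.sg (area2 K) * (rot90 (side_vec (K, i))).2.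
    exact: (congr1 snd (out_normalE i)).
  by rewrite !mulrDr !mulrA h1 h2.
rewrite sum3 !RHSE -!mulrDr; congr (_ * _).
(* It remains to match the side integrals with those of (F, G) on the reference
   triangle, where some sides are run through backwards. *)
have cp (h : R * R -> R) (u : R -> R * R) (a b : R * R) : polyfun n h ->
    (forall s, u s = a + s *: b) -> continuous (fun s => h (u s)).
  by move=> ph uE; rewrite (_ : (fun s => _) = (fun s => h (a + s *: b)));
    [exact: continuous_path ph|apply/funext => s; rewrite uE].
have u1 (s : R) : (1 - s, s) = (1, 0) + s *: ((-1, 1) : R * R).
  by congr (_, _); rewrite /= /GRing.scale /=; ring.
have u2 (s : R) : (0, s) = (0, 0) + s *: ((0, 1) : R * R).
  by congr (_, _); rewrite /= /GRing.scale /=; ring.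
have u3 (s : R) : (s, 0) = (0, 0) + s *: ((1, 0) : R * R).
  by congr (_, _); rewrite /= /GRing.scale /=; ring.
have u4 (s : R) : (s, 1 - s) = (0, 1) + s *: ((1, -1) : R * R).
  by congr (_, _); rewrite /= /GRing.scale /=; ring.
have ci (h : R -> R) : continuous h -> leb1.-integrable `[0, 1] (EFin \o h) by exact: continuous_integrable01.
rewrite !RintegralB //; try by apply: ci; first [exact: cp pF u1|exact: cp pF u2|exact: cp pG u3|exact: cp pG u4].
have -> : \int[leb1]_(s in `[0, 1]) F (0, s) = \int[leb1]_(s in `[0, 1]) F (0, 1 - s).
  by rewrite (@Rintegral_onem _ (fun s => F (0, s))) //; exact: cp pF u2.
have -> : \int[leb1]_(s in `[0, 1]) G (s, 1 - s) = \int[leb1]_(s in `[0, 1]) G (1 - s, s).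
  rewrite -(@Rintegral_onem _ (fun s => G (1 - s, s))); last exact: cp pG u1.
  by apply: eq_Rintegral => s _; rewrite subKr.
have S0 : \int[leb1]_(s in `[0, 1]) ((rot90 (side_vec (K, 0))).1 * f (side_pt 0 s) + (rot90 (side_vec (K, 0))).2 * g (side_pt 0 s))
   = \int[leb1]_(s in `[0, 1]) F (1 - s, s) + \int[leb1]_(s in `[0, 1]) G (1 - s, s).
  rewrite -RintegralD //; [|by apply: ci; exact: cp pF u1|by apply: ci; exact: cp pG u1].
  apply: eq_Rintegral => s _; rewrite /F /G /side_pt !side_pt0 /rot90 /side_vec /side_a /side_b /= ordS0 ordS1 /e1 /e2 /=; ring.
have S1 : \int[leb1]_(s in `[0, 1]) ((rot90 (side_vec (K, 1))).1 * f (side_pt 1 s) + (rot90 (side_vec (K, 1))).2 * g (side_pt 1 s))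
   = - \int[leb1]_(s in `[0, 1]) F (0, 1 - s).
  rewrite -mulN1r -RintegralZl //; last first.
    apply: ci; apply: (cp F (fun s => (0, 1 - s)) (0, 1) (0, -1)) => // s.
    by congr (_, _); rewrite /= /GRing.scale /=; ring.
  apply: eq_Rintegral => s _; rewrite /F /side_pt !side_pt1 /rot90 /side_vec /side_a /side_b /= ordS1 ordS2 /e1 /e2 /=; ring.
have S2 : \int[leb1]_(s in `[0, 1]) ((rot90 (side_vec (K, 2%:R))).1 * f (side_pt 2%:R s) + (rot90 (side_vec (K, 2%:R))).2 * g (side_pt 2%:R s))
   = - \int[leb1]_(s in `[0, 1]) G (s, 0).
  rewrite -mulN1r -RintegralZl //; last by apply: ci; exact: cp pG u3.
  apply: eq_Rintegral => s _; rewrite /G /side_pt !side_pt2 /rot90 /side_vec /side_a /side_b /= ordS2 ordS0 /e1 /e2 /=; ring.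
rewrite S0 S1 S2; ring.
Qed.

End sides.

(** * Geometry of a triangulation *)

Section geometry.
Context {R : realType}.
Local Notation leb2 := (@leb2 R).
Variables (Omega : set (R * R)) (m : mesh R).
Hypothesis poly : polygonal_domain Omega.
Hypothesis tri : triangulation m Omega.
Implicit Types (K : 'I_(nelt m)).

Lemma area2_neq0 K : area2 K != 0. Proof. by case: tri. Qed.

Lemma open_domain : open Omega. Proof. by case: poly => -[]. Qed.

Lemma hull_closure K : hull K `<=` closure Omega.
Proof. by case: tri => _ <- _ _ _ x Kx; exists K. Qed.

(** An element is an open subset of the closure of Omega, hence of its interior,
    and a regular open set is the interior of its closure. *)
Lemma elt_domain K : elt K `<=` Omega.
Proof.
case: poly => -[_ _ _ _ <-] _ x Kx.
have oK := open_elt (area2_neq0 K).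
apply: (@filterS _ (nbhs x) _ (elt K)); last exact: open_nbhs_nbhs.
by move=> y /elt_hull /hull_closure.
Qed.

Lemma bary_unique K (l l' : 'I_3 -> R) : \sum_i l i = 1 -> \sum_i l' i = 1 ->
  \sum_i l i *: vtx K i = \sum_i l' i *: vtx K i -> l =1 l'.
Proof.
move=> l1 l1'; rewrite !comb_tri_map // => /(can_inj (tri_mapK (area2_neq0 K))) [h1 h2].
apply: forall3 => //; move: l1 l1'; rewrite !sum3 h1 h2 => <-.
by rewrite -!addrA => /addIr.
Qed.

(** A common point of the open triangles has three positive barycentric coordinates
    in K. It lies in the common face, so the two triangles would share all three
    vertices. *)
Lemma elt_disjoint K K' x : elt K x -> elt K' x -> K = K'.
Proof.
move=> Kx K'x; apply: contrapT => /eqP neq.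
have [_ _ /(_ _ _ neq)[hI [i hi]] _ _] := tri.
have : (hull K `&` hull K') x by split; exact: elt_hull.
rewrite hI => -[l [l0 l1 xl sh]].
have [l' [l'0 l'1 xl']] := Kx.
have ll' : l =1 l' by apply: (@bary_unique K) => //; rewrite -xl -xl'.
by have [|i' /hi] := sh i; first by rewrite ll' gt_eqF.
Qed.

Lemma side_len_diam K i : side_len (K, i) <= diam K.
Proof. by rewrite /diam; apply: (@le_bigmax _ _ _ 0 (fun j => side_len (K, j))).
Qed.

Lemma enormZ (c : R) (v : R * R) : enorm (c *: v) = `|c| * enorm v.
Proof.
by rewrite /enorm /= -sqrtr_sqr -sqrtrM ?sqr_ge0 // /GRing.scale /=; congr Num.sqrt; ring.
Qed.

Lemma enorm_rot90 (v : R * R) : enorm (rot90 v) = enorm v.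
Proof. by rewrite /enorm /rot90 /= sqrrN addrC. Qed.

(** The witness l is the barycentric coordinate of y at the vertex opposite to the
    side. *)
Lemma side_cross_hull K i y : hull K y -> exists2 l : R, 0 <= l <= 1 &
  cross (side_vec (K, i)) (y - side_a (K, i)) = l * area2 K.
Proof.
move=> [l [l0 l1 ->]]; exists (l i).
  by rewrite l0 -l1 (bigD1 i) //= lerDl sumr_ge0.
move: l1; rewrite !sum3 => l1.
move: i; apply: forall3; rewrite /side_vec /side_a /side_b /= ?ordS0 ?ordS1 ?ordS2 ?ordS0 ?ordS1 /area2 /cross /=.
- have -> : l 0 = 1 - l 1 - l 2%:R by rewrite -l1; ring.
  rewrite /GRing.scale /=; ring.
- have -> : l 0 = 1 - l 1 - l 2%:R by rewrite -l1; ring.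
  rewrite /GRing.scale /=; ring.
- have -> : l 0 = 1 - l 1 - l 2%:R by rewrite -l1; ring.
  rewrite /GRing.scale /=; ring.
Qed.

(** The diameter normal to the side of the inscribed disc is at most the height over
    that side, and height times side length is |area2 K|. *)
Lemma side_len_sqr_area (gamma : R) K i x : 0 < gamma ->
  (forall y, enorm (y - x) <= diam K / (2 * gamma) -> hull K y) ->
  side_len (K, i) ^+ 2 <= gamma * `|area2 K|.
Proof.
move=> g0 disc; set t := side_vec (K, i); set len := side_len (K, i).
have len0 : 0 < len by exact: side_len_gt0 (area2_neq0 K) i.
have dl := side_len_diam K i; rewrite -/len in dl.
pose rho := diam K / (2 * gamma).
have rho0 : 0 <= rho by rewrite divr_ge0 ?mulr_ge0 // ?(ltW g0) // (le_trans (ltW len0)).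
have nE (c : R) : `|c| = rho -> hull K (x + (c / len) *: rot90 t).
  move=> crho; apply: disc; rewrite addrAC subrr add0r enormZ enorm_rot90 normrM crho.
  by rewrite normfV (gtr0_norm len0) -/len divfK ?gt_eqF.
have [l1 /andP[l10 l11] h1] := side_cross_hull i (nE rho (ger0_norm rho0)).
have [l2 /andP[l20 l21] h2] := side_cross_hull i (nE (- rho) (etrans (normrN _) (ger0_norm rho0))).
have len2 : t.1 ^+ 2 + t.2 ^+ 2 = len ^+ 2 by rewrite /len /side_len /enorm -/t sqr_sqrtr // addr_ge0 ?sqr_ge0.
have d : (l2 - l1) * area2 K = 2 * rho * len.
  rewrite mulrBl -h1 -h2 -/t /cross /rot90 /= /GRing.scale /=.
  transitivity (2 * (rho / len) * (t.1 ^+ 2 + t.2 ^+ 2)); first by rewrite /t /side_vec /=; ring.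
  by rewrite len2; field; rewrite gt_eqF.
have : 2 * rho * len <= `|area2 K|.
  rewrite -d; apply: (le_trans (ler_norm _)); rewrite normrM ler_piMl // ler_norml; apply/andP; split; lra.
have -> : 2 * rho * len = diam K * len / gamma by rewrite /rho; field; rewrite gt_eqF.
rewrite ler_pdivrMr // [X in _ <= X]mulrC => h; apply: le_trans h; rewrite expr2; apply: ler_wpM2r => //; exact: ltW.
Qed.

(** Each side of each triangle occurs in exactly one facet. *)
Lemma facet_sides_sum (V : nmodType) (F : 'I_(nelt m) * 'I_3 -> V) :
  \sum_(i < nfacet m) \sum_(sd <- facet_sides (facets m i)) F sd = \sum_K \sum_i F (K, i).
Proof.
case: tri => _ _ _ pe _.
have E : \sum_(sd <- enum {: 'I_(nelt m) * 'I_3}) F sd = \sum_K \sum_i F (K, i).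
  by rewrite big_enum /= pair_big /=; apply: eq_bigr => -[].
by rewrite -E -(perm_big _ pe) big_flatten big_map big_enum.
Qed.

End geometry.

(** The vertices lie in the closure of the bounded set Omega. A bound of the facet
    lengths common to all meshes controls the powers h_e^(beta - 1). *)
Lemma domain_side_bound (R : realType) (Omega : set (R * R)) : polygonal_domain Omega ->
  exists2 H : R, 0 < H & forall (m : mesh R), triangulation m Omega ->
    forall (K : 'I_(nelt m)) i, side_len (K, i) <= H.
Proof.
move=> [[_ _ _ [B [_ HB]] _] _].
have {}HB x : Omega x -> `|x| <= B + 1 by apply: HB; rewrite ltrDl.
have cB x : closure Omega x -> `|x| <= B + 2.
  move=> /(_ (ball x 1)) [|y [/HB hy hxy]]; first exact: nbhsx_ballx.
  have -> : x = (x - y) + y by rewrite subrK.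
  apply: (le_trans (ler_normD _ _)); rewrite addrC (_ : B + 2 = B + 1 + 1); last by ring.
  apply: lerD => //; move: hxy; rewrite -ball_normE /= => /ltW //.
pose C := `|B| + 2.
have C0 : 0 <= C by rewrite addr_ge0.
exists (4 * C + 1); first by rewrite ltr_wpDl // mulr_ge0.
move=> m tri K i.
have vB j : `|vtx K j| <= C.
  apply: le_trans (_ : B + 2 <= C); last by rewrite lerD2r ler_norm.
  apply: cB; apply: (hull_closure tri (K := K)); exists (fun j' => (j' == j)%:R); split.
  - by move=> j'; exact: ler0n.
  - by rewrite (bigD1 j) //= eqxx big1 ?addr0 // => j' /negbTE ->.
  - by rewrite (bigD1 j) //= eqxx big1 ?addr0 ?scale1r // => j' /negbTE ->; rewrite scale0r.
have enorm_le (v : R * R) : enorm v <= `|v.1| + `|v.2|.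
  rewrite /enorm -[leRHS]ger0_norm ?addr_ge0 // -sqrtr_sqr ler_wsqrtr //.
  by rewrite sqrrD !real_normK ?num_real // lerD2r lerDl mulrn_wge0 // mulr_ge0.
have cb j : `|(vtx K j).1| <= C /\ `|(vtx K j).2| <= C.
  by have := vB j; rewrite /Num.norm /= ge_max => /andP[].
apply: (le_trans (enorm_le _)); rewrite /side_vec /=.
have [a1 a2] := cb (ordS (ordS i)); have [b1 b2] := cb (ordS i).
have := ler_normB (vtx K (ordS (ordS i))).1 (vtx K (ordS i)).1.
have := ler_normB (vtx K (ordS (ordS i))).2 (vtx K (ordS i)).2.
rewrite /side_b /side_a /=; lra.
Qed.

(** * Coefficients up to the boundary of the domain *)

Section relative_continuity.
Context {R : realType}.

(** The same notion as [{within D, continuous f}], written as a limit at each point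
    of D so that the rules for limits apply to it. *)
Definition cts (T : topologicalType) (D : set T) (f : T -> R) :=
  forall x, D x -> f y @[y --> within D (nbhs x)] --> f x.

Lemma ctsP (T : topologicalType) (D : set T) f : cts D f <-> {within D, continuous f}.
Proof. by split => /subspace_continuousP. Qed.

Section ops.
Variables (T : topologicalType) (D : set T).
Implicit Types f g : T -> R.

Lemma cts_cst (c : R) : cts D (fun=> c). Proof. by move=> x _; exact: cvg_cst. Qed.
Lemma ctsD f g : cts D f -> cts D g -> cts D (fun x => f x + g x).
Proof. by move=> cf cg x Dx; exact: cvgD (cf x Dx) (cg x Dx). Qed.
Lemma ctsN f : cts D f -> cts D (fun x => - f x).
Proof. by move=> cf x Dx; exact: cvgN (cf x Dx). Qed.
Lemma ctsM f g : cts D f -> cts D g -> cts D (fun x => f x * g x).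
Proof. by move=> cf cg x Dx; exact: cvgM (cf x Dx) (cg x Dx). Qed.
Lemma ctsV f : (forall x, D x -> f x != 0) -> cts D f -> cts D (fun x => (f x)^-1).
Proof. by move=> f0 cf x Dx; exact: cvgV (f0 x Dx) (cf x Dx). Qed.
Lemma ctsX n f : cts D f -> cts D (fun x => f x ^+ n).
Proof.
by move=> cf; elim: n => [|n IH]; [exact: cts_cst|under [X in cts D X]funext do rewrite exprS; exact: ctsM].
Qed.
Lemma cts_sum (I : Type) (s : seq I) (F : I -> T -> R) :
  (forall i, cts D (F i)) -> cts D (fun x => \sum_(i <- s) F i x).
Proof.
move=> cF; elim: s => [|i s IH].
  by under [X in cts D X]funext do rewrite big_nil; exact: cts_cst.
by under [X in cts D X]funext do rewrite big_cons; exact: ctsD.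
Qed.
Lemma cts_comp (h : R -> R) f : continuous h -> cts D f -> cts D (fun x => h (f x)).
Proof. by move=> ch cf x Dx; exact: cvg_comp (cf x Dx) (ch (f x)). Qed.
Lemma cts_norm f : cts D f -> cts D (fun x => `|f x|).
Proof. apply: cts_comp => x; exact: norm_continuous. Qed.
Lemma cts_sqrt f : cts D f -> cts D (fun x => Num.sqrt (f x)).
Proof. apply: cts_comp; exact: sqrt_continuous. Qed.

Lemma eq_cts f g : f =1 g -> cts D g -> cts D f.
Proof. by move=> /funext ->. Qed.

End ops.

Lemma cts_continuous_at (T : topologicalType) (D : set T) (f : T -> R) :
  (forall x, D x -> {for x, continuous f}) -> cts D f.
Proof. by move=> cf x Dx; apply: cvg_trans (cf x Dx); apply: cvg_app; exact: cvg_within. Qed.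

Lemma cts_path (S T : topologicalType) (A : set S) (D : set T) (u : S -> T) (f : T -> R) :
  continuous u -> (forall s, A s -> D (u s)) -> cts D f -> cts A (fun s => f (u s)).
Proof.
move=> cu uA cf s As; apply: cvg_comp (cf (u s) (uA s As)).
move=> P /= wP; have := cu s _ wP; rewrite /within /= /nbhs /=.
by apply: filterS => t /= Pt At; apply: Pt; exact: uA.
Qed.

Lemma cts_subset (T : topologicalType) (A D : set T) (f : T -> R) :
  A `<=` D -> cts D f -> cts A f.
Proof. by move=> AD; apply: (cts_path (u := id)) => // x; exact: cvg_id. Qed.

Lemma cts_integrable01 (f : R -> R) : @cts R `[0, 1]%classic f -> leb1.-integrable `[0, 1] (EFin \o f).
Proof.
move=> /ctsP cf; apply: continuous_compact_integrable => //; exact: segment_compact.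
Qed.

Lemma open_cts_measurable (D U : set (R * R)) (f : R * R -> R) : open U -> U `<=` D -> cts D f -> measurable_fun U f.
Proof.
move=> oU UD cf; apply: continuous_measurable_fun2 => // x Ux.
have := cts_subset UD cf Ux; rewrite /continuous_at.
suff -> : within U (nbhs x) = nbhs x by [].
apply/seteqP; split => P /=; rewrite /within /= /nbhs /=.
  by move=> wP; have nU : nbhs x U by [exact: open_nbhs_nbhs]; near=> y; (have : U y by near: y); near: y.
by apply: filterS.
Unshelve. all: by end_near. Qed.

(** The bound holds on a dense subset of D, and passes to the closure by continuity.
    It is needed on facets, which are null sets and may lie on the boundary. *)
Lemma closure_bound (D : set (R * R)) (f : R * R -> R) (M : R) : open D ->
  cts (closure D) f -> {ae leb2, forall x, D x -> f x <= M} ->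
  forall x, closure D x -> f x <= M.
Proof.
move=> oD cf ae x Dx; rewrite leNgt; apply/negP => Mf.
have : nbhs (f x) [set y | M < y] by apply: open_nbhs_nbhs; split => //; exact: open_gt.
move/(cf x Dx); rewrite /within /= => n1.
have [U [[oU Ux] sub]] : exists U, open_nbhs x U /\ forall y, U y -> closure D y -> M < f y.
  by move: n1; rewrite nbhsE => -[U oU sub]; exists U; split => // y Uy; exact: sub.
have : U `&` D !=set0 by have := Dx U (open_nbhs_nbhs (conj oU Ux)); rewrite setIC.
move=> /(ae_open_dense oD ae oU)[y [Uy Dy]]; rewrite leNgt => /negP; apply.
by apply: sub => //; exact: subset_closure.
Qed.

End relative_continuity.

Section coefficients.
Context {R : realType}.
Variables (Omega : set (R * R)) (M delta g : R) (b : R * R -> R) (Q : R * R -> 'cV[R]_3).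
Hypothesis oO : open Omega.
Hypothesis d0 : 0 < delta.
Hypothesis cb : {within closure Omega, continuous b}.
Hypothesis sQ : forall i : 'I_3, smooth_up_to_boundary Omega (fun x => Q x i 0).
Hypothesis CB : coefficient_bounds Omega M delta g b Q.
Local Notation pb := (phib g b).

Lemma cts_Q i : cts (closure Omega) (fun x => Q x i 0).
Proof.
have [D' [oD' sub smooth]] := sQ i; apply: cts_continuous_at => x /sub D'x.
by have [+ _] := smooth [::] x D'x.
Qed.

Lemma cts_phi : cts (closure Omega) (fun x => phi (pb x) (Q x)).
Proof.
apply: ctsD; first exact: cts_Q.
by apply: ctsM; [exact: cts_cst|exact/ctsP].
Qed.

Lemma phi_ge x : closure Omega x -> delta <= phi (pb x) (Q x).
Proof.
rewrite -lerN2; move: x; apply: closure_bound => //; first exact: ctsN cts_phi.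
by case: CB => H _ _; apply: aeW => x Dx; rewrite lerN2; exact: H.
Qed.

Lemma cts_phiV : cts (closure Omega) (fun x => (phi (pb x) (Q x))^-1).
Proof. by apply: ctsV cts_phi => x /phi_ge h; rewrite gt_eqF // (lt_le_trans d0). Qed.

(** The denominators are powers of phi, which stays above delta up to the boundary. *)
Lemma cts_Amx j k l : cts (closure Omega) (fun x => Amx j (pb x) (Q x) k l).
Proof.
have cU := @cts_Q 1; have cV := @cts_Q 2%:R; have cp := cts_phi; have ci := cts_phiV.
have c0 (c : R) := @cts_cst _ _ (closure Omega) c.
have cUU : cts (closure Omega) (fun x => U_ (Q x) ^+ 2 / phi (pb x) (Q x) ^+ 2).
  apply: eq_cts; [by move=> x; rewrite -exprVn; reflexivity|]; by apply: ctsM; apply: ctsX.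
have cVV : cts (closure Omega) (fun x => V_ (Q x) ^+ 2 / phi (pb x) (Q x) ^+ 2).
  apply: eq_cts; [by move=> x; rewrite -exprVn; reflexivity|]; by apply: ctsM; apply: ctsX.
have cUV : cts (closure Omega) (fun x => U_ (Q x) * V_ (Q x) / phi (pb x) (Q x) ^+ 2).
  apply: eq_cts; [by move=> x; rewrite -exprVn; reflexivity|]; by apply: ctsM; [exact: ctsM|exact: ctsX].
have cUp : cts (closure Omega) (fun x => U_ (Q x) / phi (pb x) (Q x)) by exact: ctsM.
have cVp : cts (closure Omega) (fun x => V_ (Q x) / phi (pb x) (Q x)) by exact: ctsM.
have c2U : cts (closure Omega) (fun x => 2 * U_ (Q x) / phi (pb x) (Q x)) by apply: ctsM => //; exact: ctsM.
have c2V : cts (closure Omega) (fun x => 2 * V_ (Q x) / phi (pb x) (Q x)) by apply: ctsM => //; exact: ctsM.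
have cpU := ctsD cp (ctsN cUU); have cpV := ctsD cp (ctsN cVV); have cNUV := ctsN cUV.
rewrite /Amx; case: (j == 0); case: (ord3P k) => ->; case: (ord3P l) => ->;
  (apply: eq_cts; first by move=> x; rewrite mxE /=; reflexivity); done.
Qed.

Lemma Amx_bound j k l x : closure Omega x -> `|Amx j (pb x) (Q x) k l| <= M.
Proof.
move: x; apply: closure_bound => //; first exact/cts_norm/cts_Amx.
by case: CB => _ /(_ j k l)[].
Qed.

Lemma coefficient_bound_ge0 : Omega !=set0 -> 0 <= M.
Proof.
by move=> [x /subset_closure Dx]; apply: le_trans (Amx_bound 0 0 0 Dx).
Qed.

Lemma cts_speed n : cts (closure Omega) (fun x => lf_speed (pb x) (Q x) n).
Proof.
rewrite /lf_speed; apply: ctsD; last exact/cts_sqrt/cts_phi.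
apply: cts_norm; apply: ctsD; apply: ctsM; try exact: cts_cst; apply: ctsM; try exact: cts_phiV; exact: cts_Q.
Qed.

End coefficients.

Lemma lf_speed_ge0 (R : realType) (pb : R) q n : 0 <= lf_speed pb q n.
Proof. by rewrite /lf_speed addr_ge0 // sqrtr_ge0. Qed.

(** The mass equation is linear with constant coefficients: its flux is (U, V). *)
Lemma Amx_row0 (R : realType) (pb : R) q (v : 'cV[R]_3) (j : 'I_2) :
  (Amx j pb q *m v) 0 0 = if j == 0 then v 1 0 else v 2%:R 0.
Proof.
by rewrite mxE sum3 /Amx; case: ifP => _; rewrite !mxE /=; ring.
Qed.

(** * The hyperbolic form on a facet *)

Section facet_algebra.
Context {R : realType}.

Lemma young (eps a x : R) : 0 < eps -> a * x <= eps / 2 * x ^+ 2 + a ^+ 2 / (2 * eps).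
Proof.
move=> e0; rewrite -subr_ge0.
have -> : eps / 2 * x ^+ 2 + a ^+ 2 / (2 * eps) - a * x = (eps * x - a) ^+ 2 / (2 * eps).
  by field; rewrite gt_eqF.
by rewrite divr_ge0 ?sqr_ge0 // mulr_ge0 // ltW.
Qed.

Lemma dotE (u v : 'cV[R]_3) : dot u v = u 0 0 * v 0 0 + u 1 0 * v 1 0 + u 2%:R 0 * v 2%:R 0.
Proof. by rewrite /dot sum3. Qed.

Lemma dot_ge0 (u : 'cV[R]_3) : 0 <= dot u u.
Proof. by apply: sumr_ge0 => i _; rewrite -expr2 sqr_ge0. Qed.

Definition norm1 (v : 'cV[R]_3) := `|v 0 0| + `|v 1 0| + `|v 2%:R 0|.

Lemma norm1_ge0 v : 0 <= norm1 v. Proof. by rewrite !addr_ge0. Qed.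

Lemma norm1_sqr v : norm1 v ^+ 2 <= 3 * dot v v.
Proof.
rewrite dotE /norm1 -!expr2 -!(@real_normK _ (v _ _)) ?num_real //.
move: `|v 0 0| `|v 1 0| `|v 2%:R 0| => x y z.
have := sqr_ge0 (x - y); have := sqr_ge0 (x - z); have := sqr_ge0 (y - z); nra.
Qed.

Lemma mulmx_bound (A : 'M[R]_3) (v : 'cV[R]_3) (B : R) i :
  (forall l, `|A i l| <= B) -> `|(A *m v) i 0| <= B * norm1 v.
Proof.
move=> AB; rewrite mxE sum3 /norm1 !mulrDr.
apply: (le_trans (ler_normD _ _)); apply: lerD; last by rewrite normrM ler_wpM2r.
by apply: (le_trans (ler_normD _ _)); apply: lerD; rewrite normrM ler_wpM2r.
Qed.

(** The normal component of p u for a state (p, u): the boundary term of the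
    integration by parts of u . grad p. *)
Definition flux_n (n : R * R) (a : 'cV[R]_3) : R := phieta a * edot (U_ a, V_ a) n.

(** Let a = (p, u) and c = (p', u') be the two traces. The first component of the
    central flux contributes {{u}}.n (p - p'), and
    p u.n - p' u'.n = {{u}}.n (p - p') + {{p}} (u - u').n. In the difference all terms
    carry a factor u - u', except the Lax-Friedrichs dissipation, which is
    nonnegative. Young's inequality with the weight nu * w leaves the energies of
    the two traces. *)
Lemma facet_pointwise (M tau nu w : R) (n : R * R) (A : 'M[R]_3) (a c : 'cV[R]_3) :
  0 <= M -> 0 <= tau -> 0 < nu -> 0 < w -> `|n.1| <= 1 -> `|n.2| <= 1 ->
  (forall v : 'cV[R]_3, (A *m v) 0 0 = n.1 * v 1 0 + n.2 * v 2%:R 0) ->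
  (forall k l, `|A k l| <= 2 * M) ->
  - (nu / 2 * w * ((a 1 0 - c 1 0) ^+ 2 + (a 2%:R 0 - c 2%:R 0) ^+ 2))
  - 6 * (M + 1) ^+ 2 / (nu * w) * (dot a a + dot c c)
  <= dot (A *m (2^-1 *: (a + c)) + (tau / 2) *: (a - c)) (a - c) - (flux_n n a - flux_n n c).
Proof.
move=> M0 tau0 nu0 w0 n1 n2 A0 AM.
set j1 := a 1 0 - c 1 0; set j2 := a 2%:R 0 - c 2%:R 0.
pose S := norm1 a + norm1 c.
have S0 : 0 <= S by rewrite addr_ge0 ?norm1_ge0.
have avS : norm1 (2^-1 *: (a + c)) <= S / 2.
  rewrite /norm1 !mxE !normrM gtr0_norm ?invr_gt0 // /S /norm1.
  have := ler_normD (a 0 0) (c 0 0); have := ler_normD (a 1 0) (c 1 0).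
  have := ler_normD (a 2%:R 0) (c 2%:R 0); lra.
have r i : `|(A *m (2^-1 *: (a + c))) i 0| <= M * S.
  apply: (le_trans (mulmx_bound _ (AM i))); apply: (le_trans (ler_wpM2l _ avS)); first by rewrite mulr_ge0.
  by rewrite (_ : 2 * M * (S / 2) = M * S) //; field.
pose r1 := (A *m (2^-1 *: (a + c))) 1 0; pose r2 := (A *m (2^-1 *: (a + c))) 2%:R 0.
pose q := (a 0 0 + c 0 0) / 2.
have E : dot (A *m (2^-1 *: (a + c)) + (tau / 2) *: (a - c)) (a - c) - (flux_n n a - flux_n n c)
  = (r1 - q * n.1) * j1 + (r2 - q * n.2) * j2 + tau / 2 * dot (a - c) (a - c).
  rewrite /r1 /r2 /q !dotE /flux_n /edot /phieta /U_ /V_ /=.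
  have := A0 (2^-1 *: (a + c)); move: (A *m (2^-1 *: (a + c))) => B; rewrite !mxE => ->.
  rewrite /j1 /j2; by field.
rewrite E.
have tq : 0 <= tau / 2 * dot (a - c) (a - c) by rewrite mulr_ge0 ?dot_ge0 // divr_ge0.
have qS : `|q| <= S.
  rewrite /q normrM (@ger0_norm _ 2^-1) ?invr_ge0 // /S /norm1.
  have := ler_normD (a 0 0) (c 0 0).
  have := normr_ge0 (a 0 0); have := normr_ge0 (a 1 0); have := normr_ge0 (a 2%:R 0).
  have := normr_ge0 (c 0 0); have := normr_ge0 (c 1 0); have := normr_ge0 (c 2%:R 0); lra.
have K1 : `|r1 - q * n.1| <= (M + 1) * S.
  apply: (le_trans (ler_normB _ _)); rewrite mulrDl mul1r; apply: lerD; first exact: r.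
  by rewrite normrM -[leRHS]mulr1 ler_pM.
have K2 : `|r2 - q * n.2| <= (M + 1) * S.
  apply: (le_trans (ler_normB _ _)); rewrite mulrDl mul1r; apply: lerD; first exact: r.
  by rewrite normrM -[leRHS]mulr1 ler_pM.
have nw : 0 < nu * w by rewrite mulr_gt0.
have Y x y : `|x| <= (M + 1) * S -> - (nu * w / 2 * y ^+ 2 + ((M + 1) * S) ^+ 2 / (2 * (nu * w))) <= x * y.
  move=> hx; rewrite lerNl; have := young (- x) y nw; rewrite mulNr sqrrN => h; apply: (le_trans h).
  apply: lerD => //; apply: ler_wpM2r; first by rewrite invr_ge0 mulr_ge0 // ltW.
  rewrite -(@real_normK _ x) ?num_real // lerXn2r ?nnegrE //.
  by rewrite mulr_ge0 // addr_ge0.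
have y1 := Y _ j1 K1; have y2 := Y _ j2 K2.
have S2 : S ^+ 2 <= 6 * (dot a a + dot c c).
  have := norm1_sqr a; have := norm1_sqr c; rewrite /S.
  have := sqr_ge0 (norm1 a - norm1 c); nra.
(* Young is used for two velocity components, and S^2 costs a factor 6. *)
have last : ((M + 1) * S) ^+ 2 / (2 * (nu * w)) * 2 <= 6 * (M + 1) ^+ 2 / (nu * w) * (dot a a + dot c c).
  have -> : ((M + 1) * S) ^+ 2 / (2 * (nu * w)) * 2 = (M + 1) ^+ 2 / (nu * w) * S ^+ 2.
    by field; rewrite !gt_eqF.
  have -> : 6 * (M + 1) ^+ 2 / (nu * w) * (dot a a + dot c c) = (M + 1) ^+ 2 / (nu * w) * (6 * (dot a a + dot c c)).
    by field; rewrite !gt_eqF.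
  by rewrite ler_wpM2l // divr_ge0 ?sqr_ge0 // ltW.
move: y1 y2 last tq; set t1 := (r1 - _) * _; set t2 := (r2 - _) * _.
set t3 := tau / 2 * _; set t4 := _ / (2 * (nu * w)); set t5 := 6 * _ / _ * _.
have -> : nu * w / 2 * j1 ^+ 2 = nu / 2 * w * j1 ^+ 2 by field.
have -> : nu * w / 2 * j2 ^+ 2 = nu / 2 * w * j2 ^+ 2 by field.
rewrite mulrDr; lra.
Qed.

End facet_algebra.

Section facets.
Context {R : realType}.
Local Notation leb2 := (@leb2 R).
Variables (Omega : set (R * R)) (m : mesh R).
Hypothesis tri : triangulation m Omega.
Variables (k : nat) (z : dgfun m).
Hypothesis Vz : Vh k z.
Implicit Types (e : facet (R := R) (nelt m)).

Lemma Vh_polyfun K i : polyfun k (fun x => z K x i 0).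
Proof. exact/poly_le_polyfun/Vz. Qed.

Definition elt_energy K : R := \int[leb2]_(x in elt K) dot (z K x) (z K x).

Lemma elt_energy_ge0 K : 0 <= elt_energy K.
Proof. by apply: Rintegral_ge0 => x _; exact: dot_ge0. Qed.

Lemma elt_energyE K : elt_energy K = \sum_i \int[leb2]_(x in elt K) (z K x i 0 ^+ 2).
Proof.
have a0 := area2_neq0 tri K; have mK := measurable_elt a0.
have int i : leb2.-integrable (elt K) (EFin \o (fun x => z K x i 0 ^+ 2)).
  apply: (polyfun_integrable_elt a0 (n := (2 * k)%N)); apply: polyfunX; exact: Vh_polyfun.
have int2 : leb2.-integrable (elt K) (EFin \o (fun x => z K x 0 0 ^+ 2 + z K x 1 0 ^+ 2)).
  apply: (polyfun_integrable_elt a0 (n := (2 * k)%N)).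
  by apply: polyfunD; apply: polyfunX; exact: Vh_polyfun.
rewrite sum3 -RintegralD // -RintegralD //.
by apply: eq_Rintegral => x _; rewrite dotE -!expr2.
Qed.

Lemma elt_sup_dot (C : R) K x :
  (forall f, polyfun k f -> f x ^+ 2 <= C / `|area2 K| * \int[leb2]_(y in elt K) (f y ^+ 2)) ->
  dot (z K x) (z K x) <= C / `|area2 K| * elt_energy K.
Proof.
move=> H; rewrite elt_energyE dotE sum3 !mulrDr -!expr2.
by apply: lerD; [apply: lerD|]; exact: H (Vh_polyfun K _).
Qed.

Lemma facet_ptE e s : facet_pt e s = side_pt (plus e).1 (plus e).2 s.
Proof. by rewrite /facet_pt /side_pt; case: (plus e). Qed.

Lemma facet_lenE e : facet_len e = side_len ((plus e).1, (plus e).2).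
Proof. by rewrite /facet_len; case: (plus e). Qed.

Lemma facet_len_gt0 e : 0 < facet_len e.
Proof. by rewrite facet_lenE; exact: side_len_gt0 (area2_neq0 tri _) _. Qed.

Lemma facets_conforming i : facet_conforming Omega (facets m i).
Proof. by case: tri. Qed.

(** The K^- side runs either along or against the parametrization of the facet. *)
Lemma minus_pt e sd p : facet_conforming Omega e -> minus e = Some (sd, p) ->
  (forall s, facet_pt e s + p = side_pt sd.1 sd.2 s) \/
  (forall s, facet_pt e s + p = side_pt sd.1 sd.2 (1 - s)).
Proof.
rewrite /facet_conforming => + me; rewrite me => -[[[h1 h2]|[h1 h2]] _ _]; [left|right] => s.
  rewrite /facet_pt /side_pt /side_vec -surjective_pairing h1 h2.
  by rewrite opprD addrACA subrr addr0 addrAC.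
rewrite /facet_pt /side_pt /side_vec -surjective_pairing h1 h2.
rewrite [LHS]surjective_pairing [RHS]surjective_pairing; congr (_, _); rewrite /= /GRing.scale /=; ring.
Qed.

Lemma minus_len e sd p : facet_conforming Omega e -> minus e = Some (sd, p) -> facet_len e = side_len sd.
Proof.
rewrite /facet_conforming => + me; rewrite me => -[[[h1 h2]|[h1 h2]] _ _];
  rewrite /facet_len /side_len /side_vec h1 h2.
  by rewrite opprD addrACA subrr addr0.
rewrite opprD addrACA subrr addr0 /enorm /=; congr Num.sqrt; ring.
Qed.

Lemma minus_normal e sd p : facet_conforming Omega e -> minus e = Some (sd, p) -> out_normal sd = - normal e.
Proof. by rewrite /facet_conforming => + me; rewrite me => -[]. Qed.

Lemma minus_pt_hull e sd p s : facet_conforming Omega e -> minus e = Some (sd, p) -> 0 <= s <= 1 ->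
  hull sd.1 (facet_pt e s + p).
Proof.
move=> conf me /andP[s0 s1]; have a0 := area2_neq0 tri sd.1.
case: (minus_pt conf me) => ->; apply: side_pt_hull => //; first by rewrite s0.
by rewrite subr_ge0 s1 gerBl.
Qed.

Lemma facet_pt_hull e s : 0 <= s <= 1 -> hull (plus e).1 (facet_pt e s).
Proof. by move=> s01; rewrite facet_ptE; exact: side_pt_hull. Qed.

Lemma continuous_facet_pt e : continuous (facet_pt e).
Proof.
move=> s; apply: cvgD; first exact: cvg_cst.
by apply: cvgZl; exact: cvg_id.
Qed.

Lemma continuous_trace_p e i : continuous (fun s => trace_p z e s i 0).
Proof. exact: continuous_path (Vh_polyfun (plus e).1 i). Qed.

Lemma continuous_trace_m e i : continuous (fun s => trace_m z e s i 0).
Proof.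
rewrite /trace_m; case: (minus e) => [[sd p]|]; last first.
  by rewrite (_ : (fun=> _) = fun=> 0); [move=> s; exact: cvg_cst|apply/funext => s; rewrite mxE].
rewrite (_ : (fun s => _) = fun s => z sd.1 ((side_a (plus e) + p) + s *: side_vec (plus e)) i 0).
  exact: continuous_path (Vh_polyfun sd.1 i).
by apply/funext => s; rewrite /facet_pt addrAC.
Qed.

Definition side_flux (sd : 'I_(nelt m) * 'I_3) : R :=
  side_len sd * \int[leb1]_(s in `[0, 1]) flux_n (out_normal sd) (z sd.1 (side_pt sd.1 sd.2 s)).

Lemma flux_nN n a : flux_n (- n) a = - flux_n n a :> R.
Proof. by rewrite /flux_n /edot /=; ring. Qed.

Lemma flux_n0 (n : R * R) : flux_n n 0 = 0.
Proof. by rewrite /flux_n /phieta mxE mul0r. Qed.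

Lemma continuous_flux_n n (t : R -> 'cV[R]_3) : (forall i, continuous (fun s => t s i 0)) ->
  continuous (fun s => flux_n n (t s)).
Proof.
move=> ct s; apply: cvgM; first exact: ct.
by apply: cvgD; apply: cvgM; [exact: ct|exact: cvg_cst|exact: ct|exact: cvg_cst].
Qed.

(** The outward normals of the two neighbours are opposite, so their fluxes combine to
    the jump of p u.n. *)
Lemma facet_flux e : facet_conforming Omega e ->
  \sum_(sd <- facet_sides e) side_flux sd =
  facet_int e (fun s => flux_n (normal e) (trace_p z e s) - flux_n (normal e) (trace_m z e s)).
Proof.
move=> conf; have cp := @continuous_flux_n (normal e) _ (@continuous_trace_p e).
have cm := @continuous_flux_n (normal e) _ (@continuous_trace_m e).
rewrite /facet_int RintegralB //; [|exact: continuous_integrable01|exact: continuous_integrable01].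
rewrite mulrBr /facet_sides big_cons; congr (_ + _).
case me : (minus e) => [[sd p]|] /=; last first.
  rewrite big_nil /trace_m me; under eq_Rintegral do rewrite flux_n0.
  by rewrite Rintegral_cst // mul0r mulr0 oppr0.
rewrite big_seq1 /side_flux -(minus_len conf me) (minus_normal conf me) -mulrN; congr (_ * _).
rewrite -mulN1r -RintegralZl //; last exact: continuous_integrable01.
have E (s : R) : -1 * flux_n (normal e) (trace_m z e s) = flux_n (- normal e) (z sd.1 (facet_pt e s + p)).
  by rewrite mulN1r -flux_nN /trace_m me.
case: (minus_pt conf me) => pt.
  by apply: eq_Rintegral => s _; rewrite E pt.
(* The K^- side runs backwards. *)
rewrite -[LHS]Rintegral_onem.
  by apply: eq_Rintegral => s _; rewrite E pt.
apply: continuous_flux_n => i.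
exact: continuous_path (Vh_polyfun sd.1 i).
Qed.

Lemma dot_jump_Upart e s : dot (jump (Upart z) e s) (jump (Upart z) e s) =
  (trace_p z e s 1 0 - trace_m z e s 1 0) ^+ 2 + (trace_p z e s 2%:R 0 - trace_m z e s 2%:R 0) ^+ 2.
Proof.
rewrite dotE /jump /trace_p /trace_m /Upart; case: (minus e) => [[sd p]|]; rewrite !mxE /= /U_ /V_; ring.
Qed.

Lemma continuous_jump_Upart e : continuous (fun s => dot (jump (Upart z) e s) (jump (Upart z) e s)).
Proof.
rewrite (funext (dot_jump_Upart e)) => s.
have cj i : {for s, continuous (fun s => trace_p z e s i 0 - trace_m z e s i 0)}.
  by apply: cvgB; [exact: continuous_trace_p|exact: continuous_trace_m].
by apply: cvgD; apply: cvgM; exact: cj.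
Qed.

End facets.

Section facet_estimate.
Context {R : realType}.
Local Notation leb2 := (@leb2 R).
Variables (Omega : set (R * R)) (M delta g : R) (b : R * R -> R) (Q : R * R -> 'cV[R]_3).
Hypothesis poly : polygonal_domain Omega.
Hypothesis d0 : 0 < delta.
Hypothesis cb : {within closure Omega, continuous b}.
Hypothesis sQ : forall i : 'I_3, smooth_up_to_boundary Omega (fun x => Q x i 0).
Hypothesis CB : coefficient_bounds Omega M delta g b Q.
Local Notation pb := (phib g b).
Let oO := open_domain poly.

Variable m : mesh R.
Hypothesis tri : triangulation m Omega.
Variables (k : nat) (z : dgfun m).
Hypothesis Vz : Vh k z.

Variables (nu sigma beta gamma H C : R).
Hypotheses (nu0 : 0 < nu) (sigma0 : 0 < sigma) (beta1 : 1 <= beta) (C0 : 0 <= C).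
Hypothesis shape : forall (K : 'I_(nelt m)) i, side_len (K, i) ^+ 2 <= gamma * `|area2 K|.
Hypothesis lenH : forall (K : 'I_(nelt m)) i, side_len (K, i) <= H.
Hypothesis sup : forall (K : 'I_(nelt m)) f x, polyfun k f -> hull K x ->
  f x ^+ 2 <= C / `|area2 K| * \int[leb2]_(y in elt K) (f y ^+ 2).

Variable e : facet (R := R) (nelt m).
Hypothesis conf : facet_conforming Omega e.

Lemma out_normal_le1 (K : 'I_(nelt m)) i : `|(out_normal (K, i)).1| <= 1 /\ `|(out_normal (K, i)).2| <= 1.
Proof.
have a0 := area2_neq0 tri K; have l0 := side_len_gt0 a0 i; have E := out_normalE a0 i.
have sg1 : `|Num.sg (area2 K)| = 1 by rewrite normr_sg a0.
have le (t : R) : t ^+ 2 <= side_len (K, i) ^+ 2 -> `|t| <= side_len (K, i).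
  by rewrite -(@real_normK _ t) ?num_real // ler_pXn2r ?nnegrE // ltW.
have len2 : side_len (K, i) ^+ 2 = (side_vec (K, i)).1 ^+ 2 + (side_vec (K, i)).2 ^+ 2.
  by rewrite /side_len /enorm sqr_sqrtr // addr_ge0 ?sqr_ge0.
have comp (c t : R) : side_len (K, i) * c = Num.sg (area2 K) * t -> `|t| <= side_len (K, i) -> `|c| <= 1.
  move=> /(congr1 Num.norm); rewrite !normrM sg1 mul1r (gtr0_norm l0) => <-.
  by rewrite -[leRHS]mulr1 ler_pM2l.
split.
  apply: (comp _ _ (congr1 fst E)); rewrite /rot90 /=; apply: le; rewrite len2 lerDr sqr_ge0 //.
by apply: (comp _ _ (congr1 snd E)); rewrite /rot90 /= normrN; apply: le; rewrite len2 lerDl sqr_ge0.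
Qed.

Lemma normal_le1 : `|(normal e).1| <= 1 /\ `|(normal e).2| <= 1.
Proof. by rewrite /normal; case: (plus e) => K i; exact: out_normal_le1. Qed.

Lemma facet_pt_closure s : 0 <= s <= 1 -> closure Omega (facet_pt e s).
Proof. by move=> s01; apply: (hull_closure tri); exact: facet_pt_hull. Qed.

Let M_ge0 : 0 <= M.
Proof. by apply: (coefficient_bound_ge0 oO d0 cb sQ CB); case: poly => -[]. Qed.

Definition flux_mx s := \sum_(j < 2) Defs.coord (normal e) j *: Amx j (pb (facet_pt e s)) (Q (facet_pt e s)).
Definition lax_friedrichs s : R :=
  dot (flux_mx s *m avg_hyp z e s
       + (lf_speed (pb (facet_pt e s)) (Q (facet_pt e s)) (normal e) / 2) *: jump z e s) (jump z e s).

Lemma flux_mxE s i l : flux_mx s i l = (normal e).1 * Amx 0 (pb (facet_pt e s)) (Q (facet_pt e s)) i l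
  + (normal e).2 * Amx 1 (pb (facet_pt e s)) (Q (facet_pt e s)) i l.
Proof. by rewrite /flux_mx !big_ord_recl big_ord0 addr0 !mxE /Defs.coord. Qed.

Lemma cts_lax_friedrichs : @cts R R `[0, 1]%classic lax_friedrichs.
Proof.
have path (f : R * R -> R) : cts (closure Omega) f -> @cts R R `[0, 1]%classic (fun s => f (facet_pt e s)).
  move=> cf; apply: cts_path cf; first exact: continuous_facet_pt.
  by move=> s; rewrite /= in_itv /=; exact: facet_pt_closure.
have cA j i l := path _ (@cts_Amx _ _ _ _ _ _ _ oO d0 cb sQ CB j i l).
have cS := path _ (@cts_speed _ _ _ _ _ _ _ oO d0 cb sQ CB (normal e)).
have cF i l : @cts R R `[0, 1]%classic (fun s => flux_mx s i l).
  apply: eq_cts; first by move=> s; rewrite flux_mxE; reflexivity.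
  by apply: ctsD; apply: ctsM; try exact: cts_cst; exact: cA.
have cp i : @cts R R `[0, 1]%classic (fun s => trace_p z e s i 0).
  by apply: cts_continuous_at => s _; exact: continuous_trace_p.
have cm i : @cts R R `[0, 1]%classic (fun s => trace_m z e s i 0).
  by apply: cts_continuous_at => s _; exact: continuous_trace_m.
have cj i : @cts R R `[0, 1]%classic (fun s => jump z e s i 0).
  apply: eq_cts; first by move=> s; rewrite /jump !mxE; reflexivity.
  by apply: ctsD => //; exact: ctsN.
have ca i : @cts R R `[0, 1]%classic (fun s => avg_hyp z e s i 0).
  apply: eq_cts; first by move=> s; rewrite /avg_hyp !mxE; reflexivity.
  by apply: ctsM; [exact: cts_cst|exact: ctsD].
apply: eq_cts; first by move=> s; rewrite /lax_friedrichs /dot; reflexivity.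
apply: cts_sum => i; apply: ctsM => //.
apply: eq_cts; first by move=> s; rewrite 3!mxE; reflexivity.
apply: ctsD.
  by apply: cts_sum => l; apply: ctsM.
by apply: ctsM => //; apply: ctsM => //; exact: cts_cst.
Qed.

(** [facet_pointwise] with the penalty parameter as weight; the traces are bounded by
    the energies of the adjacent triangles through the inverse inequality. *)
Lemma facet_pointwise_bound s (w : R) : 0 <= s <= 1 -> w = sigma / facet_len e `^ beta ->
  - (nu / 2 * w * dot (jump (Upart z) e s) (jump (Upart z) e s))
  - 6 * (M + 1) ^+ 2 / (nu * w) * (C * \sum_(sd <- facet_sides e) elt_energy z sd.1 / `|area2 sd.1|)
  <= lax_friedrichs s - (flux_n (normal e) (trace_p z e s) - flux_n (normal e) (trace_m z e s)).
Proof.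
move=> s01 wE.
have w0 : 0 < w by rewrite wE divr_gt0 // powR_gt0 // (facet_len_gt0 tri).
have [n1 n2] := normal_le1; have cl := facet_pt_closure s01.
have E0 (v : 'cV[R]_3) : (flux_mx s *m v) 0 0 = (normal e).1 * v 1 0 + (normal e).2 * v 2%:R 0.
  by rewrite mxE sum3 !flux_mxE /Amx /= /mx3 !mxE /=; ring.
have EM i l : `|flux_mx s i l| <= 2 * M.
  rewrite flux_mxE (_ : 2 * M = M + M); last by ring.
  have B j := Amx_bound oO d0 cb sQ CB j i l cl.
  apply: (le_trans (ler_normD _ _)); apply: lerD; rewrite normrM -[leRHS]mul1r; exact: ler_pM.
have := facet_pointwise (trace_p z e s) (trace_m z e s) M_ge0 (lf_speed_ge0 (pb (facet_pt e s)) (Q (facet_pt e s)) (normal e)) nu0 w0 n1 n2 E0 EM.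
rewrite -/(avg_hyp z e s) -/(jump z e s) -/(lax_friedrichs s); apply: le_trans; apply: lerB.
  rewrite lerN2; apply: ler_wpM2l; first by rewrite mulr_ge0 ?(ltW w0) // divr_ge0 // ltW.
  by rewrite dot_jump_Upart.
apply: ler_wpM2l.
  by apply: divr_ge0; apply: mulr_ge0; rewrite ?sqr_ge0 ?(ltW nu0) ?(ltW w0).
have bd K x : hull K x -> dot (z K x) (z K x) <= C * (elt_energy z K / `|area2 K|).
  move=> Kx; apply: le_trans (_ : C / `|area2 K| * elt_energy z K <= _); last by rewrite mulrAC mulrA.
  by apply: (elt_sup_dot tri Vz) => f pf; exact: sup.
rewrite /facet_sides big_cons mulrDr; apply: lerD; first by apply: bd; exact: facet_pt_hull.
rewrite /trace_m; case me : (minus e) => [[sd p]|]; last by rewrite big_nil dotE !mxE; lra.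
by rewrite big_seq1; apply: bd; exact: (minus_pt_hull tri conf me).
Qed.

(** The constant of [facet_pointwise_bound] with sigma in place of the penalty
    parameter, times the factor of [facet_len_area]. *)
Definition facet_cst : R := 6 * (M + 1) ^+ 2 / (nu * sigma) * C * (H `^ (beta - 1) * gamma).

Lemma facet_sides_len sd : sd \in facet_sides e -> facet_len e = side_len sd.
Proof.
rewrite /facet_sides inE => /orP[/eqP -> //|]; case me : (minus e) => [[sd' p]|]; rewrite ?inE // => /eqP ->.
exact: minus_len conf me.
Qed.

(** The length h_e comes from the facet integral and h_e^beta from the inverse of the
    penalty parameter. Two powers of h_e are absorbed by the area of the triangle; the
    remaining h_e^(beta - 1) is bounded because beta >= 1. *)
Lemma facet_len_area sd : sd \in facet_sides e ->
  facet_len e * facet_len e `^ beta <= H `^ (beta - 1) * gamma * `|area2 sd.1|.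
Proof.
move=> sde; have h0 := facet_len_gt0 tri e.
have -> : facet_len e * facet_len e `^ beta = facet_len e `^ (beta - 1) * facet_len e ^+ 2.
  have {1}-> : beta = 1 + (beta - 1) by rewrite addrC subrK.
  rewrite [X in _ * X = _]powRD; last by rewrite (gt_eqF h0) implybT.
  by rewrite (powRr1 (ltW h0)); ring.
rewrite -mulrA; apply: ler_pM; rewrite ?powR_ge0 ?sqr_ge0 //.
  have hH : facet_len e <= H by rewrite (facet_sides_len sde); case: (sd).
  by apply: ge0_ler_powR; rewrite ?nnegrE ?subr_ge0 // ?(ltW h0) // (le_trans (ltW h0)).
by rewrite (facet_sides_len sde); case: sd sde => K i _; exact: shape.
Qed.

(** The velocity jumps use half of the penalty part of the viscous form; what is left
    is bounded by the energies of the adjacent triangles, uniformly in the mesh. *)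
Lemma facet_estimate :
  - (nu / 2 * (sigma / facet_len e `^ beta * facet_int e (fun s => dot (jump (Upart z) e s) (jump (Upart z) e s))))
  - facet_cst * \sum_(sd <- facet_sides e) elt_energy z sd.1
  <= facet_int e lax_friedrichs - \sum_(sd <- facet_sides e) side_flux z sd.
Proof.
set w := sigma / _; have h0 := facet_len_gt0 tri e.
have w0 : 0 < w by rewrite divr_gt0 // powR_gt0.
rewrite (facet_flux Vz conf) /facet_int.
set S := \sum_(sd <- facet_sides e) elt_energy z sd.1 / `|area2 sd.1|.
pose kappa := 6 * (M + 1) ^+ 2 / (nu * w) * (C * S).
pose J s := dot (jump (Upart z) e s) (jump (Upart z) e s).
pose fl s := flux_n (normal e) (trace_p z e s) - flux_n (normal e) (trace_m z e s).
have iL := cts_integrable01 cts_lax_friedrichs.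
have cfl : continuous fl.
  move=> s; apply: cvgB.
    exact: (continuous_flux_n (continuous_trace_p Vz (e := e))).
  exact: (continuous_flux_n (continuous_trace_m Vz (e := e))).
have ifl := continuous_integrable01 cfl.
have iLfl : leb1.-integrable `[0, 1] (EFin \o (fun s => lax_friedrichs s - fl s)).
  apply: cts_integrable01; apply: ctsD; first exact: cts_lax_friedrichs.
  by apply: ctsN; apply: cts_continuous_at => s _; exact: cfl.
have cJ : continuous J := @continuous_jump_Upart _ _ _ _ Vz e.
have iJ := continuous_integrable01 cJ.
have cJ' : continuous (fun s => - (nu / 2 * w) * J s).
  by move=> s; apply: cvgM; [exact: cvg_cst|exact: cJ].
have iJ' := continuous_integrable01 cJ'.
have ck : continuous (fun _ : R => kappa) by move=> s; exact: cvg_cst.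
have iK := continuous_integrable01 ck.
have iJK : leb1.-integrable `[0, 1] (EFin \o (fun s => - (nu / 2 * w) * J s - kappa)).
  by apply: continuous_integrable01 => s; apply: cvgB; [exact: cJ'|exact: ck].
have step : - (nu / 2 * w) * (\int[leb1]_(s in `[0, 1]) J s) - kappa <= \int[leb1]_(s in `[0, 1]) lax_friedrichs s - \int[leb1]_(s in `[0, 1]) fl s.
  rewrite -RintegralB // -RintegralZl //.
  have -> : kappa = \int[leb1]_(s in `[0, 1]) kappa.
    have l01 : lebesgue_measure (`[0, 1]%classic : set R) = 1%E.
      by rewrite lebesgue_measure_itv /= lte01 sube0.
    by rewrite Rintegral_cst //; transitivity (kappa * fine 1%E); [rewrite /= mulr1|congr (_ * fine _)].
  rewrite -RintegralB //; apply: le_Rintegral => //.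
  - move=> s; rewrite /= in_itv /= => s01.
    by have := facet_pointwise_bound s01 (erefl w); rewrite -/(J s) -/S -/kappa -/(fl s) mulNr.
have hk : facet_len e * kappa <= facet_cst * \sum_(sd <- facet_sides e) elt_energy z sd.1.
  have -> : facet_len e * kappa = 6 * (M + 1) ^+ 2 / (nu * sigma) * C * (facet_len e * facet_len e `^ beta * S).
    by rewrite /kappa /w; field; rewrite !gt_eqF // powR_gt0.
  rewrite /facet_cst -[leRHS]mulrA; apply: ler_wpM2l.
    by apply: mulr_ge0 => //; apply: divr_ge0; apply: mulr_ge0; rewrite ?sqr_ge0 ?(ltW nu0) ?(ltW sigma0).
  rewrite /S !mulr_sumr big_seq [leRHS]big_seq; apply: ler_sum => sd sde.
  rewrite mulrA mulrAC ler_wpM2r ?elt_energy_ge0 //.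
  by rewrite ler_pdivrMr ?facet_len_area // normr_gt0; exact: area2_neq0 tri _.
have := ler_wpM2l (ltW h0) step; rewrite !mulrBr => /(le_trans _); apply.
rewrite -/(J) ; apply: lerB => //.
have -> : \int[leb1]_(x in `[0, 1]) dot (jump (Upart z) e x) (jump (Upart z) e x) = \int[leb1]_(x in `[0, 1]) J x by [].
by rewrite le_eqVlt; apply/orP; left; apply/eqP; ring.
Qed.

End facet_estimate.

(** * Lower bound of the hyperbolic form *)

(** The filter structure is found by unfolding [leb2] to a product measure. *)
#[global] Instance ae_leb2_filter (R : realType) : Filter (almost_everywhere (@leb2 R)).
Proof. rewrite /leb2; typeclasses eauto. Qed.

Section domination.
Context {R : realType}.
Local Notation leb2 := (@leb2 R).

Lemma dominated_Rintegral (D : set (R * R)) (F G : R * R -> R) : measurable D ->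
  measurable_fun D F -> leb2.-integrable D (EFin \o G) ->
  {ae leb2, forall x, D x -> `|F x| <= G x} ->
  leb2.-integrable D (EFin \o F) /\ `|\int[leb2]_(x in D) F x| <= \int[leb2]_(x in D) G x.
Proof.
move=> mD mF iG FG.
have le1 : (\int[leb2]_(x in D) `|(EFin \o F) x| <= \int[leb2]_(x in D) `|(EFin \o G) x|)%E.
  apply: ae_ge0_le_integral => //.
  - by apply: measurableT_comp => //; exact/measurable_EFinP.
  - by apply: measurableT_comp => //; exact: measurable_int iG.
  - by apply: filterS FG => x H Dx /=; rewrite lee_fin (le_trans (H Dx)) // ler_norm.
have iF : leb2.-integrable D (EFin \o F).
  apply/integrableP; split; first exact/measurable_EFinP.
  by apply: le_lt_trans le1 _; case/integrableP: iG.
split=> //; apply: (@le_trans _ _ (\int[leb2]_(x in D) `|F x|)); first exact: le_normr_Rintegral.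
apply: (@le_trans _ _ (\int[leb2]_(x in D) `|G x|)).
  rewrite /Rintegral fine_le //.
  - apply: integrable_fin_num => //; exact: integrable_norm iF.
  - apply: integrable_fin_num => //; exact: integrable_norm iG.
have ae0 : {ae leb2, forall x, D x -> `|G x|%:E = (G x)%:E}.
  by apply: filterS FG => x H Dx; rewrite ger0_norm // (le_trans _ (H Dx)).
rewrite le_eqVlt; apply/orP; left; apply/eqP; rewrite /Rintegral; congr fine.
apply: ae_eq_integral => //.
- by apply/measurable_EFinP; apply: measurableT_comp => //; apply/measurable_EFinP; exact: measurable_int iG.
- exact: measurable_int iG.
Qed.

End domination.

Section volume.
Context {R : realType}.
Local Notation leb2 := (@leb2 R).
Variables (Omega : set (R * R)) (M delta g : R) (b : R * R -> R) (Q : R * R -> 'cV[R]_3).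
Hypothesis poly : polygonal_domain Omega.
Hypothesis d0 : 0 < delta.
Hypothesis cb : {within closure Omega, continuous b}.
Hypothesis sQ : forall i : 'I_3, smooth_up_to_boundary Omega (fun x => Q x i 0).
Hypothesis CB : coefficient_bounds Omega M delta g b Q.
Local Notation pb := (phib g b).
Let oO := open_domain poly.

Variable m : mesh R.
Hypothesis tri : triangulation m Omega.
Variables (k : nat) (z : dgfun m).
Hypothesis Vz : Vh k z.
Variable nu : R.
Hypothesis nu0 : 0 < nu.

Definition elt_grad K : R :=
  \int[leb2]_(x in elt K) (\sum_(j < 2) dot (dpart j (Upart z) K x) (dpart j (Upart z) K x)).

Definition transport K x : R := \sum_(j < 2) dot (Amx j (pb x) (Q x) *m z K x) (dpart j z K x).

Lemma dot_dpart_Upart K x : \sum_(j < 2) dot (dpart j (Upart z) K x) (dpart j (Upart z) K x) =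
  \sum_(j < 2) (partial j (fun y => z K y 1 0) x ^+ 2 + partial j (fun y => z K y 2%:R 0) x ^+ 2).
Proof.
apply: eq_bigr => j _; rewrite dotE !mxE -!expr2.
have E0 : (fun y => Upart z K y 0 0) = fun=> 0 by apply/funext => y; rewrite /Upart !mxE.
have E1 : (fun y => Upart z K y 1 0) = fun y => z K y 1 0 by apply/funext => y; rewrite /Upart !mxE.
have E2 : (fun y => Upart z K y 2%:R 0) = fun y => z K y 2%:R 0 by apply/funext => y; rewrite /Upart !mxE.
by rewrite E0 E1 E2 partial_cst expr0n add0r.
Qed.

Lemma sum2 (V : nmodType) (F : 'I_2 -> V) : \sum_j F j = F 0 + F 1.
Proof. by rewrite !big_ord_recl big_ord0 addr0; congr (F _ + F _); exact/val_inj. Qed.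

(** Let z = (p, u). By [Amx_row0] the only term with a derivative of p is u . grad p, and
    subtracting div (p u) replaces it by - p div u. All remaining terms are products
    of a component of A_j z or p by a derivative of u, to which Young's inequality
    applies. *)
Lemma transport_pointwise K x : closure Omega x ->
  `|transport K x - (partial 0 (fun y => z K y 0 0 * z K y 1 0) x
                     + partial 1 (fun y => z K y 0 0 * z K y 2%:R 0) x)| <=
  nu / 2 * (\sum_(j < 2) dot (dpart j (Upart z) K x) (dpart j (Upart z) K x))
  + 6 * (M + 1) ^+ 2 / nu * dot (z K x) (z K x).
Proof.
move=> cx; have pp i := Vh_polyfun Vz K i.
set D2 := dot (z K x) (z K x); rewrite dot_dpart_Upart sum2 /transport sum2 !dotE !(partialM _ _ (pp _) (pp _)) !Amx_row0 /=.
set N := norm1 (z K x); have N0 : 0 <= N by exact: norm1_ge0.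
have AM j i : `|(Amx j (pb x) (Q x) *m z K x) i 0| <= M * N.
  by apply: mulmx_bound => l; exact: (Amx_bound oO d0 cb sQ CB).
have pN : `|z K x 0 0| <= N by rewrite /N /norm1 -addrA lerDl addr_ge0.
have N2 : N ^+ 2 <= 3 * D2 := norm1_sqr (z K x).
have dE j i : dpart j z K x i 0 = partial j (fun y => z K y i 0) x by rewrite mxE.
rewrite !dE.
set a01 := (Amx 0 _ _ *m _) 1 0; set a02 := (Amx 0 _ _ *m _) 2%:R 0.
set a11 := (Amx 1 _ _ *m _) 1 0; set a12 := (Amx 1 _ _ *m _) 2%:R 0.
set d01 := partial 0 (fun y => z K y 1 0) x; set d02 := partial 0 (fun y => z K y 2%:R 0) x.
set d11 := partial 1 (fun y => z K y 1 0) x; set d12 := partial 1 (fun y => z K y 2%:R 0) x.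
have Y (c d : R) : `|c| <= (M + 1) * N -> `|c * d| <= nu / 2 * d ^+ 2 + ((M + 1) * N) ^+ 2 / (2 * nu).
  move=> hc; rewrite normrM; apply: (@le_trans _ _ ((M + 1) * N * `|d|)); first by rewrite ler_wpM2r.
  by rewrite -[d ^+ 2]real_normK ?num_real //; exact: young.
have MN : M * N <= (M + 1) * N by rewrite ler_wpM2r // lerDl.
have MN' j i : `|(Amx j (pb x) (Q x) *m z K x) i 0 - z K x 0 0| <= (M + 1) * N.
  by rewrite mulrDl mul1r; apply: (le_trans (ler_normB _ _)); apply: lerD.
have y1 := Y (a01 - z K x 0 0) d01 (MN' _ _); have y2 := Y a02 d02 (le_trans (AM _ _) MN).
have y3 := Y a11 d11 (le_trans (AM _ _) MN); have y4 := Y (a12 - z K x 0 0) d12 (MN' _ _).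
have KN : ((M + 1) * N) ^+ 2 / (2 * nu) * 4 <= 6 * (M + 1) ^+ 2 / nu * D2.
  have -> : ((M + 1) * N) ^+ 2 / (2 * nu) * 4 = 2 * (M + 1) ^+ 2 / nu * N ^+ 2.
    by field; rewrite gt_eqF.
  have -> : 6 * (M + 1) ^+ 2 / nu * D2 = 2 * (M + 1) ^+ 2 / nu * (3 * D2).
    by field; rewrite gt_eqF.
  rewrite ler_wpM2l // divr_ge0 ?(ltW nu0) // mulr_ge0 // sqr_ge0 //.
set lhs := (X in `|X|).
have -> : lhs = (a01 - z K x 0 0) * d01 + a02 * d02 + (a11 * d11 + (a12 - z K x 0 0) * d12).
  by rewrite /lhs; ring.
apply: (le_trans (ler_normD _ _)).
have := ler_normD ((a01 - z K x 0 0) * d01) (a02 * d02).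
have := ler_normD (a11 * d11) ((a12 - z K x 0 0) * d12).
move: y1 y2 y3 y4 KN; rewrite !mulrDr; lra.
Qed.

End volume.

Lemma Rintegral_lin (R : realType) (D : set (R * R)) (f h : R * R -> R) (c d : R) : measurable D ->
  leb2.-integrable D (EFin \o f) -> leb2.-integrable D (EFin \o h) ->
  leb2.-integrable D (EFin \o (fun x => c * f x + d * h x)) /\
  \int[leb2]_(x in D) (c * f x + d * h x) = c * \int[leb2]_(x in D) f x + d * \int[leb2]_(x in D) h x.
Proof.
move=> mD i1 i2.
have i3 : leb2.-integrable D (EFin \o (fun x => c * f x)).
  by refine (integrableZl _ c i1).
have i4 : leb2.-integrable D (EFin \o (fun x => d * h x)).
  by refine (integrableZl _ d i2).
split; last by rewrite RintegralD // !RintegralZl.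
by refine (integrableD _ i3 i4).
Qed.

Lemma volume_facet_balance (R : realType) (h c1 c2 G J E T L S : R) :
  T <= S + (h * G + c1 * E) -> - (h * J) - c2 * (3 * E) <= L - S ->
  - (h * (G + J)) - (c1 + 3 * c2) * E <= - T + L.
Proof. lra. Qed.

Lemma polyfun_dot (R : realType) (m : mesh R) (k : nat) (z w : dgfun m) K :
  (forall i, polyfun k (fun x => z K x i 0)) ->
  (forall i, polyfun k (fun x => w K x i 0)) ->
  polyfun (2 * k) (fun x => dot (z K x) (w K x)).
Proof. by move=> pz pw; apply: polyfun_sum => i _; rewrite mul2n -addnn; exact: polyfunM. Qed.

Section hyperbolic.
Context {R : realType}.
Local Notation leb2 := (@leb2 R).
Variables (Omega : set (R * R)) (M delta g : R) (b : R * R -> R) (Q : R * R -> 'cV[R]_3).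
Hypothesis poly : polygonal_domain Omega.
Hypothesis d0 : 0 < delta.
Hypothesis cb : {within closure Omega, continuous b}.
Hypothesis sQ : forall i : 'I_3, smooth_up_to_boundary Omega (fun x => Q x i 0).
Hypothesis CB : coefficient_bounds Omega M delta g b Q.
Local Notation pb := (phib g b).
Let oO := open_domain poly.

Variable m : mesh R.
Hypothesis tri : triangulation m Omega.
Variables (k : nat) (z : dgfun m).
Hypothesis Vz : Vh k z.
Variable nu : R.
Hypothesis nu0 : 0 < nu.

Lemma Vh_polyfun_dpart K j i : polyfun k (fun x => dpart j z K x i 0).
Proof.
rewrite (_ : (fun x => _) = partial j (fun y => z K y i 0)).
  exact/polyfun_partial/(Vh_polyfun Vz).
by apply/funext => x; rewrite mxE.
Qed.

Lemma polyfun_cts n (f : R * R -> R) (D : set (R * R)) : polyfun n f -> cts D f.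
Proof. by move=> pf; apply: cts_continuous_at => x _; exact: polyfun_continuous pf x. Qed.

Lemma Vh_polyfun_grad K : polyfun (2 * k) (fun x => \sum_(j < 2) dot (dpart j (Upart z) K x) (dpart j (Upart z) K x)).
Proof.
rewrite (funext (dot_dpart_Upart z K)); apply: polyfun_sum => j _; apply: polyfunD;
  by apply: polyfunX; apply: polyfun_partial; exact: Vh_polyfun Vz K _.
Qed.

Lemma Vh_polyfun_dot K : polyfun (2 * k) (fun x => dot (z K x) (z K x)).
Proof. exact: polyfun_dot (Vh_polyfun Vz K) (Vh_polyfun Vz K). Qed.

Lemma volume_estimate K :
  \int[leb2]_(x in elt K) transport g b Q z K x <=
  \sum_i side_flux z (K, i) + (nu / 2 * elt_grad z K + 6 * (M + 1) ^+ 2 / nu * elt_energy z K).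
Proof.
have a0 := area2_neq0 tri K; have mK := measurable_elt a0.
have pp i := Vh_polyfun Vz K i.
pose dv x := partial 0 (fun y => z K y 0 0 * z K y 1 0) x + partial 1 (fun y => z K y 0 0 * z K y 2%:R 0) x.
have pdv : polyfun (k + k) dv by apply: polyfunD; apply: polyfun_partial; exact: polyfunM.
have idv := polyfun_integrable_elt a0 pdv.
pose r x := transport g b Q z K x - dv x.
pose G x := nu / 2 * (\sum_(j < 2) dot (dpart j (Upart z) K x) (dpart j (Upart z) K x))
  + 6 * (M + 1) ^+ 2 / nu * dot (z K x) (z K x).
have pG : polyfun (2 * k) G by apply: polyfunD; apply: polyfunZ; [exact: Vh_polyfun_grad|exact: Vh_polyfun_dot].
have iG := polyfun_integrable_elt a0 pG.
have Kcl : elt K `<=` closure Omega by move=> x /(elt_domain poly tri); exact: subset_closure.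
have cT : cts (elt K) (transport g b Q z K).
  apply: cts_sum => j; apply: eq_cts; first by move=> x; rewrite /dot; reflexivity.
  apply: cts_sum => i; apply: ctsM; last exact: polyfun_cts (Vh_polyfun_dpart K j i).
  apply: eq_cts; first by move=> x; rewrite mxE; reflexivity.
  apply: cts_sum => l; apply: ctsM; last exact: polyfun_cts (pp l).
  apply: (cts_subset Kcl); exact: (cts_Amx oO d0 cb sQ CB).
have mr : measurable_fun (elt K) r.
  apply: (open_cts_measurable (open_elt a0) (D := elt K)) => //.
  by apply: ctsD => //; apply: ctsN; exact: polyfun_cts pdv.
have [ir le] : leb2.-integrable (elt K) (EFin \o r) /\ `|\int[leb2]_(x in elt K) r x| <= \int[leb2]_(x in elt K) G x.
  apply: dominated_Rintegral => //; apply: aeW => x Kx.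
  exact: (transport_pointwise poly d0 cb sQ CB Vz nu0 K (Kcl _ Kx)).
have -> : \int[leb2]_(x in elt K) transport g b Q z K x = \int[leb2]_(x in elt K) dv x + \int[leb2]_(x in elt K) r x.
  by rewrite -RintegralD //; apply: eq_Rintegral => x _; rewrite /r addrC subrK.
apply: lerD.
  have := divergence_elt a0 (polyfunM (pp 0) (pp 1)) (polyfunM (pp 0) (pp 2%:R)); rewrite -/dv => ->.
  rewrite le_eqVlt; apply/orP; left; apply/eqP; apply: eq_bigr => i _; rewrite /side_flux; congr (_ * _).
  by apply: eq_Rintegral => s _; rewrite /flux_n /edot /phieta /U_ /V_ /=; ring.
apply: (le_trans (ler_norm _)); apply: (le_trans le).
have i1 := polyfun_integrable_elt a0 (Vh_polyfun_grad K).
have i2 := polyfun_integrable_elt a0 (Vh_polyfun_dot K).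
by rewrite /G; have [_ ->] := Rintegral_lin (nu / 2) (6 * (M + 1) ^+ 2 / nu) mK i1 i2.
Qed.

Variables (sigma beta gamma H C : R).
Hypotheses (sigma0 : 0 < sigma) (beta1 : 1 <= beta) (C0 : 0 <= C).
Hypothesis shape : forall (K : 'I_(nelt m)) i, side_len (K, i) ^+ 2 <= gamma * `|area2 K|.
Hypothesis lenH : forall (K : 'I_(nelt m)) i, side_len (K, i) <= H.
Hypothesis sup : forall (K : 'I_(nelt m)) f x, polyfun k f -> hull K x ->
  f x ^+ 2 <= C / `|area2 K| * \int[leb2]_(y in elt K) (f y ^+ 2).

Definition b_h_cst : R := 6 * (M + 1) ^+ 2 / nu + 3 * facet_cst M nu sigma beta gamma H C.

(** The side fluxes produced by the divergence theorem in [volume_estimate], rearranged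
    facet by facet, are those subtracted in [facet_estimate]. The factor 3 in the
    constant counts the sides of a triangle. *)
Lemma b_h_lower_bound :
  - (nu / 2 * dg_seminorm2 sigma beta z) - b_h_cst * ip z z <= b_h pb Q z z.
Proof.
rewrite /b_h /dg_seminorm2 /sum_facets /ip.
have V : \sum_K \int[leb2]_(x in elt K) transport g b Q z K x <=
   \sum_K \sum_i side_flux z (K, i) + (nu / 2 * \sum_K elt_grad z K + 6 * (M + 1) ^+ 2 / nu * \sum_K elt_energy z K).
  by rewrite !mulr_sumr -!big_split; apply: ler_sum => K _; exact: volume_estimate.
have F : - (nu / 2 * \sum_(i < nfacet m) sigma / facet_len (facets m i) `^ beta * facet_int (facets m i) (fun s =>
     dot (jump (Upart z) (facets m i) s) (jump (Upart z) (facets m i) s)))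
   - facet_cst M nu sigma beta gamma H C * (3 * \sum_K elt_energy z K)
   <= \sum_(i < nfacet m) facet_int (facets m i) (lax_friedrichs g b Q z (facets m i)) - \sum_K \sum_i side_flux z (K, i).
  have E3 : 3 * \sum_K elt_energy z K = \sum_(i < nfacet m) \sum_(sd <- facet_sides (facets m i)) elt_energy z sd.1.
    rewrite (facet_sides_sum tri (fun sd => elt_energy z sd.1)) mulr_sumr; apply: eq_bigr => K _.
    by rewrite sum3 /=; ring.
  rewrite E3 -(facet_sides_sum tri) !mulr_sumr -!sumrN -!big_split; apply: ler_sum => i _.
  exact: (facet_estimate poly d0 cb sQ CB tri Vz nu0 sigma0 beta1 C0 shape lenH sup (facets_conforming tri i)).
exact: volume_facet_balance V F.
Qed.

End hyperbolic.

(** * The viscous form and the source term *)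

Section viscous.
Context {R : realType}.
Local Notation leb2 := (@leb2 R).
Variable m : mesh R.
Variables (k : nat) (z : dgfun m) (nu sigma beta : R).
Hypothesis Vz : Vh k z.

Lemma BmxE (v : 'cV[R]_3) : Bmx nu *m v = cv3 0 (nu * v 1 0) (nu * v 2%:R 0).
Proof.
apply/matrixP => i j; rewrite !ord1 mxE sum3 !mxE /=.
by case: (ord3P i) => -> /=; ring.
Qed.

Lemma dot_BmxC (u v : 'cV[R]_3) : dot (Bmx nu *m u) v = dot u (Bmx nu *m v).
Proof. by rewrite !BmxE !dotE !mxE /=; ring. Qed.

Lemma dot_Bmx (u : 'cV[R]_3) : dot (Bmx nu *m u) u = nu * (u 1 0 ^+ 2 + u 2%:R 0 ^+ 2).
Proof. by rewrite BmxE dotE !mxE /=; ring. Qed.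

Lemma dpart_Sop j K x : dpart j (Sop nu z) K x = Bmx nu *m dpart j z K x.
Proof.
have pp i := Vh_polyfun Vz K i.
apply/matrixP => i l; rewrite !ord1 BmxE !mxE /Sop.
have E c : (fun y => (Bmx nu *m z K y) c 0) = fun y => (cv3 0 (nu * z K y 1 0) (nu * z K y 2%:R 0)) c 0.
  by apply/funext => y; rewrite BmxE.
rewrite E; case: (ord3P i) => -> /=.
- by rewrite (_ : (fun y => _) = fun=> 0) ?partial_cst //; apply/funext => y; rewrite mxE.
- by rewrite (_ : (fun y => _) = fun y => nu * z K y 1 0) ?(partialZ _ _ _ (pp _)) //; apply/funext => y; rewrite mxE.
- by rewrite (_ : (fun y => _) = fun y => nu * z K y 2%:R 0) ?(partialZ _ _ _ (pp _)) //; apply/funext => y; rewrite mxE.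
Qed.

Lemma trace_p_Sop (y : dgfun m) e s : trace_p (Sop nu y) e s = Bmx nu *m trace_p y e s.
Proof. by []. Qed.

Lemma trace_m_Sop (y : dgfun m) e s : trace_m (Sop nu y) e s = Bmx nu *m trace_m y e s.
Proof. by rewrite /trace_m; case: (minus e) => [[sd p]|]; rewrite ?mulmx0. Qed.

Lemma jump_Sop e s : jump (Sop nu z) e s = Bmx nu *m jump z e s.
Proof. by rewrite /jump trace_p_Sop trace_m_Sop mulmxBr. Qed.

Lemma avg_visc_Sop (y : dgfun m) e s : avg_visc (Sop nu y) e s = Bmx nu *m avg_visc y e s.
Proof.
rewrite /avg_visc trace_p_Sop trace_m_Sop; case: (minus e) => // _.
by rewrite -mulmxDr scalemxAr.
Qed.

Lemma avg_visc_dn_Sop e s : avg_visc_dn (Sop nu z) e s = Bmx nu *m avg_visc_dn z e s.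
Proof.
rewrite /avg_visc_dn mulmx_sumr; apply: eq_bigr => j _.
have -> : dpart j (Sop nu z) = Sop nu (dpart j z).
  by apply/funext => K; apply/funext => x; exact: dpart_Sop.
by rewrite avg_visc_Sop scalemxAr.
Qed.

(** The matrix B is symmetric, so the two consistency terms of the nonsymmetric form
    cancel on the diagonal. *)
Lemma a_h_diag : (forall K : 'I_(nelt m), area2 K != 0) -> a_h nu sigma beta z z = nu * dg_seminorm2 sigma beta z.
Proof.
move=> a0; rewrite /a_h /dg_seminorm2 /sum_facets.
have -> : \sum_(i < nfacet m) facet_int (facets m i) (fun s =>
      dot (avg_visc_dn (Sop nu z) (facets m i) s) (jump z (facets m i) s)) =
   \sum_(i < nfacet m) facet_int (facets m i) (fun s =>
      dot (avg_visc_dn z (facets m i) s) (jump (Sop nu z) (facets m i) s)).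
  apply: eq_bigr => i _; congr (_ * _); apply: eq_Rintegral => s _.
  by rewrite avg_visc_dn_Sop jump_Sop dot_BmxC.
rewrite subrK mulrDr; congr (_ + _).
  rewrite mulr_sumr; apply: eq_bigr => K _.
  rewrite -RintegralZl; [|exact: measurable_elt|exact: (polyfun_integrable_elt (a0 K) (Vh_polyfun_grad Vz K))].
  apply: eq_Rintegral => x _; rewrite dot_dpart_Upart mulr_sumr; apply: eq_bigr => j _.
  by rewrite dpart_Sop dot_Bmx !mxE.
rewrite mulr_sumr; apply: eq_bigr => i _; set e := facets m i.
rewrite /facet_int.
transitivity (facet_len e * (nu * (sigma / facet_len e `^ beta)
    * \int[leb1]_(s in `[0, 1]) dot (jump (Upart z) e s) (jump (Upart z) e s))); last by ring.
congr (_ * _).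
rewrite -RintegralZl; [|exact: measurable_itv|exact: (continuous_integrable01 (continuous_jump_Upart Vz (e := e)))].
apply: eq_Rintegral => s _; rewrite jump_Sop dot_Bmx (dot_jump_Upart z) powRN !mxE.
by ring.
Qed.

End viscous.

Section source_bound.
Context {R : realType}.
Local Notation leb2 := (@leb2 R).

(** The chosen representative is locally integrable when there is a weak derivative,
    and zero otherwise. *)
Lemma wpartial_measurable (D : set (R * R)) i f : measurable D -> measurable_fun D (wpartial D i f).
Proof.
move=> mD; rewrite /wpartial; case: xgetP => [h _ [_ [mh _] _] //|_]; exact: measurable_cst.
Qed.

Variables (Omega : set (R * R)) (M delta g fc nu : R) (b : R * R -> R) (Q : R * R -> 'cV[R]_3).
Hypothesis poly : polygonal_domain Omega.
Hypothesis sQ : forall i : 'I_3, smooth_up_to_boundary Omega (fun x => Q x i 0).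
Hypothesis CB : coefficient_bounds Omega M delta g b Q.
Let oO := open_domain poly.
Let mO := open_measurable2 oO.
Local Notation res := (residual Omega g fc nu b Q).
Hypothesis M0 : 0 <= M.

Lemma residual_measurable i : measurable_fun Omega (fun x => res x i 0).
Proof.
have mw j f := @wpartial_measurable Omega j f mO.
have mQ l : measurable_fun Omega (fun x => Q x l 0).
  apply: (open_cts_measurable oO (D := Omega)) => //.
  by apply: cts_subset (cts_Q sQ (i := l)); exact: subset_closure.
have msum (F : 'I_2 -> R * R -> R) : (forall j, measurable_fun Omega (F j)) -> measurable_fun Omega (fun x => \sum_j F j x).
  move=> mF; rewrite (_ : (fun x => _) = fun x => F 0 x + F 1 x); first exact: measurable_funD.
  by apply/funext => x; rewrite sum2.
have ms : measurable_fun Omega (fun x => source Omega g fc b Q x i 0).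
  rewrite /source /V_ /U_ /phieta; case: (ord3P i) => ->.
  - rewrite (_ : (fun x => _) = fun=> 0); first exact: measurable_cst.
    by apply/funext => x; rewrite mxE.
  - rewrite (_ : (fun x => _) = fun x => fc * Q x 2%:R 0 + Q x 0 0 * wpartial Omega 0 (phib g b) x).
      by apply: measurable_funD; apply: measurable_funM.
    by apply/funext => x; rewrite mxE.
  - rewrite (_ : (fun x => _) = fun x => - fc * Q x 1 0 + Q x 0 0 * wpartial Omega 1 (phib g b) x).
      by apply: measurable_funD; apply: measurable_funM.
    by apply/funext => x; rewrite mxE.
have md : measurable_fun Omega (fun x => div_flux Omega g b Q x i 0).
  rewrite (_ : (fun x => _) = fun x => \sum_(j < 2) wpartial Omega j (fun y => flux j (phib g b y) (Q y) i 0) x).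
    exact: msum.
  by apply/funext => x; rewrite mxE.
have ml : measurable_fun Omega (fun x => lap_visc Omega nu Q x i 0).
  rewrite (_ : (fun x => _) = fun x => \sum_(j < 2) wpartial Omega j (wpartial Omega j (fun y => (Bmx nu *m Q y) i 0)) x).
    exact: msum.
  by apply/funext => x; rewrite mxE.
rewrite (_ : (fun x => _) = fun x => source Omega g fc b Q x i 0 - div_flux Omega g b Q x i 0 + lap_visc Omega nu Q x i 0).
  by apply: measurable_funD => //; apply: measurable_funB.
by apply/funext => x; rewrite /residual !mxE.
Qed.

Lemma residual_sq_measurable : measurable_fun Omega (fun x => dot (res x) (res x)).
Proof.
rewrite (_ : (fun x => _) = fun x => res x 0 0 * res x 0 0 + res x 1 0 * res x 1 0 + res x 2%:R 0 * res x 2%:R 0).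
  by apply: measurable_funD; [apply: measurable_funD|]; apply: measurable_funM; exact: residual_measurable.
by apply/funext => x; rewrite dotE.
Qed.

Hypothesis fin : (sqnorm_L2 Omega res < +oo)%E.

Lemma residual_integrable : leb2.-integrable Omega (EFin \o (fun x => dot (res x) (res x))).
Proof.
have mr := residual_sq_measurable.
apply/integrableP; split; first exact/measurable_EFinP.
suff -> : (\int[leb2]_(x in Omega) `|(EFin \o (fun x => dot (res x) (res x))) x| = sqnorm_L2 Omega res)%E by [].
by apply: eq_integral => x _; rewrite /= ger0_norm ?dot_ge0.
Qed.

Variable m : mesh R.
Hypothesis tri : triangulation m Omega.
Variables (k : nat) (z : dgfun m).
Hypothesis Vz : Vh k z.

Lemma residual_integrable_elt (K : 'I_(nelt m)) : leb2.-integrable (elt K) (EFin \o (fun x => dot (res x) (res x))).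
Proof.
have mK := measurable_elt (area2_neq0 tri K).
have ir := residual_integrable.
apply: (integrableS _ _ _ ir); [exact: mO|exact: mK|exact: (elt_domain poly tri)].
Qed.

(** The elements are disjoint measurable subsets of Omega. *)
Lemma residual_elt_sum : \sum_(K < nelt m) \int[leb2]_(x in elt K) dot (res x) (res x) <= fine (sqnorm_L2 Omega res).
Proof.
have mK K := measurable_elt (area2_neq0 tri K).
have mr := residual_sq_measurable.
have dis : trivIset [set` enum 'I_(nelt m)] (@elt R m).
  by move=> K K' _ _ [x [Kx K'x]]; exact: (elt_disjoint tri Kx K'x).
have sub : \big[setU/set0]_(K <- enum 'I_(nelt m)) elt K `<=` Omega.
  by rewrite -bigcup_seq => x [K _]; exact: (elt_domain poly tri).
have mU : measurable (\big[setU/set0]_(K <- enum 'I_(nelt m)) elt K).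
  by apply: bigsetU_measurable => K _.
have le : (\sum_(K <- enum 'I_(nelt m)) \int[leb2]_(x in elt K) (dot (res x) (res x))%:E <= sqnorm_L2 Omega res)%E.
  rewrite -ge0_integral_bigsetU //; last 3 first.
  - exact: enum_uniq.
  - by apply/measurable_EFinP; apply: measurable_funS mr.
  - by move=> x _; rewrite lee_fin dot_ge0.
  apply: ge0_subset_integral => //; first exact/measurable_EFinP.
  by move=> x _; rewrite lee_fin dot_ge0.
have finK (K : 'I_(nelt m)) : (\int[leb2]_(x in elt K) (dot (res x) (res x))%:E)%E \is a fin_num.
  refine (integrable_fin_num _ (residual_integrable_elt K)); exact: mK.
have fS : (sqnorm_L2 Omega res) \is a fin_num.
  by rewrite ge0_fin_numE // integral_ge0 // => x _; rewrite lee_fin dot_ge0.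
rewrite -lee_fin fineK // -sumEFin; apply: le_trans le; rewrite big_enum /=.
by apply: lee_sum => K _; rewrite /Rintegral fineK.
Qed.

(** The Coriolis force does no work. *)
Lemma dot_Coriolis (w0 w1 f : R) (a r : 'cV[R]_3) :
  dot (mx3 [:: [:: 0; 0; 0]; [:: w0; 0; f]; [:: w1; - f; 0]] *m a + r) a =
  (w0 * a 1 0 + w1 * a 2%:R 0) * a 0 0 + (r 0 0 * a 0 0 + r 1 0 * a 1 0 + r 2%:R 0 * a 2%:R 0).
Proof. by rewrite dotE !(mxE, sum3) /=; ring. Qed.

Lemma source_pointwise (w0 w1 : R) (a r : 'cV[R]_3) : `|w0| <= M -> `|w1| <= M ->
  `|(w0 * a 1 0 + w1 * a 2%:R 0) * a 0 0 + (r 0 0 * a 0 0 + r 1 0 * a 1 0 + r 2%:R 0 * a 2%:R 0)|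
  <= (M + 2^-1) * dot a a + 2^-1 * dot r r.
Proof.
move=> h0 h1; rewrite !dotE.
apply: (le_trans (ler_normD _ _)).
rewrite [(M + _) * _]mulrDl -[leRHS]addrA; apply: lerD.
  rewrite normrM; apply: (@le_trans _ _ (M * (`|a 1 0| + `|a 2%:R 0|) * `|a 0 0|)).
    apply: ler_wpM2r => //; apply: (le_trans (ler_normD _ _)); rewrite !normrM mulrDr.
    by apply: lerD; apply: ler_wpM2r.
  rewrite -mulrA; apply: ler_wpM2l => //.
  rewrite -!expr2 -!(@real_normK _ (a _ _)) ?num_real //.
  move: `|a 0 0| `|a 1 0| `|a 2%:R 0| => x y w.
  have := sqr_ge0 (x - y); have := sqr_ge0 (x - w); have := sqr_ge0 y; have := sqr_ge0 w; lra.
rewrite ler_norml; move: (a 0 0) (a 1 0) (a 2%:R 0) (r 0 0) (r 1 0) (r 2%:R 0) => x y w x' y' w'.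
have := sqr_ge0 (x + x'); have := sqr_ge0 (y + y'); have := sqr_ge0 (w + w').
have := sqr_ge0 (x - x'); have := sqr_ge0 (y - y'); have := sqr_ge0 (w - w').
by move=> *; apply/andP; split; lra.
Qed.

Lemma source_bound :
  ip (fun K x => Cmx Omega g fc b x *m z K x + res x) z
  <= (M + 2^-1) * ip z z + 2^-1 * fine (sqnorm_L2 Omega res).
Proof.
have W : W1infty_bound Omega M (phib g b) by case: CB.
have iz K := polyfun_integrable_elt (area2_neq0 tri K) (Vh_polyfun_dot Vz K).
apply: (@le_trans _ _ (\sum_(K < nelt m) \int[leb2]_(x in elt K) ((M + 2^-1) * dot (z K x) (z K x) + 2^-1 * dot (res x) (res x)))).
  apply: ler_sum => K _.
  have a0 := area2_neq0 tri K; have mK := measurable_elt a0.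
  have sub := @elt_domain _ _ _ poly tri K.
  pose C x := Cmx Omega g fc b x *m z K x + res x.
  have CE x : dot (C x) (z K x) =
      (wpartial Omega 0 (phib g b) x * z K x 1 0 + wpartial Omega 1 (phib g b) x * z K x 2%:R 0) * z K x 0 0
      + (res x 0 0 * z K x 0 0 + res x 1 0 * z K x 1 0 + res x 2%:R 0 * z K x 2%:R 0).
    exact: dot_Coriolis.
  have mz i : measurable_fun (elt K) (fun x => z K x i 0).
    apply: (continuous_measurable_fun2 (open_elt a0)) => x _.
    exact: polyfun_continuous (Vh_polyfun Vz K i) x.
  have mr i : measurable_fun (elt K) (fun x => res x i 0) := measurable_funS mO sub (residual_measurable i).
  have mw j : measurable_fun (elt K) (wpartial Omega j (phib g b)) := measurable_funS mO sub (wpartial_measurable j (phib g b) mO).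
  have mC : measurable_fun (elt K) (fun x => dot (C x) (z K x)).
    rewrite (funext CE); apply: measurable_funD.
      by apply: measurable_funM => //; apply: measurable_funD; apply: measurable_funM.
    by apply: measurable_funD; [apply: measurable_funD|]; apply: measurable_funM.
  have aeC : {ae leb2, forall x, elt K x -> `|dot (C x) (z K x)| <= (M + 2^-1) * dot (z K x) (z K x) + 2^-1 * dot (res x) (res x)}.
    have [_ _ W2] := W; apply: filterS2 (W2 0) (W2 1) => x + + Kx.
    move=> /(_ (sub _ Kx)) w0 /(_ (sub _ Kx)) w1; rewrite CE.
    exact: source_pointwise.
  have [_ le] := dominated_Rintegral mK mC (Rintegral_lin (M + 2^-1) 2^-1 mK (iz K) (residual_integrable_elt K)).1 aeC.
  exact: le_trans (ler_norm _) le.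
have E (K : 'I_(nelt m)) : \int[leb2]_(x in elt K) ((M + 2^-1) * dot (z K x) (z K x) + 2^-1 * dot (res x) (res x)) =
    (M + 2^-1) * \int[leb2]_(x in elt K) dot (z K x) (z K x) + 2^-1 * \int[leb2]_(x in elt K) dot (res x) (res x).
  exact: (Rintegral_lin (M + 2^-1) 2^-1 (measurable_elt (area2_neq0 tri K)) (iz K) (residual_integrable_elt K)).2.
rewrite (eq_bigr _ (fun K _ => E K)) mulr_sumr.
rewrite big_split /= lerD2l -mulr_sumr ler_wpM2l ?invr_ge0 //; exact: residual_elt_sum.
Qed.

End source_bound.

(** * Continuity in time of the energy and of the seminorm *)

Section separated_families.
Context {R : realType}.
Variables (Fl : set_system R).
Context {FF : Filter Fl}.

(** Along the filter Fl, F s is a combination of finitely many fixed functions of the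
    class P, with convergent scalar coefficients. Such convergence passes through
    products, derivatives and integrals by finite sums alone. *)
Definition sep_cvg (X : Type) (P : (X -> R) -> Prop) (F : R -> X -> R) (F0 : X -> R) :=
  exists (I : finType) (c : I -> R -> R) (c0 : I -> R) (f : I -> X -> R),
  [/\ forall i, P (f i), forall i, c i s @[s --> Fl] --> c0 i,
      \forall s \near Fl, forall x, F s x = \sum_i c i s * f i x &
      forall x, F0 x = \sum_i c0 i * f i x].

Section ops.
Variables (X : Type) (P : (X -> R) -> Prop).

Lemma sep_cvgD F F0 G G0 : sep_cvg P F F0 -> sep_cvg P G G0 ->
  sep_cvg P (fun s x => F s x + G s x) (fun x => F0 x + G0 x).
Proof.
move=> [I [c [c0 [f [Pf cc FE F0E]]]]] [J [d [d0 [h [Ph dd GE G0E]]]]].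
exists (I + J)%type, (fun k s => match k with inl i => c i s | inr j => d j s end),
  (fun k => match k with inl i => c0 i | inr j => d0 j end),
  (fun k => match k with inl i => f i | inr j => h j end); split.
- by case.
- by case.
- by apply: filterS2 FE GE => s Fs Gs x; rewrite big_sumType /= Fs Gs.
- by move=> x; rewrite big_sumType /= F0E G0E.
Qed.

Lemma sep_cvgM F F0 G G0 : (forall f h, P f -> P h -> P (fun x => f x * h x)) ->
  sep_cvg P F F0 -> sep_cvg P G G0 ->
  sep_cvg P (fun s x => F s x * G s x) (fun x => F0 x * G0 x).
Proof.
move=> PM [I [c [c0 [f [Pf cc FE F0E]]]]] [J [d [d0 [h [Ph dd GE G0E]]]]].
exists (I * J)%type, (fun k s => c k.1 s * d k.2 s), (fun k => c0 k.1 * d0 k.2),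
  (fun k x => f k.1 x * h k.2 x); split.
- by move=> k; exact: PM.
- by move=> k; apply: cvgM.
- apply: filterS2 FE GE => s Fs Gs x; rewrite Fs Gs big_distrlr /= pair_bigA; apply: eq_bigr => k _ /=; ring.
- move=> x; rewrite F0E G0E big_distrlr /= pair_bigA; apply: eq_bigr => k _ /=; ring.
Qed.

Lemma sep_cvgZ a F F0 : sep_cvg P F F0 -> sep_cvg P (fun s x => a * F s x) (fun x => a * F0 x).
Proof.
move=> [I [c [c0 [f [Pf cc FE F0E]]]]]; exists I, (fun i s => a * c i s), (fun i => a * c0 i), f; split => //.
- by move=> i; apply: cvgM => //; exact: cvg_cst.
- by apply: filterS FE => s Fs x; rewrite Fs mulr_sumr; apply: eq_bigr => i _; rewrite mulrA.
- by move=> x; rewrite F0E mulr_sumr; apply: eq_bigr => i _; rewrite mulrA.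
Qed.

Lemma sep_cvg_eq F F0 G G0 : (forall s x, F s x = G s x) -> F0 =1 G0 -> sep_cvg P G G0 -> sep_cvg P F F0.
Proof.
move=> FG FG0; have -> : F = G by apply/funext => s; apply/funext => x.
by have -> : F0 = G0 by exact/funext.
Qed.

Lemma sep_cvg0 : sep_cvg P (fun=> fun=> 0) (fun=> 0).
Proof.
exists 'I_0, (fun _ _ => 0), (fun=> 0), (fun _ _ => 0); split; try by case.
  by apply: nearW => s x; rewrite big_ord0.
by move=> x; rewrite big_ord0.
Qed.

Lemma sep_cvg_sum (J : Type) (r : seq J) (F : J -> R -> X -> R) F0 : (forall j, sep_cvg P (F j) (F0 j)) ->
  sep_cvg P (fun s x => \sum_(j <- r) F j s x) (fun x => \sum_(j <- r) F0 j x).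
Proof.
move=> cF; elim: r => [|j r IH].
  by apply: sep_cvg_eq sep_cvg0 => [s x|x]; rewrite big_nil.
by apply: sep_cvg_eq (sep_cvgD (cF j) IH) => [s x|x]; rewrite big_cons.
Qed.

Lemma sep_cvg_comp (Y : Type) (P' : (Y -> R) -> Prop) (u : Y -> X) F F0 :
  (forall f, P f -> P' (fun y => f (u y))) -> sep_cvg P F F0 -> sep_cvg P' (fun s y => F s (u y)) (fun y => F0 (u y)).
Proof.
move=> PP [I [c [c0 [f [Pf cc FE F0E]]]]]; exists I, c, c0, (fun i y => f i (u y)); split => //.
- by move=> i; exact: PP.
- by apply: filterS FE => s Fs y; exact: Fs.
Qed.

End ops.

Lemma cvg_sum_fin (I : Type) (r : seq I) (c : I -> R -> R) (c0 : I -> R) : (forall i, c i s @[s --> Fl] --> c0 i) ->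
  \sum_(i <- r) c i s @[s --> Fl] --> \sum_(i <- r) c0 i.
Proof.
move=> cc; elim: r => [|i r IH].
  rewrite big_nil; under eq_fun do rewrite big_nil; exact: cvg_cst.
rewrite big_cons; under eq_fun do rewrite big_cons; exact: cvgD.
Qed.

Lemma sep_cvg_Rintegral d (X : measurableType d) (mu : {measure set X -> \bar R}) (D : set X) (P : (X -> R) -> Prop) F F0 :
  measurable D -> (forall f, P f -> mu.-integrable D (EFin \o f)) -> sep_cvg P F F0 ->
  \int[mu]_(x in D) F s x @[s --> Fl] --> \int[mu]_(x in D) F0 x.
Proof.
move=> mD Pint [I [c [c0 [f [Pf cc FE F0E]]]]].
have intsum (a : I -> R) : \int[mu]_(x in D) \sum_i a i * f i x = \sum_i a i * \int[mu]_(x in D) f i x.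
  have iz i : mu.-integrable D (EFin \o (fun x => a i * f i x)) by refine (integrableZl mD _ (Pint _ (Pf i))).
  have H (r : seq I) : mu.-integrable D (EFin \o (fun x => \sum_(i <- r) a i * f i x)) /\
     \int[mu]_(x in D) (\sum_(i <- r) a i * f i x) = \sum_(i <- r) a i * \int[mu]_(x in D) f i x.
    elim: r => [|i r [IH1 IH2]].
      rewrite big_nil (_ : (fun x => _) = fun=> 0); last by apply/funext => x; rewrite big_nil.
      split; first by apply: integrable0.
      by rewrite Rintegral_cst // mul0r.
    rewrite big_cons (_ : (fun x => \sum_(j <- i :: r) a j * f j x) = (fun x => a i * f i x + \sum_(j <- r) a j * f j x)).
      split; first by refine (integrableD mD (iz i) IH1).
      by rewrite RintegralD // IH2 RintegralZl //; exact: Pint.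
    by apply/funext => x; rewrite big_cons.
  exact: (H _).2.
have -> : \int[mu]_(x in D) F0 x = \sum_i c0 i * \int[mu]_(x in D) f i x.
  by rewrite -intsum; apply: eq_Rintegral => x _; exact: F0E.
have E : {near Fl, (fun s => \sum_i c i s * \int[mu]_(x in D) f i x) =1 (fun s => \int[mu]_(x in D) F s x)}.
  by apply: filterS FE => s Fs; rewrite -intsum; apply: eq_Rintegral => x _; rewrite Fs.
apply: cvg_trans (near_eq_cvg E) _.
by apply: cvg_sum_fin => i; apply: cvgM => //; exact: cvg_cst.
Qed.

End separated_families.

Section time_families.
Context {R : realType}.
Local Notation leb2 := (@leb2 R).
Variable m : mesh R.
Hypothesis a0 : forall K : 'I_(nelt m), area2 K != 0.
Variable k : nat.

Definition is_polyfun (f : R * R -> R) := exists n, polyfun n f.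

Lemma is_polyfunM f h : is_polyfun f -> is_polyfun h -> is_polyfun (fun x => f x * h x).
Proof. by move=> [n pf] [l ph]; exists (n + l)%N; exact: polyfunM. Qed.

Section filter.
Variables (Fl : set_system R).
Context {FF : ProperFilter Fl}.

(** Polynomials of bounded degree are determined by their values at the nodes, which
    converge as soon as F s converges pointwise. *)
Lemma sep_cvg_interp (F : R -> R * R -> R) (F0 : R * R -> R) :
  (\forall s \near Fl, polyfun k (F s)) -> (forall x, F s x @[s --> Fl] --> F0 x) ->
  sep_cvg Fl is_polyfun F F0.
Proof.
move=> pF cF.
have E : \forall s \near Fl, forall x, F s x = \sum_(a : 'I_k.+1 * 'I_k.+1) F s (node a) * lagrange2 a x.
  by apply: filterS pF => s ps x; exact: polyfun_interp.
exists ('I_k.+1 * 'I_k.+1)%type, (fun a s => F s (node a)), (fun a => F0 (node a)), (fun a => lagrange2 a); split => //.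
- by move=> a; exact: polyfun_lagrange2.
- move=> x.
  have c1 : \sum_(a : 'I_k.+1 * 'I_k.+1) F s (node a) * lagrange2 a x @[s --> Fl] --> \sum_(a : 'I_k.+1 * 'I_k.+1) F0 (node a) * lagrange2 a x.
    by apply: cvg_sum_fin => a; apply: cvgM; [exact: cF|exact: cvg_cst].
  have c2 : F s x @[s --> Fl] --> \sum_(a : 'I_k.+1 * 'I_k.+1) F0 (node a) * lagrange2 a x.
    apply: cvg_trans c1; apply: near_eq_cvg; by apply: filterS E => s Es; rewrite Es.
  exact: (cvg_unique _ (cF x) c2).
Qed.

Lemma sep_cvg_partial j F F0 : sep_cvg Fl is_polyfun F F0 ->
  sep_cvg Fl is_polyfun (fun s => partial j (F s)) (partial j F0).
Proof.
move=> [I [c [c0 [f [Pf cc FE F0E]]]]].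
have /boolp.choice[n pf] := Pf.
have pM i : polyfun (\max_i n i) (f i) by apply: polyfunW (pf i); exact: leq_bigmax.
exists I, c, c0, (fun i => partial j (f i)); split => //.
- by move=> i; exists (n i); exact: polyfun_partial.
- by apply: filterS FE => s Fs x; rewrite (funext Fs) (partial_sum _ _ _ _ pM).
- by move=> x; rewrite (funext F0E) (partial_sum _ _ _ _ pM).
Qed.

Lemma is_polyfun_integrable (K : 'I_(nelt m)) f : is_polyfun f -> leb2.-integrable (elt K) (EFin \o f).
Proof. by move=> [n pf]; refine (polyfun_integrable_elt (a0 K) pf). Qed.

Lemma sep_cvg_elt (K : 'I_(nelt m)) F F0 : sep_cvg Fl is_polyfun F F0 ->
  \int[leb2]_(x in elt K) F s x @[s --> Fl] --> \int[leb2]_(x in elt K) F0 x.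
Proof.
move=> sF; refine (sep_cvg_Rintegral _ _ _); [exact: (measurable_elt (a0 K))| |exact: sF].
by move=> f; exact: is_polyfun_integrable.
Qed.

Definition dg_cvg (z : R -> dgfun m) (z0 : dgfun m) :=
  forall K i, sep_cvg Fl is_polyfun (fun s x => z s K x i 0) (fun x => z0 K x i 0).

Lemma cvg_ip z z0 w w0 : dg_cvg z z0 -> dg_cvg w w0 -> ip (z s) (w s) @[s --> Fl] --> ip z0 w0.
Proof.
move=> cz cw; apply: (cvg_sum_fin (c := fun K s => \int[leb2]_(x in elt K) dot (z s K x) (w s K x))) => K.
apply: (sep_cvg_elt (F := fun s x => dot (z s K x) (w s K x))).
apply: (sep_cvg_sum _ (F := fun i s x => z s K x i 0 * w s K x i 0)) => i.
by apply: sep_cvgM => //; exact: is_polyfunM.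
Qed.

Lemma cvg_dg_seminorm2 sigma beta z z0 : dg_cvg z z0 ->
  dg_seminorm2 sigma beta (z s) @[s --> Fl] --> dg_seminorm2 sigma beta z0.
Proof.
move=> cz; apply: cvgD.
  apply: (cvg_sum_fin (c := fun K s => \int[leb2]_(x in elt K)
     (\sum_(j < 2) dot (dpart j (Upart (z s)) K x) (dpart j (Upart (z s)) K x)))) => K.
  apply: (sep_cvg_elt (F := fun s x => \sum_(j < 2) dot (dpart j (Upart (z s)) K x) (dpart j (Upart (z s)) K x))).
  apply: (sep_cvg_eq (fun s => dot_dpart_Upart (z s) K) (dot_dpart_Upart z0 K)).
  have sq j i : sep_cvg Fl is_polyfun (fun s x => partial j (fun y => z s K y i 0) x ^+ 2)
      (fun x => partial j (fun y => z0 K y i 0) x ^+ 2).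
    have cp := sep_cvg_partial j (cz K i).
    exact: (sep_cvgM is_polyfunM cp cp).
  apply: (sep_cvg_sum _ (F := fun j s x => partial j (fun y => z s K y 1 0) x ^+ 2 + partial j (fun y => z s K y 2%:R 0) x ^+ 2)) => j.
  exact: (sep_cvgD (sq j 1) (sq j 2%:R)).
rewrite /sum_facets.
apply: (cvg_sum_fin (c := fun i s => sigma / facet_len (facets m i) `^ beta *
   facet_int (facets m i) (fun t => dot (jump (Upart (z s)) (facets m i) t) (jump (Upart (z s)) (facets m i) t)))) => i.
set e := facets m i; apply: cvgM; first exact: cvg_cst.
apply: cvgM; first exact: cvg_cst.
have cP (f h : R -> R) : continuous f -> continuous h -> continuous (fun x => f x * h x).
  by move=> cf ch x; exact: cvgM (cf x) (ch x).
refine (@sep_cvg_Rintegral R Fl _ _ (measurableTypeR R) leb1 _ (fun f : R -> R => continuous f) _ _ _ _ _).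
- exact: measurable_itv.
- by move=> f cf; exact: continuous_integrable01.
apply: (sep_cvg_eq (fun s => dot_jump_Upart (z s) e) (dot_jump_Upart z0 e)).
have cpt (u v : R * R) f : is_polyfun f -> continuous (fun t : R => f (u + t *: v)).
  by move=> [n pf]; exact: continuous_path pf.
have tp l : sep_cvg Fl (fun f : R -> R => continuous f) (fun s t => trace_p (z s) e t l 0) (fun t => trace_p z0 e t l 0).
  by apply: (sep_cvg_comp (u := facet_pt e)) (cz (plus e).1 l) => f; exact: cpt.
have tm l : sep_cvg Fl (fun f : R -> R => continuous f) (fun s t => trace_m (z s) e t l 0) (fun t => trace_m z0 e t l 0).
  rewrite /trace_m; case: (minus e) => [[sd p]|].
    apply: (sep_cvg_comp (u := fun t => facet_pt e t + p)) (cz sd.1 l) => f pf.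
    rewrite (_ : (fun t => _) = fun t => f ((side_a (plus e) + p) + t *: side_vec (plus e))); first exact: cpt.
    by apply/funext => t; rewrite /facet_pt addrAC.
  by apply: sep_cvg_eq (sep_cvg0 _) => [s x|x]; rewrite mxE.
have sq l : sep_cvg Fl (fun f : R -> R => continuous f) (fun s t => (trace_p (z s) e t l 0 - trace_m (z s) e t l 0) ^+ 2)
   (fun t => (trace_p z0 e t l 0 - trace_m z0 e t l 0) ^+ 2).
  have d : sep_cvg Fl (fun f : R -> R => continuous f) (fun s t => trace_p (z s) e t l 0 - trace_m (z s) e t l 0)
   (fun t => trace_p z0 e t l 0 - trace_m z0 e t l 0).
    apply: sep_cvg_eq (sep_cvgD (tp l) (sep_cvgZ (-1) (tm l))) => [s x|x]; by rewrite mulN1r.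
  exact: (sep_cvgM cP d d).
exact: (sep_cvgD (sq 1) (sq 2%:R)).
Qed.

End filter.
End time_families.

(** * Gronwall inequality *)

Section gronwall.
Context {R : realType}.

Lemma time_derivative_is_derive (T : R) f t l : 0 < t < T -> time_derivative T f t l -> is_derive t 1 f l.
Proof.
move=> /andP[t0 tT] td.
have E : (fun h : R => h^-1 *: ((f \o shift t) (h *: 1) - f t)) @ 0^' --> l.
  have sh : (fun h : R => h + t) @ 0^' --> within `[0, T] t^'.
    have c : (fun h : R => h + t) @ (0 : R) --> t.
      by rewrite -[X in _ --> X]add0r; apply: cvgD; [exact: cvg_id|exact: cvg_cst].
    move=> P nP0.
    have nP : nbhs t (fun y => y != t -> `[0, T]%classic y -> P y) := nP0.
    have nI : nbhs t `]0, T[%classic by apply: open_nbhs_nbhs; split; [exact: interval_open|rewrite /= in_itv /= t0].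
    have nPI : nbhs t (fun y => (y != t -> `[0, T]%classic y -> P y) /\ `]0, T[%classic y) by exact: filterI.
    have B : nbhs (0 : R) (fun h : R => (h + t != t -> `[0, T]%classic (h + t) -> P (h + t)) /\ `]0, T[%classic (h + t)).
      exact: (c _ nPI).
    have A : nbhs (0 : R) (fun h : R => h != 0 -> P (h + t)).
      apply: filterS B => h [Ph Ih] h0; move: Ih; rewrite /= in_itv /= => /andP[h1 h2].
      apply: Ph; last by rewrite /= in_itv /= !ltW.
      by apply: contra_neq h0 => /eqP; rewrite -subr_eq0 addrK => /eqP.
    exact: A.
  have comp : ((fun s => (s - t)^-1 * (f s - f t)) \o (fun h : R => h + t)) @ 0^' --> l.
    by move=> P hP; exact: (sh _ (td P hP)).
  apply: cvg_trans comp; apply: near_eq_cvg.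
  by apply: nearW => h /=; rewrite addrK /GRing.scale /= mulr1.
apply: DeriveDef; first by apply/cvg_ex; exists l.
exact/cvg_lim.
Qed.

(** The function exp(- A t) E(t) + nu exp(- A T) P(t) - rho t, with P(t) the integral of N
    over [0, t], is nonincreasing: the constant weight of P stays below exp(- A t), so its
    derivative in front of N is compensated by the dissipation. *)
Lemma gronwall (T A nu rho : R) (E N dE : R -> R) :
  0 < T -> 0 <= A -> 0 <= nu -> 0 <= rho ->
  {within `[0, T], continuous E} -> {within `[0, T], continuous N} ->
  (forall t, 0 < t < T -> 0 <= N t) ->
  (forall t, 0 < t < T -> is_derive t 1 E (dE t)) ->
  (forall t, 0 < t < T -> dE t <= - (nu * N t) + A * E t + rho) ->
  E T + nu * \int[leb1]_(t in `[0, T]) N t <= expR (A * T) * (E 0 + rho * T).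
Proof.
move=> T0 A0 nu0 rho0 cE cN N0 dEE ineq.
have iN : leb1.-integrable `[0, T] (EFin \o N).
  by apply: continuous_compact_integrable => //; exact: segment_compact.
pose P x := \int[leb1]_(t in `[0, x]) N t.
have cP : {within `[0, T], continuous P} := parameterized_integral_continuous (ltW T0) iN.
pose w := nu * expR (- (A * T)).
pose phi t := expR (- A * t) * E t + w * P t - rho * t.
have dphi t : 0 < t < T -> is_derive t 1 phi (expR (- A * t) * dE t - A * expR (- A * t) * E t + w * N t - rho).
  move=> tI; have /andP[t0 tT] := tI.
  have dP : is_derive t 1 P (N t).
    have cNt : {for t, continuous N}.
      have := cN; move/(continuous_within_itvP N T0) => [H _ _].
      by apply: H; rewrite in_itv /= t0.
    have [d1 d2] := continuous_FTC1_closed tT iN t0 cNt.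
    by apply: DeriveDef => //; rewrite -derive1E.
  have de : is_derive t 1 (fun t => expR (- A * t)) (- A * expR (- A * t)).
    have d1 : is_derive t 1 (fun t : R => - A * t) (- A).
      have := @is_deriveZ _ _ _ id (- A) t 1 1 (is_derive_id t 1).
      by rewrite /GRing.scale /= mulr1.
    by have := is_derive1_comp (is_derive_expR (- A * t)) d1; rewrite mulrC.
  have dEt := dEE t tI.
  have d1 := is_deriveM de dEt.
  have d2 := @is_deriveZ _ _ _ P w t 1 _ dP.
  have d3 := @is_deriveZ _ _ _ id rho t 1 1 (is_derive_id t 1).
  have := is_deriveB (is_deriveD d1 d2) d3.
  rewrite /GRing.scale /= mulr1 => H.
  rewrite (_ : _ - rho = expR (- A * t) * dE t + E t * (- A * expR (- A * t)) + w * N t - rho); first exact: H.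
  ring.
have le : phi T <= phi 0.
  apply: (@ler0_derive1_nincr _ phi 0 T) => //; rewrite ?lexx ?(ltW T0) //.
  - by move=> t; rewrite in_itv /= => /dphi [].
  - move=> t; rewrite in_itv /= => tI; rewrite derive1E; have [_ ->] := dphi t tI.
    have /andP[t0 tT] := tI.
    have eA0 : 0 < expR (- A * t) by exact: expR_gt0.
    have eA1 : expR (- A * t) <= 1 by rewrite -expR0 ler_expR mulNr oppr_le0 mulr_ge0 // ltW.
    have ew : w <= nu * expR (- A * t).
      by rewrite /w ler_wpM2l // ler_expR mulNr lerN2 ler_wpM2l // ltW.
    have h1 : expR (- A * t) * (dE t - A * E t) <= expR (- A * t) * (- (nu * N t) + rho).
      by apply: ler_wpM2l; [exact: ltW|have := ineq t tI; lra].
    have h2 : expR (- A * t) * rho <= rho by rewrite -[leRHS]mul1r ler_wpM2r.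
    have h3 : w * N t <= nu * expR (- A * t) * N t by rewrite ler_wpM2r // N0.
    rewrite (_ : _ - rho = expR (- A * t) * (dE t - A * E t) + w * N t - rho); last by ring.
    apply: le_trans (_ : expR (- A * t) * (- (nu * N t) + rho) + nu * expR (- A * t) * N t - rho <= 0).
      by apply: lerB => //; apply: lerD.
    rewrite (_ : expR (- A * t) * (- (nu * N t) + rho) + nu * expR (- A * t) * N t - rho = expR (- A * t) * rho - rho); last by ring.
    by rewrite subr_le0.
  - apply/ctsP; apply: ctsD; first apply: ctsD.
    + apply: ctsM; last exact/ctsP.
      apply: cts_continuous_at => t _; apply: continuous_comp; last exact: continuous_expR.
      by apply: cvgM; [exact: cvg_cst|exact: cvg_id].
    + by apply: ctsM; [exact: cts_cst|exact/ctsP].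
    + apply: ctsN; apply: ctsM; first exact: cts_cst.
      by apply: cts_continuous_at => t _; exact: cvg_id.
have P0 : P 0 = 0 by rewrite /P set_itv1 Rintegral_set1.
move: le; rewrite /phi P0 !mulr0 expR0 mul1r addr0 subr0 => le.
have eAT : expR (A * T) * expR (- A * T) = 1 by rewrite -expRD mulNr subrr expR0.
have : expR (A * T) * (expR (- A * T) * E T + w * P T - rho * T) <= expR (A * T) * E 0.
  by apply: ler_wpM2l => //; exact: expR_ge0.
have -> : expR (A * T) * (expR (- A * T) * E T + w * P T - rho * T) = E T + nu * P T - expR (A * T) * (rho * T).
  by rewrite /w -mulNr mulrBr mulrDr !mulrA eAT mul1r [_ * nu]mulrC -[nu * _ * _]mulrA eAT mulr1.
by rewrite -/(P T) mulrDr lerBlDr.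
Qed.

End gronwall.

(** * Time derivative of the energy *)

Section energy.
Context {R : realType}.
Local Notation leb2 := (@leb2 R).
Variable m : mesh R.
Hypothesis a0 : forall K : 'I_(nelt m), area2 K != 0.
Variables (k : nat) (T : R) (qh : R -> dgfun m).
Hypothesis Vq : forall t, 0 <= t <= T -> Vh k (qh t).
Hypothesis cq : forall K x (i : 'I_3), {within `[0, T], continuous (fun t => qh t K x i 0)}.

Lemma within_proper t : 0 <= t <= T -> ProperFilter (within `[0, T] (nbhs t)).
Proof.
by move=> tT; apply: within_nbhs_proper; apply: subset_closure; rewrite /= in_itv.
Qed.

Lemma dg_cvg_within t : 0 <= t <= T -> dg_cvg (within `[0, T] (nbhs t)) qh (qh t).
Proof.
move=> tT K i; have FF := within_proper tT; apply: (@sep_cvg_interp _ k).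
  have : \forall s \near nbhs t, `[0, T]%classic s -> polyfun k (fun x => qh s K x i 0).
    by apply: nearW => s; rewrite /= in_itv /= => sT; exact: Vh_polyfun (Vq sT) K i.
  by [].
by move=> x; have /ctsP := @cq K x i; apply; rewrite /= in_itv.
Qed.

Lemma cts_energy : {within `[0, T], continuous (fun t => ip (qh t) (qh t))}.
Proof.
apply/ctsP => t; rewrite /= in_itv /= => tT; have FF := within_proper tT.
exact: (cvg_ip a0 (dg_cvg_within tT) (dg_cvg_within tT)).
Qed.

Lemma cts_dg_seminorm2 sigma beta : {within `[0, T], continuous (fun t => dg_seminorm2 sigma beta (qh t))}.
Proof.
apply/ctsP => t; rewrite /= in_itv /= => tT; have FF := within_proper tT.
by apply: (cvg_dg_seminorm2 a0); exact: dg_cvg_within.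
Qed.

(** The factorization |z|^2 - |w|^2 = (z - w, z) + (z - w, w). *)
Lemma ip_difference (h : R) (z w : dgfun m) : Vh k z -> Vh k w ->
  h * (ip z z - ip w w) =
  ip (fun K x => h *: (z K x - w K x)) z + ip (fun K x => h *: (z K x - w K x)) w.
Proof.
move=> Vz Vw; rewrite /ip -sumrB mulr_sumr -big_split; apply: eq_bigr => K _ /=.
have mK := measurable_elt (a0 K).
have pz i := Vh_polyfun Vz K i; have pw i := Vh_polyfun Vw K i.
have pd i : polyfun k (fun x => (h *: (z K x - w K x)) i 0).
  rewrite (_ : (fun x => _) = fun x => h * (z K x i 0 + - w K x i 0)); last by apply/funext => x; rewrite !mxE.
  by apply: polyfunZ; apply: polyfunD => //; exact: polyfunN.
have i1 := polyfun_integrable_elt (a0 K) (polyfun_dot pz pz).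
have i2 := polyfun_integrable_elt (a0 K) (polyfun_dot pw pw).
have i3 := polyfun_integrable_elt (a0 K) (polyfun_dot (z := fun K x => h *: (z K x - w K x)) pd pz).
have i4 := polyfun_integrable_elt (a0 K) (polyfun_dot (z := fun K x => h *: (z K x - w K x)) pd pw).
have [_ E1] := Rintegral_lin h (- h) mK i1 i2; have [_ E2] := Rintegral_lin 1 1 mK i3 i4.
rewrite mulrBr -mulNr -E1 -[X in X + _]mul1r -[X in _ + X]mul1r -E2.
by apply: eq_Rintegral => x _; rewrite !dotE !mxE; ring.
Qed.

(** By [ip_difference] the difference quotient of the energy is the inner product of the
    difference quotient of qh with the sum of its two values. The values of qh are
    polynomials of degree k, so the pointwise derivatives in time suffice to pass to
    the limit. *)
Lemma is_derive_energy t (dq : dgfun m) : 0 < t < T ->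
  (forall K x (i : 'I_3), time_derivative T (fun s => qh s K x i 0) t (dq K x i 0)) ->
  is_derive t 1 (fun s => ip (qh s) (qh s)) (2 * ip dq (qh t)).
Proof.
move=> tT td; have /andP[t0 tT'] := tT.
have isd K x i := time_derivative_is_derive tT (td K x i).
pose sh (h : R) := h *: 1 + t.
have csh : sh h @[h --> (0 : R)^'] --> t.
  have -> : t = sh 0 by rewrite /sh scale0r add0r.
  apply: cvg_within_filter; apply: cvgD; last exact: cvg_cst.
  by apply: cvgZl; exact: cvg_id.
have shI : \forall h \near (0 : R)^', 0 <= sh h <= T.
  have nI : nbhs t `]0, T[%classic by apply: open_nbhs_nbhs; split; [exact: interval_open|rewrite /= in_itv /= t0].
  have : \forall h \near (0 : R)^', `]0, T[%classic (sh h) by exact: csh _ nI.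
  by apply: filterS => h; rewrite /= in_itv /= => /andP[h1 h2]; rewrite !ltW.
have cqs : dg_cvg (0 : R)^' (fun h => qh (sh h)) (qh t).
  move=> K i; apply: (@sep_cvg_interp _ k).
    by apply: filterS shI => h hI; exact: Vh_polyfun (Vq hI) K i.
  move=> x; have ct : {for t, continuous (fun s => qh s K x i 0)}.
    by apply: differentiable_continuous; apply/derivable1_diffP; case: (isd K x i).
  by move=> P /ct; exact: csh.
have ctt : dg_cvg (0 : R)^' (fun=> qh t) (qh t).
  move=> K i; apply: (@sep_cvg_interp _ k); last by move=> x; exact: cvg_cst.
  by apply: nearW => _; apply: Vh_polyfun K i; apply: Vq; rewrite !ltW.
pose D h : dgfun m := fun K x => h^-1 *: (qh (sh h) K x - qh t K x).
have cD : dg_cvg (0 : R)^' D dq.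
  move=> K i; apply: (@sep_cvg_interp _ k).
    apply: filterS shI => h hI; rewrite /D (_ : (fun x => _) = fun x => h^-1 * (qh (sh h) K x i 0 + - qh t K x i 0)); last first.
      by apply/funext => x; rewrite !mxE.
    apply: polyfunZ; apply: polyfunD; first exact: Vh_polyfun (Vq hI) K i.
    by apply: polyfunN; apply: Vh_polyfun K i; apply: Vq; rewrite !ltW.
  move=> x; have [d1 d2] := isd K x i.
  have lq : h^-1 *: (((fun s => qh s K x i 0) \o shift t) (h *: 1) - qh t K x i 0) @[h --> (0 : R)^'] --> dq K x i 0.
    by rewrite -d2; exact: d1.
  apply: cvg_trans lq; apply: near_eq_cvg; apply: nearW => h /=.
  by rewrite /D !mxE.
have lim : ip (D h) (qh (sh h)) + ip (D h) (qh t) @[h --> (0 : R)^'] --> 2 * ip dq (qh t).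
  rewrite mulr_natl mulr2n; apply: cvgD; first exact: (cvg_ip a0 cD cqs).
  exact: (cvg_ip a0 cD ctt).
have E : (fun h : R => h^-1 *: (((fun s => ip (qh s) (qh s)) \o shift t) (h *: 1) - ip (qh t) (qh t))) @ (0 : R)^'
   --> 2 * ip dq (qh t).
  apply: cvg_trans lim; apply: near_eq_cvg; apply: filterS shI => h hI /=.
  rewrite -[RHS]/(h^-1 * (ip (qh (sh h)) (qh (sh h)) - ip (qh t) (qh t))).
  by rewrite ip_difference //; apply: Vq => //; rewrite !ltW.
by apply: DeriveDef; [apply/cvg_ex; exists (2 * ip dq (qh t))|exact/cvg_lim].
Qed.

End energy.

(** * Stability of the scheme *)

Lemma dg_seminorm2_ge0 (R : realType) (m : mesh R) (sigma beta : R) (z : dgfun m) : 0 <= sigma ->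
  0 <= dg_seminorm2 sigma beta z.
Proof.
move=> s0; apply: addr_ge0.
  apply: sumr_ge0 => K _; apply: Rintegral_ge0 => x _; apply: sumr_ge0 => j _; exact: dot_ge0.
apply: sumr_ge0 => i _; apply: mulr_ge0; first by rewrite divr_ge0 ?powR_ge0.
by apply: mulr_ge0; [exact: sqrtr_ge0|apply: Rintegral_ge0 => s _; exact: dot_ge0].
Qed.

Lemma energy_rate (R : realType) (nu N E K M r bh ah rhs d : R) :
  - (nu / 2 * N) - K * E <= bh -> ah = nu * N ->
  rhs <= (M + 2^-1) * E + 2^-1 * r -> d + bh + ah = rhs ->
  2 * d <= - (nu * N) + 2 * (M + 2^-1 + K) * E + r.
Proof. by move=> h1 -> h2 h3; lra. Qed.

Theorem theorem1 (R : realType) (Omega : set (R * R)) (T nu fc sigma beta : R)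
    (k : nat) (Qh : set (mesh R)) (M delta : R) :
  polygonal_domain Omega ->
  0 < T -> 0 < nu -> 0 < sigma -> 1 <= beta -> (1 <= k)%N ->
  (forall m, Qh m -> triangulation m Omega) ->
  shape_regular Qh -> quasi_uniform Qh ->
  0 < delta ->
  exists2 c1 : R, 0 < c1 &
    forall (g : R) (b : R * R -> R) (qeq : R * R -> 'cV[R]_3)
      (q : R -> R * R -> 'cV[R]_3),
    0 < g ->
    W1infty Omega b -> {within closure Omega, continuous b} ->
    (forall i : 'I_3, smooth_up_to_boundary Omega (fun x => qeq x i 0)) ->
    coefficient_bounds Omega M delta g b qeq ->
    exact_solution Omega T g fc nu b q ->
    (forall t, 0 <= t <= T -> forall i : 'I_3,
       Hs k.+1 Omega (fun x => q t x i 0)) ->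
    forall (m : mesh R) (qh : R -> dgfun m),
    Qh m ->
    semidiscrete_solution k Omega T g fc nu sigma beta b qeq qh ->
    ((ip (qh T) (qh T))%:E
     + nu%:E * \int[leb1]_(t in `[0%R, T])
                 (dg_seminorm2 sigma beta (qh t))%:E
     <= c1%:E * ((ip (qh 0) (qh 0))%:E
                 + \int[leb1]_(t in `[0%R, T])
                     sqnorm_L2 Omega (residual Omega g fc nu b qeq)))%E.
Proof.
move=> poly T0 nu0 sigma0 beta1 _ triQ [gamma gamma0 shapeQ] _ delta0.
have [H _ lenH] := domain_side_bound poly.
have [C C0 supC] := elt_sup_bound R k.
pose A := 2 * (M + 2^-1 + b_h_cst M nu sigma beta gamma H C).
exists (expR (A * T)); first exact: expR_gt0.
move=> g b qeq _ _ _ cb sQ CB _ _ m qh Qm [Vq cq sol].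
have tri := triQ m Qm; have a0 := area2_neq0 tri.
have ne : Omega !=set0 by case: poly => -[].
have M0 := coefficient_bound_ge0 (open_domain poly) delta0 cb sQ CB ne.
set S := sqnorm_L2 Omega _.
have S0 : (0 <= S)%E by apply: integral_ge0 => x _; rewrite lee_fin dot_ge0.
have lT : lebesgue_measure (`[0, T]%classic : set R) = T%:E.
  by rewrite lebesgue_measure_itv /= lte_fin T0 sube0.
have -> : (\int[leb1]_(t in `[0%R, T]) S = S * T%:E)%E.
  rewrite integral_cst; last exact: measurable_itv.
  by congr (_ * _)%E.
(* If the residual is not square integrable, the right-hand side is infinite. *)
have [Sfin|] := boolP (S < +oo)%E; last first.
  rewrite -leNgt leye_eq => /eqP ->; rewrite gt0_mulye ?lte_fin // addey //.
  by rewrite gt0_muley ?lte_fin ?expR_gt0 // leey.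
pose rho := fine S.
have SE : S = rho%:E by rewrite fineK // ge0_fin_numE.
have rho0 : 0 <= rho by exact: fine_ge0.
have Kc0 : 0 <= b_h_cst M nu sigma beta gamma H C.
  have pos (x : R) : 0 <= x -> 0 <= 6 * (M + 1) ^+ 2 / x.
    by move=> x0; rewrite divr_ge0 // mulr_ge0 // sqr_ge0.
  rewrite /b_h_cst addr_ge0 ?pos ?(ltW nu0) // mulr_ge0 // /facet_cst.
  apply: mulr_ge0; last by rewrite mulr_ge0 ?powR_ge0 // ltW.
  by apply: mulr_ge0 => //; apply: pos; rewrite mulr_ge0 // ltW.
have A0 : 0 <= A by apply: mulr_ge0 => //; apply: addr_ge0 => //; apply: addr_ge0; rewrite ?invr_ge0.
have shape (K : 'I_(nelt m)) i : side_len (K, i) ^+ 2 <= gamma * `|area2 K|.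
  by have [x disc] := shapeQ m Qm K; exact: (side_len_sqr_area tri i gamma0 disc).
pose E t := ip (qh t) (qh t); pose N t := dg_seminorm2 sigma beta (qh t).
have cE : {within `[0, T], continuous E} := cts_energy a0 Vq cq.
have cN : {within `[0, T], continuous N} := @cts_dg_seminorm2 _ m a0 k T qh Vq cq sigma beta.
have N0 t : 0 <= N t by apply: dg_seminorm2_ge0; exact: ltW.
(* The scheme tested with its own solution. *)
have step t : exists l, 0 < t < T -> is_derive t 1 E l /\ l <= - (nu * N t) + A * E t + rho.
  have [tT|] := boolP (0 < t < T); last by exists 0.
  have /andP[t0 tT'] := tT.
  have t0T : 0 < t <= T by rewrite t0 ltW.
  have tcc : 0 <= t <= T by rewrite !ltW.
  have [dq [td eq]] := sol t t0T; exists (2 * ip dq (qh t)) => _; split.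
    exact: (is_derive_energy a0 Vq tT td).
  have Vt := Vq t tcc.
  have hb := b_h_lower_bound poly delta0 cb sQ CB tri Vt nu0 sigma0 beta1 C0 shape (lenH m tri) (fun K f x => supC m K f x (a0 K)).
  have ha := a_h_diag nu sigma beta Vt a0.
  have hr := source_bound poly sQ CB M0 Sfin tri Vt.
  have e := eq (qh t) Vt.
  rewrite /A /E /N; move: hb ha hr e; rewrite -/S -/rho.
  exact: energy_rate.
have /boolp.choice[dE dEP] := step.
have := @gronwall R T A nu rho E N dE T0 A0 (ltW nu0) rho0 cE cN (fun t _ => N0 t)
  (fun t tT => (dEP t tT).1) (fun t tT => (dEP t tT).2).
have iN : leb1.-integrable `[0, T] (EFin \o N).
  by apply: continuous_compact_integrable => //; exact: segment_compact.
have -> : (\int[leb1]_(t in `[0%R, T]) (dg_seminorm2 sigma beta (qh t))%:E = (\int[leb1]_(t in `[0, T]) N t)%R%:E)%E.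
  by rewrite /Rintegral fineK //; refine (integrable_fin_num _ iN); exact: measurable_itv.
by rewrite SE -lee_fin.
Qed.
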